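(* Write $\llbracket2\rrbracket=v+v^{-1}$. In the convolution algebra $\mathbf S^{\imath}$, the elements $\mathbf e_i,\mathbf f_i,\mathbf d_i^{\pm1},\mathbf d_{i+1}^{\pm1}$ $(i\in[1,n-1])$ and $\mathbf t$ satisfy: (a) the defining relations of $\mathbf U(\mathfrak{gl}(n))$: for $i,j\in[1,n-1]$, $a,b\in[1,n]$: $\mathbf d_a\mathbf d_a^{-1}=\mathbf d_a^{-1}\mathbf d_a=1$, $\mathbf d_a\mathbf d_b=\mathbf d_b\mathbf d_a$, $\mathbf d_a\mathbf e_j\mathbf d_a^{-1}=v^{\delta_{a,j}-\delta_{a,j+1}}\mathbf e_j$, $\mathbf d_a\mathbf f_j\mathbf d_a^{-1}=v^{-\delta_{a,j}+\delta_{a,j+1}}\mathbf f_j$, $\mathbf e_i\mathbf f_j-\mathbf f_j\mathbf e_i=\delta_{i,j}\frac{\mathbf d_i\mathbf d_{i+1}^{-1}-\mathbf d_i^{-1}\mathbf d_{i+1}}{v-v^{-1}}$, $\mathbf e_i^2\mathbf e_j+\mathbf e_j\mathbf e_i^2=\llbracket2\rrbracket\mathbf e_i\mathbf e_j\mathbf e_i$ and $\mathbf f_i^2\mathbf f_j+\mathbf f_j\mathbf f_i^2=\llbracket2\rrbracket\mathbf f_i\mathbf f_j\mathbf f_i$ if $|i-j|=1$, $\mathbf e_i\mathbf e_j=\mathbf e_j\mathbf e_i$ and $\mathbf f_i\mathbf f_j=\mathbf f_j\mathbf f_i$ if $|i-j|>1$; (b) $\mathbf d_i\mathbf t=\mathbf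 t\mathbf d_i$ for $i\in[1,n]$; (c) $\mathbf e_i\mathbf t=\mathbf t\mathbf e_i$ and $\mathbf f_i\mathbf t=\mathbf t\mathbf f_i$ for $i\in[1,n-2]$; (d) $\mathbf e_{n-1}^2\mathbf t-\llbracket2\rrbracket\mathbf e_{n-1}\mathbf t\mathbf e_{n-1}+\mathbf t\mathbf e_{n-1}^2=0$; (e) $\mathbf f_{n-1}^2\mathbf t-\llbracket2\rrbracket\mathbf f_{n-1}\mathbf t\mathbf f_{n-1}+\mathbf t\mathbf f_{n-1}^2=0$; (f) $\mathbf t^2\mathbf e_{n-1}-\llbracket2\rrbracket\mathbf t\mathbf e_{n-1}\mathbf t+\mathbf e_{n-1}\mathbf t^2=\mathbf e_{n-1}$; (g) $\mathbf t^2\mathbf f_{n-1}-\llbracket2\rrbracket\mathbf t\mathbf f_{n-1}\mathbf t+\mathbf f_{n-1}\mathbf t^2=\mathbf f_{n-1}$.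
   Context: Let $\mathcal A=\mathbb Z[v,v^{-1}]$, $n,d\ge1$, $N=2n+1$, $D=2d+1$; $[a,b]$ denotes the set of integers from $a$ to $b$, and $|U|=\dim U$. For an odd prime power $q$ equip $\mathbb F_q^D$ with a nondegenerate symmetric bilinear form with isometry group $O(D)$. Let ${}^\imath X$ be the set of flags $V=(0=V_0\subseteq V_1\subseteq\cdots\subseteq V_N=\mathbb F_q^D)$ with $V_i=V_{N-i}^\perp$ for all $i$ and $V_n$ maximal isotropic (so $|V_n|=d$). The $O(D)$-orbits on ${}^\imath X\times{}^\imath X$ are indexed, independently of $q$, by the set ${}^\imath\Xi_d$ of $N\times N$ matrices $A$ over $\{0,1,2,\dots\}$ with $\sum a_{ij}=D$, $a_{ij}=a_{N+1-i,N+1-j}$, $a_{n+1,n+1}=1$ and all other entries of row $n+1$ and column $n+1$ zero: $(V,V')$ corresponds to $a_{ij}=|(V_{i-1}+V_i\cap V'_j)/(V_{i-1}+V_i\cap V'_{j-1})|$. $\mathbf S^{\imath}$ is the $\mathcal A$-module of $O(D)$-invariant $\mathcal A$-valued functions on ${}^\imath X\times{}^\imath X$, free on the characteristic functions of orbits, with convolution product $(f*g)(V,V'')=\sum_{V'}f(V,V')g(V',V'')$, where the structure constants of characteristic functions are the polynomials in $v^2$ whose values at $v=\sqrt q$ give the counts over $\mathbb F_q$ for all odd prime powers $q$. Write $U\overset1\subset W$ if $U\subset W$ has codimension 1. For $V,V'\in{}^\imath X$, $i\in[1,n-1]$, $a\in[1,n]$: $\mathbf e_i(V,V')=v^{-|V'_{i+1}/V'_i|}$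 if $V_i\overset1\subset V'_i$ and $V_j=V'_j$ for all $j\in[1,n]\setminus\{i\}$, else $0$; $\mathbf f_i(V,V')=v^{-|V'_i/V'_{i-1}|}$ if $V'_i\overset1\subset V_i$ and $V_j=V'_j$ for all $j\in[1,n]\setminus\{i\}$, else $0$; $\mathbf d_a^{\pm1}(V,V')=v^{\mp|V'_a/V'_{a-1}|}$ if $V=V'$, else $0$; $\mathbf t(V,V')=v^{-(|V'_n|-|V'_{n-1}|)}$ if $|V_n\cap V'_n|\ge d-1$ and $V_j=V'_j$ for all $j\in[1,n-1]$, else $0$. *)

(* Defs.v *)
From HB Require Import structures.
From mathcomp Require Import all_boot all_order all_algebra.
From mathcomp Require Import sesquilinear.
From mathcomp Require Import boolp.

Set Implicit Arguments.
Unset Strict Implicit.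
Unset Printing Implicit Defensive.

Import GRing.Theory.
Local Open Scope ring_scope.

(** * Laurent polynomials Z[v, v^-1], as the subring of the fraction field of
    Z[v] of the fractions whose denominator is a power of v *)

Definition fracv : {fraction {poly int}} := FracField.tofrac 'X.

Definition is_laurent : pred {fraction {poly int}} :=
  fun x => `[< exists (p : {poly int}) (k : nat),
                 x = FracField.tofrac p / fracv ^+ k >].

Lemma fracv_neq0 : fracv != 0.
Proof. by rewrite /fracv tofrac_eq0 polyX_eq0. Qed.

Fact is_laurent_subring : subring_closed is_laurent.
Proof.
have vk k : fracv ^+ k != 0 by rewrite expf_neq0 ?fracv_neq0.
split=> [|x y|x y].
- by apply/asboolP; exists 1, 0%N; rewrite expr0 divr1 tofrac1.
- move=> /asboolP[p [k ->]] /asboolP[q [l ->]]; apply/asboolP.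
  exists (p * 'X^l - q * 'X^k), (k + l)%N.
  rewrite tofracB !tofracM !tofracXn -[FracField.tofrac 'X]/fracv.
  by rewrite -mulNr addf_div ?vk // exprD mulNr.
- move=> /asboolP[p [k ->]] /asboolP[q [l ->]]; apply/asboolP.
  by exists (p * q), (k + l)%N; rewrite mulf_div exprD tofracM.
Qed.

HB.instance Definition _ :=
  GRing.isSubringClosed.Build {fraction {poly int}} is_laurent
    is_laurent_subring.

Record laurent := Laurent
  { laurent_val :> {fraction {poly int}}; _ : laurent_val \in is_laurent }.

HB.instance Definition _ := [isSub for laurent_val].
HB.instance Definition _ := [Choice of laurent by <:].
HB.instance Definition _ := [SubChoice_isSubComNzRing of laurent by <:].

Fact vpow_subproof (z : int) : fracv ^ z \in is_laurent.
Proof.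
apply/asboolP; case: z => k.
  by exists 'X^k, 0%N; rewrite expr0 divr1 tofracXn.
by exists 1, k.+1; rewrite tofrac1 div1r.
Qed.

Definition vpow (z : int) : laurent := Laurent (vpow_subproof z).

Definition vdbl2 : laurent := vpow 1 + vpow (-1).

Definition eval_v2 (p : {poly int}) : laurent := (map_poly intr p).[vpow 2].

(** * Orthogonal spaces and isotropic flags

    A subspace of F^D is the row space of a square matrix U in the normal form
    <<U>>, so that equality of subspaces is equality of matrices. *)

Record orthogonal_space (d : nat) := OrthogonalSpace {
  os_field :> finFieldType;
  os_odd : odd #|os_field|;
  os_form : 'M[os_field]_(d.*2.+1);
  os_sym : os_form^T = os_form;
  os_nondeg : os_form \in unitmx
}.

Section Flags.

Variables (n d : nat) (E : orthogonal_space d).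

Local Notation N := n.*2.+1.
Local Notation D := d.*2.+1.
Local Notation sub := 'M[E]_D.

Definition perp (U : sub) : sub := orthomx idfun (os_form E) U.

Definition isotropic (U : sub) : bool := (U <= perp U)%MS.

Definition max_isotropic (U : sub) : bool :=
  isotropic U && [forall W : sub, (U <= W)%MS && isotropic W ==> (W <= U)%MS].

(* The condition on the rank of V_n is a consequence of its maximality, since
   the Witt index of a nondegenerate form on F_q^(2d+1), q odd, is d. *)
Definition is_flag (V : {ffun 'I_N.+1 -> sub}) : bool :=
  [&& [forall i, <<V i>>%MS == V i],
      V ord0 == 0,
      V ord_max == 1%:M,
      [forall i : 'I_N, (V (inord i) <= V (inord i.+1))%MS],
      [forall i, (V i == perp (V (rev_ord i)))%MS],
      max_isotropic (V (inord n))
    & \rank (V (inord n)) == d].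

Record flag := Flag { flag_val : {ffun 'I_N.+1 -> sub}; _ : is_flag flag_val }.

HB.instance Definition _ := [isSub for flag_val].
HB.instance Definition _ := [Finite of flag by <:].

Definition fl (V : flag) (i : nat) : sub := flag_val V (inord i).

Definition qdim (W U : sub) : nat := (\rank W - \rank U)%N.

(* Indices of matrices start at 0: the entry (i, j) is a_{i+1,j+1}. *)
Definition relpos (V V' : flag) : 'M['I_D.+1]_N :=
  \matrix_(i < N, j < N)
    inord (qdim (fl V i + fl V i.+1 :&: fl V' j.+1)%MS
                (fl V i + fl V i.+1 :&: fl V' j)%MS).

Definition isometry (g : sub) : bool := g *m os_form E *m g^T == os_form E.

Definition moves (g : sub) (V W : flag) : bool :=
  [forall i : 'I_N.+1, (fl W i == fl V i *m g)%MS].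

End Flags.

Arguments flag n {d} E.

Definition Xi (n d : nat) : {set 'M['I_(d.*2.+2)]_(n.*2.+1)} :=
  [set A : 'M['I_(d.*2.+2)]_(n.*2.+1) |
    [&& (\sum_i \sum_j (A i j : nat))%N == d.*2.+1,
        [forall i, forall j, A i j == A (rev_ord i) (rev_ord j)],
        A (inord n) (inord n) == 1%N :> nat,
        [forall j, (j != inord n) ==> (A (inord n) j == 0%N :> nat)]
      & [forall i, (i != inord n) ==> (A i (inord n) == 0%N :> nat)]]].

(* c A B C is the coefficient of the characteristic function of the orbit C in
   the product of those of the orbits A and B. *)
Definition is_structure_constants (n d : nat)
    (c : 'M['I_(d.*2.+2)]_(n.*2.+1) -> 'M['I_(d.*2.+2)]_(n.*2.+1) ->
         'M['I_(d.*2.+2)]_(n.*2.+1) -> {poly int}) : Prop :=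
  forall (E : orthogonal_space d) A B C,
    A \in Xi n d -> B \in Xi n d -> C \in Xi n d ->
  forall V V'' : flag n E, relpos V V'' = C ->
    (c A B C).[#|E|%:R] =
      #|[set V' : flag n E | (relpos V V' == A) && (relpos V' V'' == B)]|%:R.

(** * The module of invariant functions and the generic convolution

    The module is realised on the flags over an arbitrary E; the product
    depends on E only through the indexing of the orbits by [Xi]. *)

Section Schur.

Variables (n d : nat) (E : orthogonal_space d).

Local Notation N := n.*2.+1.
Local Notation D := d.*2.+1.
Local Notation X := (flag n E).
Local Notation fct := {ffun X * X -> laurent^o}.

Definition invariant : pred fct := fun f =>
  [forall g : 'M[E]_D, isometry g ==>
    [forall V : X, forall V' : X, forall W : X, forall W' : X,
      moves g V W && moves g V' W' ==> (f (W, W') == f (V, V'))]].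

Lemma invariantP (f : fct) :
  reflect (forall g : 'M[E]_D, isometry g -> forall V V' W W' : X,
             moves g V W -> moves g V' W' -> f (W, W') = f (V, V'))
          (f \in invariant).
Proof.
apply: (iffP forallP) => [H g ig V V' W W' m m'|H g].
  have /implyP/(_ ig) := H g.
  move=> /forallP/(_ V)/forallP/(_ V')/forallP/(_ W)/forallP/(_ W').
  by rewrite m m' => /eqP.
apply/implyP=> ig; apply/forallP=> V; apply/forallP=> V'; apply/forallP=> W.
apply/forallP=> W'; apply/implyP=> /andP[m m']; apply/eqP.
exact: (H g ig).
Qed.

Fact invariant_submod : submod_closed invariant.
Proof.
split=> [|a f h /invariantP Hf /invariantP Hh]; apply/invariantP.
  by move=> g ig V V' W W' m m'; rewrite !ffunE.
move=> g ig V V' W W' m m'.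
by rewrite !ffunE (Hf g ig V V' W W') // (Hh g ig V V' W W').
Qed.

HB.instance Definition _ :=
  GRing.isSubmodClosed.Build laurent fct invariant invariant_submod.

Record schur := Schur { schur_val :> fct; _ : schur_val \in invariant }.

HB.instance Definition _ := [isSub for schur_val].
HB.instance Definition _ := [Choice of schur by <:].
HB.instance Definition _ := [SubChoice_isSubLmodule of schur by <:].

Lemma capmx_unit (g A B : 'M[E]_D) :
  g \in unitmx -> ((A *m g) :&: (B *m g) :=: (A :&: B) *m g)%MS.
Proof.
move=> gu; apply/eqmxP; rewrite capmxMr andbT.
have /(submxMr g) := capmxMr (A *m g) (B *m g) (invmx g).
by rewrite !mulmxK // mulmxKV.
Qed.

Lemma isometry_unit (g : 'M[E]_D) : isometry g -> g \in unitmx.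
Proof.
move=> /eqP ig; have := os_nondeg E; rewrite -ig.
by rewrite -mulmxA unitmx_mul => /andP[].
Qed.

Section Move.

Variables (g : 'M[E]_D) (ig : isometry g).
Variables (V V' W W' : X) (mV : moves g V W) (mV' : moves g V' W').

Let eqfl (U Z : X) : moves g U Z -> forall i, (fl Z i :=: fl U i *m g)%MS.
Proof.
move=> /forallP m i; rewrite /fl; have := m (inord i); rewrite /fl inord_val.
by move/eqmxP.
Qed.

Let freeg : row_free g.
Proof. by rewrite row_free_unit; apply: isometry_unit. Qed.

Lemma moves_rank i : \rank (fl W i) = \rank (fl V i).
Proof. by rewrite (eqfl mV i) mxrankMfree. Qed.

Lemma moves_sub i j : (fl W i <= fl W' j)%MS = (fl V i <= fl V' j)%MS.
Proof.
rewrite (eqfl mV i) (eqfl mV' j).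
apply/idP/idP=> [H|]; last exact: submxMr.
have := submxMr (invmx g) H.
by rewrite -!mulmxA mulmxV ?isometry_unit // !mulmx1.
Qed.

Lemma flK (U : X) i : <<fl U i>>%MS = fl U i.
Proof.
by case: U => U /= HU; apply/eqP; have /andP[/forallP h _] := HU; apply: h.
Qed.

Lemma moves_cap i j : \rank (fl W i :&: fl W' j) = \rank (fl V i :&: fl V' j).
Proof.
rewrite (cap_eqmx (eqfl mV i) (eqfl mV' j)).
by rewrite (capmx_unit _ _ (isometry_unit ig)) mxrankMfree.
Qed.

Lemma moves_relpos : relpos W W' = relpos V V'.
Proof.
apply/matrixP=> i j; rewrite !mxE /qdim.
have rk k : \rank (fl W i + fl W i.+1 :&: fl W' k)%MS =
            \rank (fl V i + fl V i.+1 :&: fl V' k)%MS.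
  rewrite (adds_eqmx (eqfl mV i) (cap_eqmx (eqfl mV i.+1) (eqfl mV' k))).
  have e := capmx_unit (fl V i.+1) (fl V' k) (isometry_unit ig).
  by rewrite (adds_eqmx (eqmx_refl _) e) -addsmxMr mxrankMfree.
by rewrite !rk.
Qed.

End Move.

Lemma moves_eq (g : 'M[E]_D) (ig : isometry g) (V V' W W' : X) i :
  moves g V W -> moves g V' W' -> (fl W i == fl W' i) = (fl V i == fl V' i).
Proof.
move=> m m'; have gen (U Z : X) : (fl U i == fl Z i) =
    (fl U i <= fl Z i)%MS && (fl Z i <= fl U i)%MS.
  apply/eqP/idP=> [->|/andP[a b]]; first by rewrite submx_refl.
  by rewrite -(flK U) -(flK Z); apply/genmxP; rewrite a b.
by rewrite !gen (moves_sub ig m m') (moves_sub ig m' m).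
Qed.

Lemma flagP (U Z : X) :
  reflect (U = Z) [forall i : 'I_N.+1, fl U i == fl Z i].
Proof.
apply: (iffP forallP) => [H|-> //]; apply/val_inj/ffunP=> i.
by have /eqP := H i; rewrite /fl inord_val.
Qed.

Lemma moves_flag_eq (g : 'M[E]_D) (ig : isometry g) (V V' W W' : X) :
  moves g V W -> moves g V' W' -> (W == W') = (V == V').
Proof.
move=> m m'.
have fE (U Z : X) : (U == Z) = [forall i : 'I_N.+1, fl U i == fl Z i].
  by apply/eqP/idP => /flagP.
by rewrite !fE; apply: eq_forallb => i; apply: (moves_eq ig).
Qed.

(* The coefficient of f on the characteristic function of the orbit A. *)
Definition coef_at (f : schur) (A : 'M['I_D.+1]_N) : laurent :=
  if [pick p : X * X | relpos p.1 p.2 == A] is Some p then f p else 0.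

Section Convolution.

Variable c : 'M['I_D.+1]_N -> 'M['I_D.+1]_N -> 'M['I_D.+1]_N -> {poly int}.

Definition conv_fun (f h : schur) : fct := [ffun p : X * X =>
  \sum_(A in Xi n d) \sum_(B in Xi n d)
    coef_at f A * coef_at h B * eval_v2 (c A B (relpos p.1 p.2))].

Fact conv_inv f h : conv_fun f h \in invariant.
Proof.
apply/invariantP=> g ig V V' W W' m m'; rewrite !ffunE /=.
by rewrite (moves_relpos ig m m').
Qed.

Definition conv (f h : schur) : schur := Schur (conv_inv f h).

End Convolution.

Definition one_fun : fct :=
  [ffun p : X * X => if p.1 == p.2 then 1 else 0].

Definition codim1 (U W : 'M[E]_D) : bool :=
  (U <= W)%MS && (\rank W == (\rank U).+1).

Definition agree_off (i : nat) (V V' : X) : bool :=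
  [forall j : 'I_n.+1, (0 < j)%N && (j != i :> nat) ==> (fl V j == fl V' j)].

Definition e_fun (i : nat) : fct := [ffun p : X * X =>
  let: (V, V') := p in
  if codim1 (fl V i) (fl V' i) && agree_off i V V'
  then vpow (- (qdim (fl V' i.+1) (fl V' i))%:Z) else 0].

Definition f_fun (i : nat) : fct := [ffun p : X * X =>
  let: (V, V') := p in
  if codim1 (fl V' i) (fl V i) && agree_off i V V'
  then vpow (- (qdim (fl V' i) (fl V' i.-1))%:Z) else 0].

Definition d_fun (a : nat) : fct := [ffun p : X * X =>
  let: (V, V') := p in
  if V == V' then vpow (- (qdim (fl V' a) (fl V' a.-1))%:Z) else 0].

Definition dinv_fun (a : nat) : fct := [ffun p : X * X =>
  let: (V, V') := p in
  if V == V' then vpow (qdim (fl V' a) (fl V' a.-1))%:Z else 0].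

Definition t_fun : fct := [ffun p : X * X =>
  let: (V, V') := p in
  if (d.-1 <= \rank (fl V n :&: fl V' n))%N && agree_off n V V'
  then vpow (- (qdim (fl V' n) (fl V' n.-1))%:Z) else 0].

Lemma moves_agree_off (g : 'M[E]_D) (ig : isometry g) (V V' W W' : X) i :
  moves g V W -> moves g V' W' -> agree_off i W W' = agree_off i V V'.
Proof.
move=> m m'; apply: eq_forallb => j.
by rewrite (moves_eq ig j m m').
Qed.

Lemma moves_codim1 (g : 'M[E]_D) (ig : isometry g) (V V' W W' : X) i :
  moves g V W -> moves g V' W' ->
  codim1 (fl W i) (fl W' i) = codim1 (fl V i) (fl V' i).
Proof.
by move=> m m'; rewrite /codim1 (moves_sub ig m m') !(moves_rank ig m)
  !(moves_rank ig m').
Qed.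

Fact one_inv : one_fun \in invariant.
Proof.
apply/invariantP=> g ig V V' W W' m m'.
by rewrite !ffunE /= (moves_flag_eq ig m m').
Qed.

Fact e_inv i : e_fun i \in invariant.
Proof.
apply/invariantP=> g ig V V' W W' m m'; rewrite !ffunE /qdim.
by rewrite (moves_codim1 ig _ m m') (moves_agree_off ig _ m m')
  !(moves_rank ig m').
Qed.

Fact f_inv i : f_fun i \in invariant.
Proof.
apply/invariantP=> g ig V V' W W' m m'; rewrite !ffunE /qdim.
by rewrite (moves_codim1 ig _ m' m) (moves_agree_off ig _ m m')
  !(moves_rank ig m').
Qed.

Fact d_inv a : d_fun a \in invariant.
Proof.
apply/invariantP=> g ig V V' W W' m m'; rewrite !ffunE /qdim.
by rewrite (moves_flag_eq ig m m') !(moves_rank ig m').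
Qed.

Fact dinv_inv a : dinv_fun a \in invariant.
Proof.
apply/invariantP=> g ig V V' W W' m m'; rewrite !ffunE /qdim.
by rewrite (moves_flag_eq ig m m') !(moves_rank ig m').
Qed.

Fact t_inv : t_fun \in invariant.
Proof.
apply/invariantP=> g ig V V' W W' m m'; rewrite !ffunE /qdim.
by rewrite (moves_cap ig m m') (moves_agree_off ig _ m m')
  !(moves_rank ig m').
Qed.

Definition one_elt : schur := Schur one_inv.
Definition e_elt (i : nat) : schur := Schur (e_inv i).
Definition f_elt (i : nat) : schur := Schur (f_inv i).
Definition d_elt (a : nat) : schur := Schur (d_inv a).
Definition dinv_elt (a : nat) : schur := Schur (dinv_inv a).
Definition t_elt : schur := Schur t_inv.

End Schur.

Arguments one_elt n {d} E.
Arguments e_elt n {d} E.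
Arguments f_elt n {d} E.
Arguments d_elt n {d} E.
Arguments dinv_elt n {d} E.
Arguments t_elt n {d} E.

Notation "x *[ c ] y" := (conv c x y)
  (at level 40, c at level 200, left associativity,
   format "x  *[ c ]  y") : ring_scope.

(* Main.v *)
(** Fix an odd prime p and v = sqrt p.  Specialised at v, the product of S^i is
    the product of matrices indexed by the flags of an orthogonal space over F_p,
    because all orbits of Xi occur over every odd finite field (a pair of flags
    of given relative position is spanned by parts of a hyperbolic basis).  A
    Laurent polynomial vanishing at sqrt p for all odd primes p is zero, so it
    suffices to prove the relations for these matrices.

    There each generator is a 0/1 matrix changing a single term of the flag,
    scaled by a power of v that depends only on dimensions, and the relations
    reduce to counting the possible intermediate flags.  The relations of type
    Serre, including those with e_(n-1) or f_(n-1) twice and t once, amount to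
    the q + 1 lines of a plane, of which exactly one lies in a given hyperplane
    not containing the plane.  The relations with t twice amount to counting the
    maximal isotropic subspaces W adjacent to two given ones M and M': if M and
    M' differ, each such W contains their intersection and there are q + 1 or no
    W in all, while each hyperplane of M lies in q such W other than M.  The cubic
    relations for f follow from those for e by transposition. *)

From HB Require Import structures.
Require Import Defs.
From mathcomp Require Import all_boot all_order all_algebra all_field.
From mathcomp Require Import mxabelem sesquilinear boolp zify ring.

Set Implicit Arguments.
Unset Strict Implicit.
Unset Printing Implicit Defensive.

Import GRing.Theory Num.Theory.
Local Open Scope ring_scope.

(** * Orthogonal geometry *)

(** Every relation is homogeneous: a step changes the jumps of dimension along a flag by constants,
    so all powers of v can be evaluated at the source of a path. Removing them leaves an identity
    between numbers of paths over the naturals, free of subtraction, such as (q + 1) c3 = q c1 + c2.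
    In (f) and (g) one more term with a power of q occurs. It comes from the paths with M = M': the
    hyperplanes of M containing the (n-1)-st term form a geometric sum, which loses one power of q
    when that term grows by a dimension.

    The obstacle in the passage to F_p is that the relations concern flags over the given E, while
    products are defined by coefficients on orbits. The generators depend on the relative position
    alone, because they only test dimensions of intersections, and the matrix of a pair determines
    all of these. Conversely, each matrix must occur over E. A hyperbolic basis is therefore built
    from the Lagrangian term of a flag over E; if there is no such flag, all functions live on the
    empty set and the relations hold trivially. *)

Lemma submx_rank_geq (F : fieldType) m1 m2 n (A : 'M[F]_(m1, n)) (B : 'M[F]_(m2, n)) :
  (A <= B)%MS -> (\rank B <= \rank A)%N -> (B <= A)%MS.
Proof. by move=> AB rB; rewrite -(mxrank_leqif_sup AB) eqn_leq mxrankS. Qed.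

Section Perp.
Variables (d : nat) (E : orthogonal_space d).
Local Notation D := d.*2.+1.
Local Notation sub := 'M[E]_D.
Local Notation q := #|E|.
Implicit Types A B H L M U W X Y : sub.

Lemma sub_perp m (X : 'M[E]_(m, D)) U :
  (X <= perp U)%MS = (X *m os_form E *m U^T == 0).
Proof.
rewrite /perp /orthomx map_mx_id //.
by rewrite -mulmxA; apply/sub_kermxP/eqP.
Qed.

Lemma perp_sym U W : (U <= perp W)%MS = (W <= perp U)%MS.
Proof.
rewrite !sub_perp -trmx_eq0 !trmx_mul trmxK os_sym.
by rewrite mulmxA.
Qed.

Lemma rank_perp U : \rank (perp U) = (D - \rank U)%N.
Proof.
rewrite /perp /orthomx map_mx_id // mxrank_ker -(mxrank_tr (_ *m _)) trmx_mul.
by rewrite trmxK os_sym mxrankMfree // row_free_unit os_nondeg.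
Qed.

Lemma rank_le_dim U : (\rank U <= D)%N.
Proof. exact: rank_leq_row. Qed.

Lemma perpK U : (perp (perp U) :=: U)%MS.
Proof.
apply/eqmx_sym/eqmxP; rewrite -mxrank_leqif_eq; last by rewrite perp_sym submx_refl.
by rewrite !rank_perp subKn ?rank_le_dim.
Qed.

Lemma perpS U W : (perp U <= perp W)%MS = (W <= U)%MS.
Proof. by rewrite perp_sym perpK. Qed.

Lemma eqmx_perp U W : (U :=: W)%MS -> (perp U :=: perp W)%MS.
Proof. by move=> e; apply/eqmxP; rewrite !perpS !e submx_refl. Qed.

Lemma sub_perp_adds X U W :
  (X <= perp (U + W)%MS)%MS = (X <= perp U)%MS && (X <= perp W)%MS.
Proof. by rewrite perp_sym addsmx_sub !(perp_sym X). Qed.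

Lemma perp_adds U W : (perp (U + W)%MS :=: perp U :&: perp W)%MS.
Proof.
apply/eqmxP; rewrite sub_capmx -sub_perp_adds submx_refl /=.
by rewrite sub_perp_adds capmxSl capmxSr.
Qed.

Lemma isotropicS U W : (U <= W)%MS -> isotropic W -> isotropic U.
Proof.
by move=> UW iW; rewrite /isotropic (submx_trans UW) // (submx_trans iW) // perpS.
Qed.

Lemma isotropic_eqmx U W : (U :=: W)%MS -> isotropic U = isotropic W.
Proof. by move=> e; apply/idP/idP; apply: isotropicS; rewrite e. Qed.

Lemma isotropic_adds U W :
  isotropic (U + W)%MS = [&& isotropic U, isotropic W & (U <= perp W)%MS].
Proof.
rewrite /isotropic addsmx_sub !(sub_perp_adds _ U W) (perp_sym W U).
by case: (U <= perp W)%MS; rewrite ?andbT ?andbF.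
Qed.

Lemma isotropic_rank U : isotropic U -> (\rank U <= d)%N.
Proof. by move/mxrankS; rewrite rank_perp; have := rank_le_dim U; lia. Qed.

Definition lagrangian W := isotropic W && (\rank W == d).

(** The sum Y + M is again isotropic, so its dimension is at most d and adding Y does not enlarge
    M. *)
Lemma lagr_sub_perp M Y :
  lagrangian M -> isotropic Y -> (Y <= perp M)%MS -> (Y <= M)%MS.
Proof.
move=> /andP[iM /eqP rM] iY YM.
have /isotropic_rank : isotropic (Y + M)%MS by rewrite isotropic_adds iY iM.
move=> h; have : (Y + M <= M)%MS by apply: submx_rank_geq (addsmxSr _ _) _; rewrite rM.
by rewrite addsmx_sub => /andP[].
Qed.

Lemma lagr_max M : lagrangian M -> max_isotropic M.
Proof.
move=> lM; rewrite /max_isotropic; have /andP[-> _] := lM.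
apply/forallP=> W; apply/implyP=> /andP[MW iW]; apply: lagr_sub_perp => //.
by rewrite perp_sym (submx_trans MW).
Qed.

End Perp.

(** * Counting the subspaces between two given ones *)

Section Count.
Variables (d : nat) (E : orthogonal_space d).
Local Notation D := d.*2.+1.
Local Notation sub := 'M[E]_D.
Local Notation q := #|E|.
Implicit Types A B H L M U W X Y : sub.

Lemma eq_genmx_normal U W : <<U>>%MS = U -> <<W>>%MS = W -> (U :=: W)%MS -> U = W.
Proof. by move=> gU gW /eq_genmx; rewrite gU gW. Qed.

Lemma card_gt1 : (1 < q)%N.
Proof. exact: card_finNzRing_gt1. Qed.

(** Requiring the normal form selects one matrix per subspace, so that cardinals of such sets count
    subspaces. *)
Definition covers A B : {set sub} :=
  [set U : sub | [&& <<U>>%MS == U, codim1 A U & (U <= B)%MS]].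

Lemma rank_addsmx_row A (v : 'rV[E]_D) : 
  ~~ (v <= A)%MS -> \rank (A + v)%MS = (\rank A).+1.
Proof.
move=> vA; apply/eqP; rewrite eqn_leq; apply/andP; split.
  have [h _] := mxrank_adds_leqif A v; apply: leq_trans h _.
  by rewrite -(addn1 (\rank A)) leq_add2l rank_leq_row.
rewrite ltnNge; apply: contra vA => /(submx_rank_geq (addsmxSl A v)).
by rewrite addsmx_sub => /andP[].
Qed.

Lemma codim1_addsmx A U (v : 'rV[E]_D) : codim1 A U -> (v <= U)%MS ->
  ~~ (v <= A)%MS -> (A + v :=: U)%MS.
Proof.
move=> /andP[AU /eqP rU] vU vA; apply/eqmxP.
have h : (A + v <= U)%MS by rewrite addsmx_sub AU.
by rewrite h submx_rank_geq // rU rank_addsmx_row.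
Qed.

(** Each vector of B outside A generates with A exactly one cover, and a cover U contains q^(dim A +
    1) - q^(dim A) of them. The shape of the equation avoids dividing by q - 1. *)
Lemma card_covers A B : (A <= B)%MS ->
  (#|covers A B| * q.-1 + 1 = q ^ (\rank B - \rank A))%N.
Proof.
move=> AB.
have rD (U : sub) : (A <= U)%MS ->
    #|rowg U :\: rowg A| = (q ^ \rank U - q ^ \rank A)%N.
  by move=> AU; rewrite cardsD (setIidPr _) ?rowgS // !card_rowg.
have part : (q ^ \rank B - q ^ \rank A
             = #|covers A B| * (q ^ (\rank A).+1 - q ^ \rank A))%N.
  rewrite -rD // -sum1_card.
  rewrite (partition_big (fun v : 'rV[E]_D => <<(A + v)%MS>>%MS) (mem (covers A B))) /=.
    rewrite -sum_nat_const; apply: eq_bigr => U; rewrite inE => /and3P[/eqP gU cU UB].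
    have /andP[AU /eqP rU] := cU.
    rewrite -rU -rD // -sum1_card; apply: eq_bigl => v; rewrite !inE.
    apply/andP/andP => [[/andP[vA vB] /eqP e]|[vA vU]].
      by rewrite vA; split=> //; rewrite -e genmxE addsmxSr.
    rewrite vA (submx_trans vU) //; split=> //; apply/eqP.
    by rewrite -gU; apply/eq_genmx/codim1_addsmx.
  move=> v; rewrite !inE => /andP[vA vB]; rewrite genmx_id eqxx /= /codim1.
  by rewrite !genmxE addsmx_sub addsmxSl AB vB rank_addsmx_row ?eqxx.
have q0 : (0 < q)%N by have := card_gt1; lia.
have rAB := mxrankS AB.
have : (q ^ \rank A * (#|covers A B| * q.-1 + 1) = q ^ \rank A * q ^ (\rank B - \rank A))%N.
  rewrite -expnD subnKC // -(subnK (_ : q ^ \rank A <= q ^ \rank B)%N).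
    by rewrite part expnS -{2}(prednK q0); nia.
  by rewrite leq_pexp2l.
by move/eqP; rewrite eqn_pmul2l ?expn_gt0 ?q0 // => /eqP.
Qed.

Definition cocovers A B : {set sub} :=
  [set U : sub | [&& <<U>>%MS == U, (A <= U)%MS & codim1 U B]].

(** Passing to orthogonals is a bijection onto the covers of [perp B] inside [perp A]. *)
Lemma card_cocovers A B : (A <= B)%MS ->
  (#|cocovers A B| * q.-1 + 1 = q ^ (\rank B - \rank A))%N.
Proof.
move=> AB.
have pgK : {in cocovers A B, cancel (fun U : sub => <<perp U>>%MS) (fun U : sub =>
  <<perp U>>%MS)}.
  move=> U; rewrite inE => /and3P[/eqP gU _ _].
  apply: eq_genmx_normal; rewrite ?genmx_id // .
  by apply: eqmx_trans (genmxE _) _; apply: eqmx_trans (eqmx_perp (genmxE _)) _; apply: perpK.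
rewrite -(card_in_imset (can_in_inj pgK)).
have -> : [set <<perp U>>%MS | U in cocovers A B] = covers (perp B) (perp A).
  apply/setP => W; apply/imsetP/idP => [[U UAB ->]|].
    move: UAB; rewrite !inE => /and3P[gU AU /andP[UB /eqP rB]].
    rewrite genmx_id eqxx /codim1 !genmxE !perpS AU UB /= !rank_perp.
    by have := rank_le_dim B; lia.
  rewrite inE => /and3P[/eqP gW /andP[BW /eqP rW] WA].
  exists <<perp W>>%MS.
    rewrite inE genmx_id eqxx /codim1 !genmxE /= perp_sym WA /=.
    rewrite -(perpK B) perpS BW /=.
    move: rW; rewrite ?(perpK B) !rank_perp; have := rank_le_dim B; have := rank_le_dim W.
    lia.
  apply: eq_genmx_normal => //; first by rewrite genmx_id.
  apply/eqmx_sym.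
  by apply: eqmx_trans (genmxE _) _; apply: eqmx_trans (eqmx_perp (genmxE _)) _; apply: perpK.
rewrite card_covers ?perpS // !rank_perp.
by congr (_ ^ _)%N; have := mxrankS AB; have := rank_le_dim B; lia.
Qed.

Lemma card_covers2 A B : (A <= B)%MS -> \rank B = (\rank A).+2 -> #|covers A B| = q.+1.
Proof.
move=> AB rB; have := card_covers AB; rewrite rB.
have -> : ((\rank A).+2 - \rank A = 2)%N by lia.
have := card_gt1; rewrite expnS expn1; move: #|covers A B| q => k m; nia.
Qed.

End Count.

(** * The bilinear form on vectors *)

Section Bilinear.
Variables (d : nat) (E : orthogonal_space d).
Local Notation D := d.*2.+1.
Local Notation sub := 'M[E]_D.
Local Notation rv := 'rV[E]_D.
Local Notation q := #|E|.
Implicit Types A B H L M U W X Y : sub.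

Definition bilin (u v : rv) : E := (u *m os_form E *m v^T) 0 0.

Lemma bfC u v : bilin u v = bilin v u.
Proof.
rewrite /bilin -[in LHS](trmxK (u *m _ *m _)) [LHS]mxE !trmx_mul trmxK os_sym.
by rewrite mulmxA.
Qed.

Lemma bfDl u v w : bilin (u + v) w = bilin u w + bilin v w.
Proof. by rewrite /bilin !mulmxDl mxE. Qed.

Lemma bfZl a u w : bilin (a *: u) w = a * bilin u w.
Proof. by rewrite /bilin -!scalemxAl mxE. Qed.

Lemma bfDr u v w : bilin w (u + v) = bilin w u + bilin w v.
Proof. by rewrite !(bfC w) bfDl. Qed.

Lemma bfZr a u w : bilin w (a *: u) = a * bilin w u.
Proof. by rewrite !(bfC w) bfZl. Qed.

Lemma bf_sub_perp u v X : (u <= X)%MS -> (v <= perp X)%MS -> bilin u v = 0.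
Proof.
move=> /submxP[C ->]; rewrite bfC sub_perp /bilin trmx_mul mulmxA => /eqP->.
by rewrite mul0mx mxE.
Qed.

Lemma row_sub_perp_adds (v m : rv) H :
  (v <= perp (H + m)%MS)%MS = (v <= perp H)%MS && (bilin m v == 0).
Proof.
have e (U : sub) : (v <= perp U)%MS = (U <= kermx (os_form E *m v^T))%MS.
  rewrite sub_perp -trmx_eq0 !trmx_mul trmxK os_sym.
  by apply/eqP/sub_kermxP.
rewrite !e addsmx_sub; congr (_ && _).
rewrite /bilin -mulmxA; apply/sub_kermxP/eqP => [->|h]; first by rewrite mxE.
by apply/matrixP=> i j; rewrite !ord1 h mxE.
Qed.

(** In characteristic 2 the cardinal of the field is a power of 2; being odd, it would be 1. *)
Lemma two_neq0 : 2%:R != 0 :> E.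
Proof.
apply/negP=> e2; have c2 : 2%N \in [pchar E] by rewrite inE /= e2.
have := os_odd E; rewrite (card_pprimeChar c2) oddX orbF => /eqP n0.
by have := card_gt1 E; rewrite (card_pprimeChar c2) n0.
Qed.
End Bilinear.

(** * Lagrangians through a hyperplane H of a Lagrangian M *)

Section Lagr.
Variables (d : nat) (E : orthogonal_space d).
Local Notation D := d.*2.+1.
Local Notation sub := 'M[E]_D.
Local Notation rv := 'rV[E]_D.
Local Notation q := #|E|.
Implicit Types A B H L M U W X Y : sub.

Lemma lagr_rank M : lagrangian M -> \rank M = d.
Proof. by case/andP=> _ /eqP. Qed.

Lemma lagr_iso M : lagrangian M -> isotropic M.
Proof. by case/andP. Qed.

Lemma lagr_eqmx M W : (M :=: W)%MS -> lagrangian M = lagrangian W.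
Proof. by move=> e; rewrite /lagrangian (isotropic_eqmx e) e. Qed.

Lemma lagr_eq M W : <<M>>%MS = M -> <<W>>%MS = W -> lagrangian M -> lagrangian W ->
  (M <= W)%MS -> M = W.
Proof.
move=> gM gW lM lW MW; apply: eq_genmx_normal => //; apply/eqmxP.
by rewrite MW submx_rank_geq // (lagr_rank lM) (lagr_rank lW).
Qed.

Definition lagr_over A := [set W : sub | [&& <<W>>%MS == W, lagrangian W & (A <= W)%MS]].

Lemma codim1_row H M : codim1 H M -> exists m : rv,
  [/\ (m <= M)%MS, ~~ (m <= H)%MS & (H + m :=: M)%MS].
Proof.
move=> cM; have /andP[HM /eqP rM] := cM.
have /row_subPn[i Hi] : ~~ (M <= H)%MS.
  by apply/negP => /mxrankS; rewrite rM ltnn.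
exists (row i M); split=> //; first exact: row_sub.
by apply: codim1_addsmx; rewrite ?row_sub.
Qed.

Lemma codim1_cap H M W : codim1 H M -> (H <= W)%MS -> ~~ (M <= W)%MS ->
  (M :&: W :=: H)%MS.
Proof.
move=> /andP[HM /eqP rM] HW nMW; apply/eqmx_sym/eqmxP.
have h : (H <= M :&: W)%MS by rewrite sub_capmx HM.
rewrite h submx_rank_geq //.
rewrite -ltnS -rM ltnNge; apply: contra nMW => le.
by apply: submx_trans (capmxSr M W); apply: submx_rank_geq le; apply: capmxSl.
Qed.

(** The Lagrangians over H are counted by the map W to M + W, with values in the lines of the plane
    [perp H] / M. The line [perp M] / M is avoided: W inside [perp M] would lie in M. *)
Lemma lagr_over_join H M W : lagrangian M -> codim1 H M -> <<M>>%MS = M ->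
  W \in lagr_over H :\ M ->
  <<(M + W)%MS>>%MS \in covers M (perp H) :\ <<perp M>>%MS.
Proof.
move=> lM cHM gM; have /andP[HM /eqP rHM] := cHM.
rewrite !inE => /and4P[nWM /eqP gW lW HW].
have nMW : ~~ (M <= W)%MS.
  by apply: contra nWM => /(lagr_eq gM gW lM lW)->.
have rS : \rank (M + W)%MS = (\rank M).+1.
  have := mxrank_sum_cap M W; rewrite (codim1_cap cHM HW nMW).
  by have := lagr_rank lM; have := lagr_rank lW; lia.
rewrite genmx_id eqxx /codim1 !genmxE addsmxSl rS eqxx addsmx_sub /=.
apply/andP; split.
  apply: contra nMW => /eqP e; rewrite submx_rank_geq //; last first.
    by rewrite (lagr_rank lM) (lagr_rank lW).
  apply: lagr_sub_perp (lagr_iso lW) _ => //.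
  have : (<<(M + W)%MS>> <= perp M)%MS by rewrite e genmxE.
  by rewrite genmxE addsmx_sub => /andP[].
rewrite !(perp_sym _ H) (submx_trans HM (lagr_iso lM)).
exact: submx_trans HW (lagr_iso lW).
Qed.

Lemma iso_bf Y u v : isotropic Y -> (u <= Y)%MS -> (v <= Y)%MS -> bilin u v = 0.
Proof. by move=> iY uY vY; apply: bf_sub_perp uY _; apply: submx_trans iY. Qed.

Lemma codim1_lagr H M W : lagrangian M -> lagrangian W -> codim1 H M -> (H <= W)%MS ->
  codim1 H W.
Proof.
move=> lM lW /andP[_ /eqP rM] HW.
by rewrite /codim1 HW -rM (lagr_rank lM) (lagr_rank lW) eqxx.
Qed.

(** If m and w were orthogonal, all of W would be orthogonal to M, hence contained in it. *)
Lemma lagr_bf_neq0 H M W (m w : rv) : lagrangian M -> lagrangian W -> (H + m :=: M)%MS ->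
  (H + w :=: W)%MS ->
  ~~ (W <= M)%MS -> bilin m w != 0.
Proof.
move=> lM lW eM eW; apply: contra => /eqP b0.
have HW : (H <= W)%MS by rewrite -eW addsmxSl.
have wW : (w <= W)%MS by rewrite -eW addsmxSr.
have HM : (H <= M)%MS by rewrite -eM addsmxSl.
apply: lagr_sub_perp (lagr_iso lW) _ => //; rewrite -eW addsmx_sub.
rewrite (submx_trans HM (lagr_iso lM)) -(eqmx_perp eM) row_sub_perp_adds b0 eqxx andbT.
by rewrite (submx_trans wW) // perp_sym (submx_trans HW (lagr_iso lW)).
Qed.

(* In a plane M + W with W <> M the form is hyperbolic modulo H, so that M / H
   and W / H are its only isotropic lines. *)
Lemma lagr_over_join_inj H M : lagrangian M -> codim1 H M -> <<M>>%MS = M ->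
  {in lagr_over H :\ M &, injective (fun W => <<(M + W)%MS>>%MS)}.
Proof.
move=> lM cHM gM W W'; have /andP[HM /eqP rHM] := cHM.
rewrite !inE => /and4P[nWM /eqP gW lW HW] /and4P[nWM' /eqP gW' lW' HW'] eJ.
have nM Y : <<Y>>%MS = Y -> lagrangian Y -> Y != M -> ~~ (Y <= M)%MS.
  by move=> gY lY; apply: contra => /(lagr_eq gY gM lY lM)->.
have [m [mM nmH eM]] := codim1_row cHM.
have [w [wW nwH eW]] := codim1_row (codim1_lagr lM lW cHM HW).
have [w' [wW' nwH' eW']] := codim1_row (codim1_lagr lM lW' cHM HW').
have b0 := lagr_bf_neq0 lM lW eM eW (nM W gW lW nWM).
have : (w' <= (H + m) + w)%MS.
  have : (w' <= <<(M + W)%MS>>)%MS by rewrite eJ genmxE (submx_trans wW') ?addsmxSr.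
  rewrite genmxE => h; apply: submx_trans h _; rewrite addsmx_sub -eM -eW addsmxSl /=.
  by rewrite addsmx_sub addsmxSr (submx_trans (addsmxSl H m)) ?addsmxSl.
case/sub_addsmxP => -[u1 u2] /= ew'.
have : (u1 *m (H + m)%MS <= H + m)%MS by apply: submxMl.
case/sub_addsmxP => -[u3 u4] /= eu1; rewrite {}eu1 in ew'.
rewrite [u4]mx11_scalar [u2]mx11_scalar !mul_scalar_mx in ew'.
set a := u4 0 0 in ew'; set b := u2 0 0 in ew'; set h := u3 *m H in ew'.
have hH : (h <= H)%MS by apply: submxMl.
have iW := lagr_iso lW; have iW' := lagr_iso lW'; have iM := lagr_iso lM.
have e1 : bilin w' m = b * bilin m w.
  rewrite ew' !bfDl !bfZl (iso_bf iM (submx_trans hH HM) mM) (iso_bf iM mM mM).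
  by rewrite (bfC w m); ring.
have e2 : bilin w' w = a * bilin m w.
  by rewrite ew' !bfDl !bfZl (iso_bf iW (submx_trans hH HW) wW) (iso_bf iW wW wW); ring.
(* Expanding w' = h + a m + b w gives 2 a b times [bilin m w]. If a = 0, then w' lies in W and W' =
   W; if b = 0, it lies in M, which is excluded. *)
have : bilin w' w' == 0 by rewrite (iso_bf iW' wW' wW').
rewrite {2}ew' !bfDr !bfZr e1 e2 (iso_bf iW' wW' (submx_trans hH HW')).
have -> : 0 + a * (b * bilin m w) + b * (a * bilin m w) = 2%:R * (a * b) * bilin m w by ring.
rewrite !mulf_eq0 (negPf (two_neq0 E)) (negPf b0) /= orbF => /orP[]/eqP z.
  apply/esym/lagr_eq => //; rewrite -eW' addsmx_sub HW ew' z scale0r addr0 addmx_sub //.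
    exact: submx_trans hH HW.
  exact: scalemx_sub.
have := nM W' gW' lW' nWM'; rewrite -eW' addsmx_sub HM ew' z scale0r addr0 addmx_sub //.
  exact: submx_trans hH HM.
exact: scalemx_sub.
Qed.

Lemma lagr_over_join_surj H M L : lagrangian M -> codim1 H M -> <<M>>%MS = M ->
  L \in covers M (perp H) :\ <<perp M>>%MS ->
  exists2 W, W \in lagr_over H :\ M & <<(M + W)%MS>>%MS = L.
Proof.
move=> lM cHM gM; have /andP[HM /eqP rHM] := cHM.
rewrite !inE => /and4P[nL /eqP gL cML LH].
have [m [mM nmH eM]] := codim1_row cHM.
have [v [vL nvM eL]] := codim1_row cML.
have iM := lagr_iso lM.
have vH : (v <= perp H)%MS := submx_trans vL LH.
(* Otherwise v, and with it L, would be orthogonal to M, so that L would be [perp M]. *)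
have b0 : bilin m v != 0.
  apply: contra nL => /eqP b0; apply/eqP/eq_genmx_normal; rewrite ?genmx_id //.
  apply/eqmx_sym; apply: eqmx_trans (genmxE _) _; apply/eqmx_sym/eqmxP.
  have h : (L <= perp M)%MS.
    by rewrite -eL addsmx_sub -/(isotropic M) iM -(eqmx_perp eM) row_sub_perp_adds vH b0 eqxx.
  rewrite h submx_rank_geq // rank_perp; have /andP[_ /eqP->] := cML.
  by rewrite (lagr_rank lM); clear; lia.
(* For w = v - c m the norm is (v, v) - 2 c (m, v), because m is isotropic; c is chosen to make it
   vanish. *)
pose w := v - (bilin v v / (2%:R * bilin m v)) *: m.
have ww : bilin w w = 0.
  rewrite /w -scaleNr !bfDl !bfDr !bfZl !bfZr (iso_bf iM mM mM) (bfC v m).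
  by field; rewrite b0 two_neq0.
have wH : (w <= perp H)%MS.
  rewrite addmx_sub // -scaleNr scalemx_sub // (submx_trans mM) //.
  by rewrite perp_sym (submx_trans HM iM).
have nwM : ~~ (w <= M)%MS.
  apply: contra nvM => wM; rewrite -(subrK ((bilin v v / (2%:R * bilin m v)) *: m) v).
  by rewrite addmx_sub // scalemx_sub.
have nwH : ~~ (w <= H)%MS by apply: contra nwM => /submx_trans->.
have rW : \rank (H + w)%MS = d by rewrite rank_addsmx_row // -rHM (lagr_rank lM).
have iH : isotropic H := isotropicS HM iM.
have iW : isotropic (H + w)%MS.
  rewrite /isotropic addsmx_sub; apply/andP; split; last first.
    by rewrite row_sub_perp_adds wH ww eqxx.
  by rewrite perp_sym addsmx_sub wH andbT; apply: iH.
exists <<(H + w)%MS>>%MS.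
  rewrite !inE genmx_id eqxx (lagr_eqmx (genmxE _)) /lagrangian iW rW eqxx genmxE addsmxSl
    !andbT.
  by apply: contra nwM => /eqP<-; rewrite genmxE addsmxSr.
apply: eq_genmx_normal; rewrite ?genmx_id //.
apply: eqmx_trans (genmxE _) _; apply: eqmx_trans (adds_eqmx (eqmx_refl _) (genmxE _)) _.
apply: eqmx_trans eL; apply/eqmxP; rewrite !addsmx_sub !addsmxSl /=.
rewrite (submx_trans HM) ?addsmxSl //=; apply/andP; split.
  rewrite addmx_sub ?addsmxSr // -scaleNr scalemx_sub //.
  by rewrite (submx_trans mM) ?addsmxSl.
rewrite -(subrK ((bilin v v / (2%:R * bilin m v)) *: m) v) addmx_sub //.
  by rewrite (submx_trans (addsmxSr H w)) ?addsmxSr.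
by rewrite scalemx_sub // (submx_trans mM) ?addsmxSl.
Qed.

(** Of the q + 1 lines of the plane [perp H] / M, all but [perp M] / M are of the form (M + W) / M,
    each for a single W. *)
Lemma card_lagr_over H M : lagrangian M -> codim1 H M -> <<M>>%MS = M ->
  #|lagr_over H :\ M| = q.
Proof.
move=> lM cHM gM; have /andP[HM /eqP rHM] := cHM.
rewrite -(card_in_imset (lagr_over_join_inj lM cHM gM)).
have -> : [set <<(M + W)%MS>>%MS | W in lagr_over H :\ M] =
          covers M (perp H) :\ <<perp M>>%MS.
  apply/setP=> L; apply/imsetP/idP => [[W WH ->]|]; first exact: lagr_over_join.
  by case/(lagr_over_join_surj lM cHM gM) => W WH <-; exists W.
have MH : (M <= perp H)%MS by rewrite perp_sym (submx_trans HM (lagr_iso lM)).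
have := card_covers2 MH; rewrite rank_perp (lagr_rank lM).
have -> : (D - \rank H = d.+2)%N by have := lagr_rank lM; lia.
move=> /(_ erefl); rewrite (cardsD1 <<perp M>>%MS (covers M (perp H))).
suff -> : <<perp M>>%MS \in covers M (perp H) by rewrite add1n => -[].
rewrite inE genmx_id eqxx /codim1 !genmxE perpS HM rank_perp [(M <= perp M)%MS]lagr_iso //.
by rewrite (lagr_rank lM) andbT; clear; lia.
Qed.

End Lagr.

(** * Common neighbours of two maximal isotropic subspaces *)

Section Common.
Variables (d : nat) (hd : (0 < d)%N) (E : orthogonal_space d).
Local Notation D := d.*2.+1.
Local Notation sub := 'M[E]_D.
Local Notation rv := 'rV[E]_D.
Local Notation q := #|E|.
Implicit Types A B H L M U W X Y : sub.

(** For Lagrangians this includes U = W: a step of t may stay in place. *)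
Definition adjacent U W := (d.-1 <= \rank (U :&: W)%MS)%N.

Lemma nearC U W : adjacent U W = adjacent W U.
Proof. by rewrite /adjacent capmxC. Qed.

(** The possible middle terms in a product of two t leading from M to M', with A in the role of the
    (n-1)-st term of the flag. *)
Definition common_nbrs A M M' : {set sub} :=
  [set W : sub | [&& <<W>>%MS == W, lagrangian W, (A <= W)%MS, adjacent M W & adjacent W M']].

Lemma commonS A B M M' : (A <= B)%MS -> common_nbrs B M M' \subset common_nbrs A M M'.
Proof.
by move=> AB; apply/subsetP=> W; rewrite !inE => /and4P[-> -> /(submx_trans AB)->].
Qed.

Lemma addsmx_full H1 H M : lagrangian M -> (H1 <= M)%MS -> (H <= M)%MS ->
  (d.-1 <= \rank H1)%N -> ~~ (H <= H1)%MS -> (H1 + H :=: M)%MS.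
Proof.
move=> lM H1M HM r1 n; apply/eqmxP.
have h : (H1 + H <= M)%MS by rewrite addsmx_sub H1M.
rewrite h submx_rank_geq // (lagr_rank lM).
suff : (d.-1 < \rank (H1 + H)%MS)%N by rewrite prednK.
rewrite (leq_ltn_trans r1) // ltnNge; apply: contra n => /(submx_rank_geq (addsmxSl _ _)).
by rewrite addsmx_sub => /andP[].
Qed.

(** Let H = M :&: M' not lie in W; then M = M :&: W + H, and similarly for M'. Now M :&: W is
    orthogonal to M' :&: W, as both lie in W, and to H, as both lie in M. It is thus orthogonal to
    M' and lies in M', so M would lie in M'. *)
Lemma common_cap M M' W : lagrangian M -> lagrangian M' -> lagrangian W -> ~~ (M <= M')%MS ->
  adjacent M W -> adjacent W M' -> (M :&: M' <= W)%MS.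
Proof.
move=> lM lM' lW nMM n1 n2; apply: contraR nMM => nHW.
set H := (M :&: M')%MS in nHW *.
have iW := lagr_iso lW.
have side M1 M2 : lagrangian M1 -> lagrangian M2 -> (H <= M1)%MS -> (H <= M2)%MS ->
    adjacent M1 W -> (M2 :&: W <= M1)%MS.
  move=> l1 l2 H1 H2 n; apply: lagr_sub_perp => //.
    by apply: isotropicS (lagr_iso l2); apply: capmxSl.
  have e : (M1 :&: W + H :=: M1)%MS.
    apply: addsmx_full => //; first exact: capmxSl.
    by apply: contra nHW => /submx_trans-> //; apply: capmxSr.
  rewrite -(eqmx_perp e) sub_perp_adds; apply/andP; split.
    by rewrite (submx_trans (capmxSr _ _)) // (submx_trans iW) // perpS capmxSr.
  by rewrite (submx_trans (capmxSl _ _)) // (submx_trans (lagr_iso l2)) // perpS.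
have s1 : (M :&: W <= M')%MS.
  by apply: side; rewrite ?capmxSl ?capmxSr // nearC.
have e : (M :&: W + H :=: M)%MS.
  apply: addsmx_full => //; rewrite ?capmxSl //.
  by apply: contra nHW => /submx_trans-> //; apply: capmxSr.
by rewrite -e addsmx_sub s1 capmxSr.
Qed.

(** Two subspaces of W of codimension at most 1 meet in codimension at most 2, and here they meet
    inside M :&: M'. *)
Lemma common_rank M M' W : lagrangian M -> lagrangian M' -> lagrangian W -> ~~ (M <= M')%MS ->
  adjacent M W -> adjacent W M' -> (d.-2 <= \rank (M :&: M')%MS)%N.
Proof.
move=> lM lM' lW nMM n1 n2.
have := mxrank_sum_cap (M :&: W)%MS (W :&: M')%MS.
have h1 : (\rank (M :&: W + W :&: M')%MS <= d)%N.
  apply: leq_trans (eq_leq (lagr_rank lW)).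
  by rewrite mxrankS // addsmx_sub capmxSl capmxSr.
have h2 : (\rank (M :&: W :&: (W :&: M'))%MS <= \rank (M :&: M')%MS)%N.
  by apply: mxrankS; apply: capmxS; rewrite ?capmxSl ?capmxSr.
move: n1 n2 h1 h2; rewrite /adjacent.
move: (\rank _) (\rank _) (\rank _) (\rank _) (\rank _) => a b c e f; lia.
Qed.

Lemma near_cap M W : lagrangian M -> lagrangian W -> ~~ (M <= W)%MS -> adjacent M W ->
  \rank (M :&: W)%MS = d.-1.
Proof.
move=> lM lW nMW n; apply/eqP; rewrite eqn_leq [X in _ && X]n andbT -ltnS prednK //.
rewrite ltnNge; apply: contra nMW => h.
apply: submx_trans (capmxSr M W); apply: submx_rank_geq; first exact: capmxSl.
by rewrite (lagr_rank lM).
Qed.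

Lemma lagr_nsub M M' : lagrangian M -> lagrangian M' -> ~~ (M <= M')%MS -> ~~ (M' <= M)%MS.
Proof.
move=> lM lM'; apply: contra => h; apply: submx_rank_geq => //.
by rewrite (lagr_rank lM) (lagr_rank lM').
Qed.

(* When M and M' meet in codimension 2, the common_nbrs neighbours of M and M' are
   the spaces H2 + (H2^perp :&: M), one for each H2 between M :&: M' and M'. *)
Section Codim2.
Variables M M' : sub.
Hypotheses (lM : lagrangian M) (lM' : lagrangian M') (nMM : ~~ (M <= M')%MS).
Hypothesis rH : (\rank (M :&: M')%MS).+2 = d.
Local Notation H := (M :&: M')%MS.

Lemma codim2_nsub W : lagrangian W -> adjacent M W -> adjacent W M' ->
  ~~ (M <= W)%MS /\ ~~ (W <= M')%MS.
Proof.
move=> lW; rewrite /adjacent => n1 n2; split; apply/negP=> h.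
  have /mxrankS : (W :&: M' <= M :&: M')%MS.
    by apply: capmxS => //; apply: submx_rank_geq h _; rewrite (lagr_rank lM) (lagr_rank lW).
  by move: n2 rH; clear; lia.
have /mxrankS : (M :&: W <= M :&: M')%MS by apply: capmxS.
by move: n1 rH; clear; lia.
Qed.

(** With X = W :&: M', the space [perp X :&: M] contains the hyperplane M :&: W of M. It is not all
    of M, since X would then lie in M and hence in H, which is too small. So X determines both
    hyperplanes whose sum is W. *)
Lemma codim2_decomp W : lagrangian W -> adjacent M W -> adjacent W M' ->
  (W :=: W :&: M' + (perp (W :&: M')%MS :&: M))%MS /\ codim1 H (W :&: M')%MS.
Proof.
move=> lW n1 n2.
have [nMW nWM] := codim2_nsub lW n1 n2.
have r1 := near_cap lM lW nMW n1.
have r2 := near_cap lW lM' nWM n2.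
have HW := common_cap lM lM' lW nMM n1 n2.
have iW := lagr_iso lW.
have cH : codim1 H (W :&: M')%MS.
  by rewrite /codim1 sub_capmx HW capmxSr /= r2; move: rH; clear; lia.
split=> //; set X := (W :&: M')%MS in r2 cH *; set Y := (perp X :&: M)%MS.
have WY : (M :&: W <= Y)%MS.
  rewrite sub_capmx capmxSl andbT (submx_trans (capmxSr _ _)) //.
  by rewrite (submx_trans iW) // perpS capmxSl.
have YW : (Y <= M :&: W)%MS.
  apply: submx_rank_geq WY _; rewrite r1 -ltnS prednK // ltnNge; apply/negP => rY.
  have MX : (M <= perp X)%MS.
    apply: submx_trans (capmxSl _ M); apply: submx_rank_geq; first exact: capmxSr.
    by rewrite (lagr_rank lM).
  have XM : (X <= M)%MS.
    by apply: lagr_sub_perp; rewrite // ?(perp_sym X) //; apply: isotropicS iW; apply: capmxSl.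
  have /mxrankS : (X <= H)%MS by rewrite sub_capmx XM capmxSr.
  by move: cH => /andP[_ /eqP->]; rewrite ltnn.
have h : (X + Y <= W)%MS by rewrite addsmx_sub capmxSl (submx_trans YW) ?capmxSr.
apply/eqmx_sym/eqmxP; rewrite h submx_rank_geq // (lagr_rank lW).
have := mxrank_sum_cap X Y; have := mxrankS WY.
have /mxrankS : (X :&: Y <= H)%MS.
  by rewrite sub_capmx (submx_trans (capmxSr X Y)) ?capmxSr // (submx_trans (capmxSl X Y))
    ?capmxSr.
by rewrite r1 r2; move: rH; clear; move: X Y => X Y; lia.
Qed.

Lemma codim2_lagr X : codim1 H X -> (X <= M')%MS ->
  let W := (X + (perp X :&: M))%MS in
  [/\ lagrangian W, adjacent M W, adjacent W M' & (W :&: M' :=: X)%MS].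
Proof.
move=> cX XM W; have /andP[HX /eqP rX] := cX.
(* [perp X] is a hyperplane of [perp H], which contains M, so it meets M in codimension at most
   1. *)
have rY : (d.-1 <= \rank (perp X :&: M)%MS)%N.
  have := mxrank_sum_cap (perp X) M.
  have /mxrankS : (perp X + M <= perp H)%MS.
    by rewrite addsmx_sub perpS HX (submx_trans (lagr_iso lM)) // perpS capmxSl.
  rewrite !rank_perp (lagr_rank lM) rX; have := rank_le_dim H; have := rH; clear; lia.
have iW : isotropic W.
  rewrite isotropic_adds (isotropicS XM (lagr_iso lM')) perp_sym capmxSl andbT.
  by apply: isotropicS (lagr_iso lM); apply: capmxSr.
(* Both summands have dimension at least d - 1 and they meet inside H, of dimension d - 2. *)
have rW : (d <= \rank W)%N.
  have := mxrank_sum_cap X (perp X :&: M)%MS.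
  have /mxrankS : (X :&: (perp X :&: M) <= H)%MS.
    rewrite sub_capmx (submx_trans (capmxSr _ _)) ?capmxSr //.
    by rewrite (submx_trans (capmxSl _ _)).
  by rewrite -/W; move: rY rX rH; clear; lia.
have lW : lagrangian W by rewrite /lagrangian iW eqn_leq rW isotropic_rank.
have n1 : adjacent M W.
  by apply: leq_trans rY _; apply: mxrankS; rewrite sub_capmx capmxSr addsmxSr.
have XWM : (X <= W :&: M')%MS by rewrite sub_capmx addsmxSl.
have n2 : adjacent W M'.
  by apply: leq_trans (mxrankS XWM); rewrite rX; move: rH; clear; lia.
split=> //; apply/eqmx_sym/eqmxP; rewrite XWM submx_rank_geq //.
have [_ nWM] := codim2_nsub lW n1 n2.
by rewrite (near_cap lW lM' nWM n2) rX; move: rH; clear; lia.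
Qed.

(** The bijection W to W :&: M' respects the condition on A: since A lies in M', it lies in W
    exactly when it lies in W :&: M'. *)
Lemma card_common_codim2 A : (A <= M')%MS ->
  #|common_nbrs A M M'| = #|[set X in covers H M' | (A <= X)%MS]|.
Proof.
move=> AM.
have inj : {in common_nbrs A M M' &, injective (fun W => <<(W :&: M')%MS>>%MS)}.
  move=> W W'; rewrite !inE => /and5P[/eqP gW lW _ n1 n2] /and5P[/eqP gW' lW' _ n1' n2'] e.
  have [e1 _] := codim2_decomp lW n1 n2; have [e1' _] := codim2_decomp lW' n1' n2'.
  have eX : (W :&: M' :=: W' :&: M')%MS.
    by apply: eqmx_trans (eqmx_sym (genmxE _)) _; rewrite e; apply: genmxE.
  apply: eq_genmx_normal => //; apply: eqmx_trans e1 _; apply: eqmx_trans (eqmx_sym e1').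
  exact: adds_eqmx eX (cap_eqmx (eqmx_perp eX) (eqmx_refl _)).
rewrite -(card_in_imset inj); congr #|pred_of_set _|; apply/setP=> X.
rewrite inE; apply/imsetP/andP => [[W]|[]].
  rewrite !inE => /and5P[/eqP gW lW AW n1 n2] ->; have [_ c] := codim2_decomp lW n1 n2.
  move: c; rewrite genmx_id eqxx /codim1 !genmxE => -> .
  by rewrite capmxSr sub_capmx AW AM.
rewrite inE => /and3P[/eqP gX cX XM] AX; have [lW n1 n2 e] := codim2_lagr cX XM.
exists <<(X + (perp X :&: M))%MS>>%MS.
  rewrite inE genmx_id eqxx (lagr_eqmx (genmxE _)) lW genmxE (submx_trans AX) ?addsmxSl //=.
  rewrite /adjacent (cap_eqmx (eqmx_refl M) (genmxE _)) [X in X && _]n1.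
  by rewrite (cap_eqmx (genmxE _) (eqmx_refl M')).
apply: eq_genmx_normal; rewrite ?genmx_id //.
apply/eqmx_sym; apply: eqmx_trans (genmxE _) _.
by apply: eqmx_trans (cap_eqmx (genmxE _) (eqmx_refl M')) e.
Qed.

End Codim2.

(* The incidence identity behind the relation between t and e_(n-1). *)
Lemma card_common_neq A B M M' : lagrangian M -> lagrangian M' -> <<M>>%MS = M ->
  <<M'>>%MS = M' ->
  (A <= M)%MS -> codim1 A B -> (B <= M')%MS -> ~~ (B <= M)%MS ->
  #|common_nbrs A M M'| = (q.+1 * #|common_nbrs B M M'|)%N.
Proof.
move=> lM lM' gM gM' AM cAB BM' nBM; have /andP[AB /eqP rB] := cAB.
have nMM' : ~~ (M' <= M)%MS by apply: contra nBM; apply: submx_trans.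
have nMM := lagr_nsub lM' lM nMM'.
set H := (M :&: M')%MS.
have AH : (A <= H)%MS by rewrite sub_capmx AM (submx_trans AB).
have nBH : ~~ (B <= H)%MS by rewrite sub_capmx (negPf nBM).
have HBM : (H + B <= M')%MS by rewrite addsmx_sub capmxSr.
have rHB : \rank (H + B)%MS = (\rank H).+1.
  have [b [bB nbA eB]] := codim1_row cAB.
  have e : (H + B :=: H + b)%MS.
    apply/eqmxP; rewrite !addsmx_sub !addsmxSl /= (submx_trans bB) ?addsmxSr // andbT.
    by rewrite -eB addsmx_sub addsmxSr (submx_trans AH) ?addsmxSl.
  rewrite e rank_addsmx_row //; apply: contra nBH => bH.
  by rewrite -eB addsmx_sub AH.
have rHd : (\rank H < d)%N.
  by have := mxrankS HBM; rewrite rHB (lagr_rank lM').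
(* H of codimension 2: the neighbours correspond to the q + 1 spaces between H and M', and H + B is
   the only one containing B. *)
have [rH|] := eqVneq (\rank H).+2 d.
  rewrite !(card_common_codim2 lM lM' nMM rH) ?(submx_trans AB) //.
  have -> : [set X in covers H M' | (B <= X)%MS] = [set <<(H + B)%MS>>%MS].
    apply/setP=> X; rewrite !inE; apply/idP/eqP => [|->].
      move=> /andP[/and3P[/eqP gX cX XM] BX].
      apply: eq_genmx_normal; rewrite ?genmx_id //; apply/eqmx_sym;
        apply: eqmx_trans (genmxE _) _.
      apply/eqmxP; have h : (H + B <= X)%MS by rewrite addsmx_sub BX; case/andP: cX => ->.
      by rewrite h submx_rank_geq // rHB; case/andP: cX => _ /eqP->.
    by rewrite genmx_id eqxx /codim1 !genmxE addsmxSl rHB eqxx HBM addsmxSr.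
  have -> : [set X in covers H M' | (A <= X)%MS] = covers H M'.
    apply/setP=> X; rewrite inE andb_idr // inE => /and3P[_ /andP[HX _] _].
    exact: submx_trans AH HX.
  by rewrite cards1 muln1 card_covers2 ?capmxSr // (lagr_rank lM').
(* H of codimension 1: the neighbours are the q + 1 Lagrangians over H, and M' = H + B is the only
   one containing B. *)
have [rH _|nr1 nr2] := eqVneq (\rank H).+1 d.
  have cHM : codim1 H M by rewrite /codim1 capmxSl (lagr_rank lM) rH eqxx.
  have eM' : (H + B :=: M')%MS.
    by apply/eqmxP; rewrite HBM submx_rank_geq // rHB rH (lagr_rank lM').
  have sup W : lagrangian W -> (H <= W)%MS -> adjacent M W && adjacent W M'.
    move=> lW HW; apply/andP; split; apply: leq_trans (_ : \rank H <= _)%N;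
      rewrite ?mxrankS ?sub_capmx ?HW ?capmxSl ?capmxSr //; by move: rH; clear; lia.
  have -> : common_nbrs B M M' = [set M'].
    apply/setP=> W; rewrite !inE; apply/idP/eqP => [/and5P[/eqP gW lW BW n1 n2]|->].
      apply/esym/lagr_eq => //; rewrite -eM' addsmx_sub BW andbT.
      exact: common_cap n1 n2.
    by rewrite gM' eqxx lM' BM' sup // capmxSr.
  have -> : common_nbrs A M M' = lagr_over H.
    apply/setP=> W; rewrite !inE; case: eqP => //= gW; case lW: (lagrangian W) => //=.
    apply/idP/idP => [/and3P[AW n1 n2]|HW]; first exact: common_cap n1 n2.
    by rewrite (submx_trans AH HW) sup.
  rewrite cards1 muln1 (cardsD1 M) (card_lagr_over lM cHM gM).
  by rewrite inE gM eqxx lM capmxSl.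
(* In higher codimension there is no common neighbour, and both sides vanish. *)
suff eA : common_nbrs A M M' = set0.
  suff -> : common_nbrs B M M' = set0 by rewrite eA cards0 muln0.
  by apply/eqP; rewrite -subset0 -eA commonS.
apply/eqP; rewrite -subset0; apply/subsetP=> W; rewrite inE => /and5P[_ lW _ n1 n2].
have := common_rank lM lM' lW nMM n1 n2; move: rHd nr1 nr2; rewrite -/H; clear.
by move: (\rank H) => r; lia.
Qed.

(** The neighbours other than M are sorted by the hyperplane in which they meet M, which has to
    contain A; the last summand accounts for M itself. *)
Lemma card_common_diag A M : lagrangian M -> <<M>>%MS = M -> (A <= M)%MS ->
  #|common_nbrs A M M| = (q * #|cocovers A M| + 1)%N.
Proof.
move=> lM gM AM.
have cM : M \in common_nbrs A M M.
  by rewrite inE gM eqxx lM AM /adjacent (capmx_idPl (submx_refl M)) (lagr_rank lM) leq_pred.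
rewrite (cardsD1 M) cM addnC; congr (_ + _)%N.
rewrite -sum1_card (partition_big (fun W : sub => <<(W :&: M)%MS>>%MS) (mem (cocovers A M))) /=.
  rewrite mulnC -sum_nat_const; apply: eq_bigr => H; rewrite inE => /and3P[/eqP gH AH cH].
  have /andP[HM _] := cH.
  rewrite -(card_lagr_over lM cH gM) -sum1_card; apply: eq_bigl => W.
  rewrite !inE; case: (eqVneq W M) => //= nWM.
  apply/andP/and3P => [[/and5P[gW lW AW n1 n2] /eqP<-]|[/eqP gW lW HW]].
    by split=> //; rewrite genmxE capmxSl.
  have e : (W :&: M :=: H)%MS.
    rewrite capmxC; apply: codim1_cap cH HW _.
    by apply: contra nWM => /(lagr_eq gM gW lM lW)->.
  have n : (d.-1 <= \rank (W :&: M)%MS)%N.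
    by rewrite e; case/andP: cH => _ /eqP; have := lagr_rank lM; clear; lia.
  rewrite gW lW eqxx (submx_trans AH HW) /adjacent (capmxC M W) n; split=> //.
  by apply/eqP; apply: eq_genmx_normal; rewrite ?genmx_id //; apply: eqmx_trans (genmxE _) e.
move=> W; rewrite !inE => /andP[nWM /and5P[/eqP gW lW AW n1 n2]].
rewrite genmx_id eqxx genmxE sub_capmx AW AM /codim1 !genmxE capmxSr /=.
rewrite (near_cap lW lM) ?prednK ?(lagr_rank lM) //.
by apply: contra nWM => /(lagr_eq gW gM lW lM)->.
Qed.

(** If B is not in M, this is [card_common_neq]. If B is in M and M differs from M', every common
    neighbour contains M :&: M', hence B, and the two counts agree. If M = M', the hyperplanes of M
    over A outnumber those over B by q^(d - dim B), which produces the last term. *)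
Lemma card_common A B M M' : lagrangian M -> lagrangian M' -> <<M>>%MS = M -> <<M'>>%MS = M' ->
  (A <= M)%MS -> codim1 A B -> (B <= M')%MS ->
  (#|common_nbrs A M M'| + q * ((B <= M)%MS * #|common_nbrs B M M'|)
   = q.+1 * #|common_nbrs B M M'| + (M == M') * q ^ (d - \rank A))%N.
Proof.
move=> lM lM' gM gM' AM cAB BM'; have /andP[AB /eqP rB] := cAB.
have [BM|nBM] := boolP (B <= M)%MS; last first.
  rewrite (card_common_neq lM lM' gM gM' AM cAB BM' nBM).
  by case: eqP nBM BM' => [->|_ _ _]; [move=> /negPf-> | rewrite !muln0].
have [e|nMM] := eqVneq M M'; last first.
  have nM : ~~ (M <= M')%MS by apply: contra nMM => /(lagr_eq gM gM' lM lM')->.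
  suff -> : common_nbrs A M M' = common_nbrs B M M' by move: #|_| => k; lia.
  apply/setP=> W; rewrite !inE; case: eqP => //= gW; case lW: (lagrangian W) => //=.
  apply/idP/idP => /and3P[h n1 n2]; rewrite n1 n2 !andbT; last exact: submx_trans h.
  by apply: submx_trans (common_cap lM lM' lW nM n1 n2); rewrite sub_capmx BM BM'.
rewrite -e; rewrite !card_common_diag //.
have := card_cocovers AM; have := card_cocovers BM; rewrite (lagr_rank lM) rB.
have rBd : (\rank B <= d)%N by have := mxrankS BM; rewrite (lagr_rank lM).
have -> : (d - \rank A = (d - (\rank A).+1).+1)%N by move: rB rBd; clear; lia.
rewrite expnS; move: #|cocovers A M| #|cocovers B M| (q ^ _)%N (card_gt1 E) => x y z q1 ey ex.
have : (x * q.-1 = (y + z) * q.-1)%N.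
  by move: ex ey q1; case: q => // k /=; nia.
move/eqP; rewrite eqn_pmul2r; last by move: q1; clear; lia.
by move/eqP->; clear; nia.
Qed.

End Common.

(** * Flags and the replacement of one term *)

Section FlagTheory.
Variables (n d : nat) (E : orthogonal_space d).
Local Notation N := n.*2.+1.
Local Notation D := d.*2.+1.
Local Notation sub := 'M[E]_D.
Local Notation X := (flag n E).
Implicit Types (V W Z : X) (U : sub) (i j k : nat).

Lemma flE V i (hi : (i < N.+1)%N) : fl V i = flag_val V (Ordinal hi).
Proof. by rewrite /fl; congr (flag_val V _); apply: val_inj; rewrite /= inordK. Qed.

Lemma fl0 V : fl V 0 = 0.
Proof.
have /and5P[_ /eqP <- _ _ _] : is_flag (flag_val V) by case: V.
by rewrite flE; congr (flag_val V _); apply: val_inj.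
Qed.

Lemma flS V i : (i < N)%N -> (fl V i <= fl V i.+1)%MS.
Proof.
move=> hi; have /and5P[_ _ _ /forallP h _] : is_flag (flag_val V) by case: V.
exact: h (Ordinal hi).
Qed.

Lemma fl_sub V i j : (i <= j <= N)%N -> (fl V i <= fl V j)%MS.
Proof.
case/andP; elim: j => [|j IH]; first by rewrite leqn0 => /eqP->.
rewrite leq_eqVlt => /orP[/eqP-> //|ij jN].
by apply: submx_trans (IH ij (ltnW jN)) _; apply: flS.
Qed.

Lemma fl_perp V i : (i <= N)%N -> (fl V i :=: perp (fl V (N - i)))%MS.
Proof.
move=> hi; have /and5P[_ _ _ _ /and3P[/forallP h _ _]] : is_flag (flag_val V) by case: V.
have hi' : (i < N.+1)%N by []; have := h (Ordinal hi') => /eqmxP; rewrite -flE.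
have -> : rev_ord (Ordinal hi') = inord (N - i) :> 'I_N.+1.
  by apply: val_inj; rewrite /= inordK ?subSS // ltnS leq_subr.
exact: id.
Qed.

Lemma fl_lagr V : lagrangian (fl V n).
Proof.
have /and5P[_ _ _ _ /and3P[_ /andP[iV _] rV]] : is_flag (flag_val V) by case: V.
by rewrite /lagrangian iV rV.
Qed.

Lemma flag_ext V W : (forall i, (0 < i <= n)%N -> fl V i = fl W i) -> V = W.
Proof.
move=> h.
have h' i : (i <= n)%N -> fl V i = fl W i.
  by case: i => [|i] hi; [rewrite !fl0 | apply: h].
apply/flagP/forallP=> i; apply/eqP.
have [hi|hi] := leqP i n; first exact: h'.
have iN : (i <= N)%N by rewrite -ltnS.
apply: eq_genmx_normal; rewrite ?flK //; apply: eqmx_trans (fl_perp V iN) _.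
apply: eqmx_trans (eqmx_sym (fl_perp W iN)); rewrite h'; last by move: hi; clear; lia.
exact: eqmx_refl.
Qed.

Lemma flag_build (h : nat -> sub) :
  (forall i, <<h i>>%MS = h i) -> h 0%N = 0 ->
  (forall i, (i < n)%N -> (h i <= h i.+1)%MS) -> lagrangian (h n) ->
  exists W : X, forall i, (i <= n)%N -> fl W i = h i.
Proof.
move=> gh h0 hS lh.
pose g (i : nat) : sub := if (i <= n)%N then h i else <<perp (h (N - i)%N)>>%MS.
pose v := [ffun i : 'I_N.+1 => g i].
have hv : is_flag v.
  have vE i : (i <= N)%N -> v (inord i) = g i by move=> hi; rewrite ffunE inordK.
  have gE i : (i <= n)%N -> g i = h i by rewrite /g => ->.
  apply/and5P; split.
  - apply/forallP=> i; rewrite ffunE /g; case: ifP => _; rewrite ?gh ?genmx_id //.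
  - by rewrite ffunE gE // h0.
  - rewrite ffunE /g /= ifN; last by clear; lia.
    rewrite subnn h0 -genmx1; apply/eqP/eq_genmx/eqmxP; rewrite submx1 /=.
    by rewrite perp_sym sub0mx.
  - apply/forallP=> i; rewrite !vE //; last exact: ltnW.
    rewrite /g; have [hi|hi] := ltnP i n; first by rewrite (ltnW hi) hS.
    (* At the middle the inclusion of the n-th term in its orthogonal is isotropy. *)
    have [in_|ni] := leqP i n.
      have -> : i = n :> nat by move: hi in_; clear; lia.
      rewrite genmxE (_ : N - n.+1 = n)%N; last by clear; lia.
      by case/andP: lh.
    rewrite !genmxE perpS (_ : N - i = (N - i.+1).+1)%N; last by have := ltn_ord i; clear; lia.
    by apply: hS; move: ni (ltn_ord i); clear; lia.
  apply/and3P; split.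
  - apply/forallP=> i; apply/eqmxP; rewrite !ffunE /g /= subSS.
    have iN : (i <= N)%N by rewrite -ltnS.
    case: ifP => hi.
      rewrite ifN; last by move: hi; clear; lia.
      rewrite subKn //; apply: eqmx_trans (eqmx_sym (perpK _)) _.
      by apply: eqmx_perp; apply: eqmx_sym; apply: genmxE.
    rewrite ifT; last by move: hi iN; clear; lia.
    exact: genmxE.
  - by rewrite vE ?gE ?lagr_max //; clear; lia.
  - by rewrite vE ?gE ?(lagr_rank lh) //; clear; lia.
exists (Flag hv) => i hi; rewrite /fl /= ffunE inordK ?/g ?hi //.
by move: hi; clear; lia.
Qed.

Lemma agree_offP i V W :
  reflect (forall k, (0 < k <= n)%N -> k != i -> fl V k = fl W k) (agree_off i V W).
Proof.
apply: (iffP forallP) => [h k /andP[k0 kn] ki|h k].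
  by have := h (inord k); rewrite inordK ?ltnS // k0 ki => /eqP.
apply/implyP=> /andP[k0 ki]; apply/eqP/h; rewrite // k0 /=. exact: (ltn_ord k).
Qed.

Lemma agree_off_sym i V W : agree_off i V W = agree_off i W V.
Proof.
by apply/agree_offP/agree_offP => h k h1 h2; rewrite h.
Qed.

Lemma agree_off_refl i V : agree_off i V V.
Proof. by apply/agree_offP. Qed.

Lemma agree_off_trans i : transitive (@agree_off n d E i).
Proof.
move=> W V Z /agree_offP h1 /agree_offP h2; apply/agree_offP => k k1 k2.
by rewrite h1 ?h2.
Qed.

Lemma agree_off_inj i V W W' : (0 < i <= n)%N ->
  agree_off i V W -> agree_off i V W' -> fl W i = fl W' i -> W = W'.
Proof.
move=> hi /agree_offP h1 /agree_offP h2 e; apply: flag_ext => k hk.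
by have [->|ki] := eqVneq k i; rewrite // -h1 // -h2.
Qed.

(** For i = n the next term of the flag is the orthogonal of the n-th and moves with it, so the
    upper bound becomes the Lagrangian condition. *)
Definition fits i V U :=
  [&& <<U>>%MS == U, (fl V i.-1 <= U)%MS &
      if i == n then lagrangian U else (U <= fl V i.+1)%MS].

Lemma fits_self i V : (0 < i <= n)%N -> fits i V (fl V i).
Proof.
move=> hi; rewrite /fits flK eqxx fl_sub /=; last by move: hi; clear; lia.
case: eqP => [->|ni]; first exact: fl_lagr.
by apply: fl_sub; move: hi ni; clear; lia.
Qed.

Lemma agree_off_fl i k V W : agree_off i V W -> (k <= n)%N -> k != i -> fl V k = fl W k.
Proof.
by move=> /agree_offP h; case: k => [|k] kn ki; [rewrite !fl0 | apply: h].
Qed.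

Lemma fits_agree i V W : (0 < i <= n)%N -> agree_off i V W -> fits i V =1 fits i W.
Proof.
move=> hi h U; rewrite /fits (agree_off_fl h (k := i.-1)); try by move: hi; clear; lia.
case: (eqVneq i n) => //= ni; rewrite (agree_off_fl h (k := i.+1)) //; move: hi ni; clear; lia.
Qed.

(** For i between 1 and n the default V is returned only when U does not fit. *)
Definition replace_term i V U : X :=
  if [pick W | agree_off i V W && (fl W i == U)] is Some W then W else V.

Lemma replace_termP i V U : (0 < i <= n)%N -> fits i V U ->
  agree_off i V (replace_term i V U) /\ fl (replace_term i V U) i = U.
Proof.
move=> hi /and3P[/eqP gU lU Uu]; rewrite /replace_term;
  case: pickP => [W /andP[-> /eqP->] // | no].
pose h k := if k == i then U else fl V k.
have [W hW] : exists W : X, forall k, (k <= n)%N -> fl W k = h k.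
  apply: flag_build => [k||k kn|]; rewrite /h.
  - by case: ifP; rewrite ?flK.
  - by rewrite ifN ?fl0 //; move: hi; clear; lia.
  - case: eqP => [ki|ki].
      rewrite ifN; last by move: ki; clear; lia.
      by move: Uu; rewrite ifN -ki //; move: ki kn; clear; lia.
    case: eqP => [ki'|_]; first by move: lU; rewrite -ki'.
    by apply: flS; move: kn; clear; lia.
  - by rewrite eq_sym; case: ifP Uu => // _ _; apply: fl_lagr.
have := no W; rewrite hW; last by case/andP: hi.
rewrite /h eqxx eqxx andbT => /negP[]; apply/agree_offP => k /andP[_ kn] ki.
by rewrite hW // /h (negPf ki).
Qed.

End FlagTheory.

(** * Counting paths made of steps at one or two places *)

Section Steps.
Variables (n d : nat) (E : orthogonal_space d).
Local Notation N := n.*2.+1.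
Local Notation D := d.*2.+1.
Local Notation sub := 'M[E]_D.
Local Notation X := (flag n E).
Implicit Types (V W Z : X) (U : sub) (i j k : nat) (P Q : X -> X -> nat) (K L : rel sub).

Definition paths P Q V W : nat := (\sum_Z P V Z * Q Z W)%N.

Definition converse P V W := P W V.

Lemma cmp_trn P Q V W : paths P Q V W = paths (converse Q) (converse P) W V.
Proof. by apply: eq_bigr => Z _; rewrite mulnC. Qed.

Definition step i K V W : nat := K (fl V i) (fl W i) && agree_off i V W.

Lemma step_trn i K V W : converse (step i K) V W = step i (fun A B => K B A) V W.
Proof. by rewrite /converse /step agree_off_sym. Qed.

Definition count_mid i K L V A B := #|[set U | [&& fits i V U, K A U & L U B]]|.

Definition agree_off2 i j V W :=
  [forall k : 'I_n.+1, [&& (0 < k)%N, k != i :> nat & k != j :> nat] ==> (fl V k == fl W k)].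

Lemma agree_off2P i j V W :
  reflect (forall k, (k <= n)%N -> k != i -> k != j -> fl V k = fl W k) (agree_off2 i j V W).
Proof.
apply: (iffP forallP) => [h k kn ki kj|h k].
  case: k kn ki kj => [|k] kn ki kj; first by rewrite !fl0.
  by have := h (inord k.+1); rewrite inordK ?ltnS // ki kj => /eqP.
by apply/implyP=> /and3P[k0 ki kj]; apply/eqP/h => //; apply: (ltn_ord k).
Qed.

Lemma agree_off2_mid i j V W Z : agree_off i V Z -> agree_off j Z W -> agree_off2 i j V W.
Proof.
move=> h1 h2; apply/agree_off2P => k kn ki kj.
by rewrite (agree_off_fl h1 kn ki) (agree_off_fl h2 kn kj).
Qed.

Lemma sum_only1 (F : X -> nat) Z0 : (forall Z, Z != Z0 -> F Z = 0%N) -> (\sum_Z F Z)%N = F Z0.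
Proof. by move=> h; rewrite (bigD1 Z0) //= big1 ?addn0. Qed.

Lemma agree_off2_upd i j V W : (0 < i <= n)%N -> i != j -> agree_off2 i j V W ->
  fits i V (fl W i) -> agree_off j (replace_term i V (fl W i)) W.
Proof.
move=> hi ij /agree_off2P h f; have [h1 h2] := replace_termP hi f.
apply/agree_offP => k /andP[_ kn] kj; have [-> //|ki] := eqVneq k i.
by rewrite -(agree_off_fl h1 kn ki) h.
Qed.

(** The middle flag agrees with V off i, so it amounts to the choice of its i-th term. *)
Lemma cmp_step_same i K L V W : (0 < i <= n)%N ->
  paths (step i K) (step i L) V W = (agree_off i V W * count_mid i K L V (fl V i) (fl W i))%N.
Proof.
move=> hi; have [a|na] := boolP (agree_off i V W); last first.
  rewrite mul0n; apply: big1 => Z _; rewrite /step.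
  case: (agree_off i V Z) / idP => [a1|_]; last by rewrite andbF.
  case: (agree_off i Z W) / idP => [a2|_]; last by rewrite andbF muln0.
  by rewrite (agree_off_trans a1 a2) in na.
rewrite mul1n.
rewrite /paths (eq_bigr (fun Z => [&& agree_off i V Z,
  K (fl V i) (fl Z i) & L (fl Z i) (fl W i)] : nat)).
  rewrite -big_mkcond sum1_card -(@card_in_imset _ _ (fun Z => fl Z i)).
    congr #|pred_of_set _|; apply/setP=> U; rewrite inE; apply/imsetP/and3P.
      case=> Z; rewrite unfold_in => /and3P[h1 h2 h3] ->; split=> //.
      by rewrite (fits_agree hi h1) fits_self.
    case=> f k l; have [h1 h2] := replace_termP hi f; exists (replace_term i V U) => //.
    by rewrite unfold_in h1 h2 k l.
  move=> Z Z'; rewrite !unfold_in => /and3P[h1 _ _] /and3P[h2 _ _].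
  exact: (agree_off_inj hi h1 h2).
move=> Z _; rewrite /step mulnb; congr nat_of_bool.
have [h|_] := boolP (agree_off i V Z); last by rewrite andbF.
by rewrite (agree_off_trans _ a) ?andbT // agree_off_sym.
Qed.

(* An i-local kernel followed by a step at another place: the intermediate flag
   can only be V with its i-th term replaced by that of W. *)
Lemma cmp_local_step i j (G : X -> sub -> nat) L V W : (0 < i <= n)%N -> (0 < j <= n)%N ->
  i != j ->
  paths (fun V W => agree_off i V W * G V (fl W i))%N (step j L) V W =
  ((agree_off2 i j V W && L (fl V j) (fl W j) && fits i V (fl W i)) * G V (fl W i))%N.
Proof.
move=> hi hj ij; have /andP[_ jn] := hj.
have zero Z : ~~ fits i V (fl W i) || ~~ agree_off2 i j V W ->
  (agree_off i V Z * G V (fl Z i) * step j L Z W = 0)%N.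
  case: (boolP (agree_off i V Z)) => h1; last by rewrite !mul0n.
  rewrite /step; case: (boolP (agree_off j Z W)) => h2; last by rewrite andbF muln0.
  rewrite (agree_off2_mid h1 h2) orbF (fits_agree hi h1) -(agree_off_fl h2) //;
    last by case/andP: hi.
  by rewrite fits_self.
have [f|nf] := boolP (fits i V (fl W i)); last first.
  by rewrite andbF mul0n; apply: big1 => Z _; rewrite zero ?nf.
have [a|na] := boolP (agree_off2 i j V W); last first.
  by rewrite mul0n; apply: big1 => Z _; rewrite zero ?na ?orbT.
have [h1 h2] := replace_termP hi f; have h3 := agree_off2_upd hi ij a f.
rewrite /paths (sum_only1 (Z0 := replace_term i V (fl W i))).
  rewrite h1 h2 /step h3 (agree_off_fl h1 (k := j)) // 1?eq_sym // andbT mul1n.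
  by rewrite mulnC.
move=> Z nZ; case: (boolP (agree_off i V Z)) => g1; last by rewrite !mul0n.
rewrite /step; case: (boolP (agree_off j Z W)) => g2; last by rewrite andbF muln0.
case/negP: nZ; apply/eqP; apply: (agree_off_inj hi g1 h1).
by rewrite h2 (agree_off_fl g2) //; case/andP: hi.
Qed.

Lemma cmp_step_local i j (G : X -> sub -> nat) L V W : (0 < i <= n)%N -> (0 < j <= n)%N ->
  i != j ->
  paths (step j L) (fun V W => agree_off i V W * G W (fl V i))%N V W =
  ((agree_off2 i j V W && L (fl V j) (fl W j) && fits i W (fl V i)) * G W (fl V i))%N.
Proof.
move=> hi hj ij; rewrite cmp_trn.
have -> : paths (converse (fun V W => (agree_off i V W * G W (fl V i))%N)) (converse (step j
  L)) W V =
   paths (fun V W => agree_off i V W * G V (fl W i))%N (step j (fun A B => L B A)) W V.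
  by apply: eq_bigr => Z _; rewrite step_trn /converse agree_off_sym.
rewrite cmp_local_step //; congr ((_ && _ && _) * _)%N.
by apply/agree_off2P/agree_off2P => h k k1 k2 k3; rewrite h.
Qed.

Lemma cmp_same_step i j K K' L V W : (0 < i <= n)%N -> (0 < j <= n)%N -> i != j ->
  paths (paths (step i K) (step i K')) (step j L) V W =
  ((agree_off2 i j V W && L (fl V j) (fl W j) && fits i V (fl W i)) *
   count_mid i K K' V (fl V i) (fl W i))%N.
Proof.
move=> hi hj ij; rewrite -(cmp_local_step (fun V U => count_mid i K K' V (fl V i) U)) //.
by apply: eq_bigr => Z _; rewrite cmp_step_same.
Qed.

Lemma cmp_step_same2 i j K K' L V W : (0 < i <= n)%N -> (0 < j <= n)%N -> i != j ->
  paths (step j L) (paths (step i K) (step i K')) V W =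
  ((agree_off2 i j V W && L (fl V j) (fl W j) && fits i W (fl V i)) *
   count_mid i K K' W (fl V i) (fl W i))%N.
Proof.
move=> hi hj ij; rewrite -(cmp_step_local (fun W U => count_mid i K K' W U (fl W i))) //.
apply: eq_bigr => Z _; rewrite cmp_step_same //.
case: (boolP (agree_off i Z W)) => [a|]; last by rewrite !mul0n.
by rewrite /count_mid; congr (_ * (_ * #|pred_of_set _|))%N; apply/setP=> U;
  rewrite !inE (fits_agree hi a).
Qed.

Lemma cmp_two i j K L V W : (0 < i <= n)%N -> (0 < j <= n)%N -> i != j ->
  paths (step i K) (step j L) V W =
  [&& agree_off2 i j V W, L (fl V j) (fl W j), fits i V (fl W i) & K (fl V i) (fl W i)] :> nat.
Proof.
move=> hi hj ij.
have -> : paths (step i K) (step j L) V W =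
   paths (fun V W => agree_off i V W * (K (fl V i) (fl W i)))%N (step j L) V W.
  by apply: eq_bigr => Z _; rewrite [step i K _ _]/step mulnb andbC.
by rewrite (cmp_local_step (fun V U => K (fl V i) U)) // mulnb !andbA.
Qed.

Lemma cmp_two_swap i j K L V W : (0 < i <= n)%N -> (0 < j <= n)%N -> i != j ->
  paths (step j L) (step i K) V W =
  [&& agree_off2 i j V W, L (fl V j) (fl W j), fits i W (fl V i) & K (fl V i) (fl W i)] :> nat.
Proof.
move=> hi hj ij.
have -> : paths (step j L) (step i K) V W =
   paths (step j L) (fun V W => agree_off i V W * (K (fl V i) (fl W i)))%N V W.
  by apply: eq_bigr => Z _; rewrite [step i K _ _]/step mulnb andbC.
by rewrite (cmp_step_local (fun W U => K U (fl W i))) // mulnb !andbA.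
Qed.

(** The step at j takes place while U is the i-th term, so U has to fit the neighbouring terms of V
    as well as those of W. *)
Lemma cmp_sandwich i j K K' L V W : (0 < i <= n)%N -> (0 < j <= n)%N -> i != j ->
  paths (paths (step i K) (step j L)) (step i K') V W =
  ((agree_off2 i j V W && L (fl V j) (fl W j)) *
   #|[set U | [&& fits i V U, fits i W U, K (fl V i) U & K' U (fl W i)]]|)%N.
Proof.
move=> hi hj ij; have [_ jn] := andP hj.
have aE Z : agree_off i Z W -> agree_off2 i j V Z = agree_off2 i j V W.
  move=> a; apply/agree_off2P/agree_off2P => h k k1 k2 k3; rewrite h //.
    exact: agree_off_fl a k1 k2.
  by rewrite (agree_off_fl a k1 k2).
(* Z is the flag reached after the step at j; it agrees with W off i, so only its i-th term is
   free. *)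
transitivity (\sum_Z ((agree_off2 i j V W && L (fl V j) (fl W j)) *
   [&& agree_off i W Z, fits i V (fl Z i), K (fl V i) (fl Z i) & K' (fl Z i) (fl W i)]))%N;
     last first.
  rewrite -big_distrr /=; congr (_ * _)%N.
  rewrite -big_mkcond sum1_card -(@card_in_imset _ _ (fun Z => fl Z i)).
    congr #|pred_of_set _|; apply/setP=> U; rewrite inE; apply/imsetP/and4P.
      case=> Z; rewrite unfold_in => /and4P[h1 h2 h3 h4] ->; split=> //.
      by rewrite (fits_agree hi h1) fits_self.
    case=> f f' k l; have [h1 h2] := replace_termP hi f'; exists (replace_term i W U) => //.
    by rewrite unfold_in h1 h2 k l f.
  move=> Z Z'; rewrite !unfold_in => /and4P[h1 _ _ _] /and4P[h2 _ _ _].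
  exact: (agree_off_inj hi h1 h2).
apply: eq_bigr => Z _; rewrite cmp_two // /step !mulnb agree_off_sym.
have [a|_] := boolP (agree_off i W Z); last by rewrite !andbF.
rewrite agree_off_sym in a.
rewrite (aE _ a) (agree_off_fl a jn) 1?eq_sym // andbT.
by do !case: (agree_off2 _ _ _ _) (L _ _) (fits _ _ _) (K _ _) (K' _ _) => [] [] [] [] [].
Qed.

End Steps.

(** * Counting intermediate flags *)

Section Mid.
Variables (d : nat) (E : orthogonal_space d).
Local Notation D := d.*2.+1.
Local Notation sub := 'M[E]_D.
Local Notation q := #|E|.
Implicit Types (A B M U : sub).

Definition between A B : {set sub} :=
  [set U : sub | [&& <<U>>%MS == U, codim1 A U & codim1 U B]].

Lemma mid_card A B : between A B != set0 -> #|between A B| = q.+1 /\ \rank B = (\rank A).+2.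
Proof.
case/set0Pn=> U; rewrite inE => /and3P[_ /andP[AU /eqP r1] /andP[UB /eqP r2]].
have rB : \rank B = (\rank A).+2 by rewrite r2 r1.
split=> //; rewrite -(card_covers2 (submx_trans AU UB) rB).
congr #|pred_of_set _|; apply/setP=> W; rewrite !inE; congr (_ && _).
rewrite /codim1; case: (A <= W)%MS => //=; case: eqP => //= ->.
by rewrite rB eqxx andbT.
Qed.

(** The factor q + 1 unites two cases: if B lies in M, so do all middle spaces; otherwise M :&: B is
    the only one in M, out of q + 1. *)
Lemma mid_upper A B M : (A <= M)%MS -> (\rank B <= (\rank (M :&: B)%MS).+1)%N ->
  (q.+1 * #|[set U in between A B | (U <= M)%MS]| = q * ((B <= M)%MS * #|between A B|) +
    #|between A B|)%N.
Proof.
move=> AM rBM; have [BM|nBM] := boolP (B <= M)%MS.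
  have -> : [set U in between A B | (U <= M)%MS] = between A B.
    apply/setP=> U; rewrite inE andb_idr // inE => /and3P[_ _ /andP[UB _]].
    exact: submx_trans BM.
  by rewrite mul1n mulSn addnC.
have [e0|n0] := eqVneq (between A B) set0.
  by rewrite e0 cards0 !muln0; apply/eqP; rewrite muln_eq0 cards_eq0 -subset0;
    apply/subsetP=> U; rewrite !inE.
have [cq rB] := mid_card n0; rewrite mul0n muln0 cq.
suff -> : [set U in between A B | (U <= M)%MS] = [set <<(M :&: B)%MS>>%MS] by rewrite cards1
  muln1.
have AB : (A <= B)%MS.
  by case/set0Pn: n0 => U; rewrite inE => /and3P[_ /andP[AU _] /andP[UB _]];
    apply: submx_trans UB.
have rMB : \rank (M :&: B)%MS = (\rank A).+1.
  apply/eqP; rewrite eqn_leq; apply/andP; split; last by move: rBM; rewrite rB.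
  rewrite -ltnS -rB ltnNge; apply: contra nBM => h.
  by apply: submx_trans (capmxSl M B); apply: submx_rank_geq h; apply: capmxSr.
apply/setP=> U; rewrite !inE; apply/idP/eqP => [|->].
  move=> /andP[/and3P[/eqP gU /andP[AU /eqP rU] /andP[UB _]] UM].
  apply: eq_genmx_normal; rewrite ?genmx_id //; apply: eqmx_trans (eqmx_sym (genmxE _)).
  by apply/eqmxP; rewrite sub_capmx UM UB submx_rank_geq ?sub_capmx ?UM // rU rMB.
by rewrite genmx_id eqxx /codim1 !genmxE sub_capmx AM AB capmxSl capmxSr rMB rB !eqxx.
Qed.

(** Dual to [mid_upper]: if M is not in A, then A + M is the only middle space containing M. *)
Lemma mid_lower A B M : (M <= B)%MS -> (\rank M <= (\rank (A :&: M)%MS).+1)%N ->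
  (q.+1 * #|[set U in between A B | (M <= U)%MS]| = #|between A B| +
    q * ((M <= A)%MS * #|between A B|))%N.
Proof.
move=> MB rAM; have [MA|nMA] := boolP (M <= A)%MS.
  have -> : [set U in between A B | (M <= U)%MS] = between A B.
    apply/setP=> U; rewrite inE andb_idr // inE => /and3P[_ /andP[AU _] _].
    exact: submx_trans AU.
  by rewrite mul1n mulSn.
have [e0|n0] := eqVneq (between A B) set0.
  by rewrite e0 cards0 !muln0; apply/eqP; rewrite muln_eq0 cards_eq0 -subset0;
    apply/subsetP=> U; rewrite !inE.
have [cq rB] := mid_card n0; rewrite mul0n muln0 cq addn0.
suff -> : [set U in between A B | (M <= U)%MS] = [set <<(A +
  M)%MS>>%MS] by rewrite cards1 muln1.
have AB : (A <= B)%MS.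
  by case/set0Pn: n0 => U; rewrite inE => /and3P[_ /andP[AU _] /andP[UB _]];
    apply: submx_trans UB.
have rMB : \rank (A + M)%MS = (\rank A).+1.
  apply/eqP; rewrite eqn_leq; apply/andP; split.
    by have := mxrank_sum_cap A M; move: rAM; clear; lia.
  rewrite ltnNge; apply: contra nMA => h.
  by apply: submx_trans (addsmxSr A M) _; apply: submx_rank_geq h; apply: addsmxSl.
apply/setP=> U; rewrite !inE; apply/idP/eqP => [|->].
  move=> /andP[/and3P[/eqP gU /andP[AU /eqP rU] /andP[UB _]] MU].
  apply: eq_genmx_normal; rewrite ?genmx_id //; apply: eqmx_trans (eqmx_sym (genmxE _)).
  by apply/eqmx_sym/eqmxP; rewrite addsmx_sub AU MU submx_rank_geq ?addsmx_sub ?AU // rU rMB.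
by rewrite genmx_id eqxx /codim1 !genmxE addsmx_sub MB AB addsmxSl addsmxSr rMB rB !eqxx.
Qed.

End Mid.

(** * The identities between numbers of paths *)

Section Counts.
Variables (n d : nat) (E : orthogonal_space d).
Local Notation N := n.*2.+1.
Local Notation D := d.*2.+1.
Local Notation sub := 'M[E]_D.
Local Notation X := (flag n E).
Local Notation q := #|E|.
Implicit Types (V W Z : X) (U : sub) (i j k : nat) (P Q : X -> X -> nat) (K L : rel sub).

Definition e_step i : X -> X -> nat := step i (@codim1 d E).
Definition f_step i : X -> X -> nat := step i (fun A B => codim1 B A).
Definition t_step : X -> X -> nat := step n (@adjacent d E).

Lemma agree_off2_sym i j V W : agree_off2 i j V W = agree_off2 i j W V.
Proof. by apply/agree_off2P/agree_off2P => h k k1 k2 k3; rewrite h. Qed.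

Lemma fits_far i j V W : (0 < i <= n)%N -> i.-1 != j -> i.+1 != j -> agree_off2 i j V W ->
  fits i V =1 fits i W.
Proof.
move=> hi h1 h2 /agree_off2P a U; rewrite /fits a //; try by move: hi; clear; lia.
by case: (eqVneq i n) => //= ni; rewrite a //; move: hi ni; clear; lia.
Qed.

Lemma step_far_comm i j K L V W : (0 < i <= n)%N -> (0 < j <= n)%N ->
  (i.+1 < j)%N || (j.+1 < i)%N ->
  paths (step i K) (step j L) V W = paths (step j L) (step i K) V W.
Proof.
move=> hi hj ij; have nij : i != j by move: ij; clear; lia.
rewrite cmp_two // cmp_two_swap //; case a : (agree_off2 i j V W) => //=.
have f := fits_far hi _ _ a; rewrite f ?fits_self //; try by move: ij hi; clear; lia.
by rewrite -f ?fits_self //; move: ij hi; clear; lia.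
Qed.

Lemma fits_up i V W : (0 < i < n)%N -> agree_off2 i i.+1 V W ->
  fits i V (fl W i) = (fl W i <= fl V i.+1)%MS.
Proof.
move=> hi /agree_off2P a; rewrite /fits flK eqxx ifN /=; last by move: hi; clear; lia.
by rewrite a ?fl_sub //; move: hi; clear; lia.
Qed.

Lemma fits_down i V W : (0 < i < n)%N -> agree_off2 i.+1 i V W ->
  fits i.+1 V (fl W i.+1) = (fl V i <= fl W i.+1)%MS.
Proof.
move=> hi /agree_off2P a; rewrite /fits flK eqxx /=.
case: (eqVneq i.+1 n) => [->|ni]; first by rewrite fl_lagr andbT.
by rewrite [fl V i.+2]a ?fl_sub ?andbT //; move: hi ni; clear; lia.
Qed.

(** The i-th term grows while the next one shrinks, and the smaller W_(i+1) still contains the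
    larger W_i; so the intermediate flag exists in either order. *)
Lemma eS_fSS_comm i V W : (0 < i < n)%N -> paths (e_step i) (f_step i.+1) V W =
  paths (f_step i.+1) (e_step i) V W.
Proof.
move=> hi; have [hi1 hi2 hi3] : [/\ (0 < i <= n)%N, (0 < i.+1 <= n)%N & i != i.+1].
  by split; move: hi; clear; lia.
rewrite cmp_two // cmp_two_swap //; case a : (agree_off2 i i.+1 V W) => //=.
rewrite (fits_up hi a) (fits_up hi) 1?agree_off2_sym //.
rewrite /codim1.
case: (boolP (fl W i.+1 <= fl V i.+1)%MS) => //= h1.
case: (boolP (fl V i <= fl W i)%MS) => h2; last by rewrite !andbF.
rewrite (submx_trans _ h1) ?(submx_trans h2) // fl_sub //; move: hi; clear; lia.
Qed.

Lemma eSS_fS_comm i V W : (0 < i < n)%N -> paths (e_step i.+1) (f_step i) V W =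
  paths (f_step i) (e_step i.+1) V W.
Proof.
move=> hi; have [hi1 hi2 hi3] : [/\ (0 < i <= n)%N, (0 < i.+1 <= n)%N & i.+1 != i].
  by split; move: hi; clear; lia.
rewrite cmp_two // cmp_two_swap //; case a : (agree_off2 i.+1 i V W) => //=.
rewrite (fits_down hi a) (fits_down hi) 1?agree_off2_sym // /codim1.
case: (boolP (fl W i <= fl V i)%MS) => //= h1.
case: (boolP (fl V i.+1 <= fl W i.+1)%MS) => h2; last by rewrite !andbF.
rewrite (submx_trans h1) ?(submx_trans _ h2) // fl_sub //; move: hi; clear; lia.
Qed.

(* Used with L = codim1, and for i = n - 1 also with L = adjacent. *)
Lemma serre_up i L V W : (0 < i < n)%N ->
  (L (fl V i.+1) (fl W i.+1) ->
   (\rank (fl W i.+1) <= (\rank (fl V i.+1 :&: fl W i.+1)%MS).+1)%N) ->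
  (q.+1 * paths (paths (e_step i) (step i.+1 L)) (e_step i) V W =
   q * paths (paths (e_step i) (e_step i)) (step i.+1 L) V W +
     paths (step i.+1 L) (paths (e_step i) (e_step i)) V W)%N.
Proof.
move=> hi hL; have [hi1 hi2 hi3] : [/\ (0 < i <= n)%N, (0 < i.+1 <= n)%N & i != i.+1].
  by split; move: hi; clear; lia.
rewrite cmp_sandwich // cmp_same_step // cmp_step_same2 //.
case: (boolP (agree_off2 i i.+1 V W)) => a; last by rewrite !mul0n !muln0.
case: (boolP (L _ _)) => l; last by rewrite !mul0n !muln0.
have {hL} r := hL l; rewrite !mul1n (fits_up hi a) (fits_up hi) 1?agree_off2_sym //=.
have s Z k : (k < N)%N -> (fl Z k <= fl Z k.+1)%MS by apply: flS.
have iN : (i < N)%N by move: hi; clear; lia.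
have VW1 : fl V i.-1 = fl W i.-1 by have /agree_off2P := a; apply; move: hi; clear; lia.
have pr Z : (fl Z i.-1 <= fl Z i)%MS by apply: fl_sub; move: hi; clear; lia.
have fE Z U : fits i Z U = [&& <<U>>%MS == U, (fl Z i.-1 <= U)%MS & (U <= fl Z i.+1)%MS].
  by rewrite /fits ifN //; move: hi; clear; lia.
set A := fl V i; set B := fl W i; set M := fl V i.+1.
(* When the step at i + 1 comes first, the upper bound W_(i+1) contains B, and no middle space is
   lost. *)
have eW : ((A <= fl W i.+1)%MS * count_mid i (@codim1 d E) (@codim1 d E) W A B =
  #|between A B|)%N.
  have eN : count_mid i (@codim1 d E) (@codim1 d E) W A B = #|between A B|.
    rewrite /count_mid; congr #|pred_of_set _|; apply/setP=> U; rewrite !inE fE.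
    apply/and3P/and3P => [[/and3P[g _ _] h1 h2] //|[g h1 h2]]; split=> //.
    rewrite g -VW1 (submx_trans (pr V)); last by case/andP: h1.
    by rewrite (submx_trans _ (s W i iN)) //; case/andP: h2.
  rewrite eN; have [->|] := eqVneq (between A B) set0; first by rewrite cards0 muln0.
  case/set0Pn=> U; rewrite inE => /and3P[_ /andP[h1 _] /andP[h2 _]].
  by rewrite (submx_trans h1) ?mul1n // (submx_trans h2) ?s.
rewrite eW.
have -> : ((B <= M)%MS * count_mid i (@codim1 d E) (@codim1 d E) V A B =
  (B <= M)%MS * #|between A B|)%N.
  case: (boolP (B <= M)%MS) => BM; last by rewrite !mul0n.
  rewrite !mul1n; congr #|pred_of_set _|; apply/setP=> U; rewrite !inE fE.
  apply/and3P/and3P => [[/and3P[g _ _] h1 h2] //|[g h1 h2]]; split=> //.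
  rewrite g (submx_trans (pr V)); last by case/andP: h1.
  by rewrite (submx_trans _ BM) //; case/andP: h2.
rewrite -mid_upper //.
- congr (_ * #|pred_of_set _|)%N; apply/setP=> U; rewrite !inE !fE.
  apply/and4P/andP => [[/and3P[g _ h] _ h1 h2]|[/and3P[g h1 h2] UM]].
    by rewrite g h1 h2.
  have AU : (A <= U)%MS by case/andP: h1.
  have UB : (U <= B)%MS by case/andP: h2.
  split=> //; rewrite g ?UM ?(submx_trans (pr V)) //=.
  by rewrite -VW1 (submx_trans (pr V)) // (submx_trans UB) // s.
- exact: s.
(* A subspace of codimension at most 1 in W_(i+1) cuts B in codimension at most 1. *)
have := mxrank_sum_cap (fl V i.+1 :&: fl W i.+1)%MS B.
have /mxrankS : (fl V i.+1 :&: fl W i.+1 + B <= fl W i.+1)%MS.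
  by rewrite addsmx_sub capmxSr s.
have /mxrankS : (fl V i.+1 :&: fl W i.+1 :&: B <= M :&: B)%MS.
  by apply: capmxS; rewrite ?capmxSl.
move: r; rewrite -/M; clear.
move: (\rank _) (\rank _) (\rank _) (\rank _) (\rank _) => x y z t u; lia.
Qed.

(** Here the neighbour that moves lies below: in the mixed product the middle space has to contain
    the new term W_i, and [mid_lower] applies. *)
Lemma serre_down i V W : (0 < i)%N -> (i.+1 < n)%N ->
  (q.+1 * paths (paths (e_step i.+1) (e_step i)) (e_step i.+1) V W =
   paths (paths (e_step i.+1) (e_step i.+1)) (e_step i) V W +
     q * paths (e_step i) (paths (e_step i.+1) (e_step i.+1)) V W)%N.
Proof.
move=> i0 hi; have [hi0 hi1 hi2 hi3] : [/\ (0 < i < n)%N, (0 < i <= n)%N,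
  (0 < i.+1 <= n)%N & i.+1 != i].
  by split; move: i0 hi; clear; lia.
rewrite cmp_sandwich // cmp_same_step // cmp_step_same2 //.
case: (boolP (agree_off2 i.+1 i V W)) => a; last by rewrite !mul0n !muln0.
case: (boolP (codim1 _ _)) => l; last by rewrite !mul0n !muln0.
rewrite !mul1n (fits_down hi0 a) (fits_down hi0) 1?agree_off2_sym //=.
have s Z k : (k < N)%N -> (fl Z k <= fl Z k.+1)%MS by apply: flS.
have [iN iN1] : (i < N)%N /\ (i.+1 < N)%N by split; move: hi; clear; lia.
have VW2 : fl V i.+2 = fl W i.+2 by have /agree_off2P := a; apply; move: hi; clear; lia.
have fE Z U : fits i.+1 Z U = [&& <<U>>%MS == U, (fl Z i <= U)%MS & (U <= fl Z i.+2)%MS].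
  by rewrite /fits ifN //; move: hi; clear; lia.
have /andP[VWi /eqP rWi] := l.
set A := fl V i.+1; set B := fl W i.+1; set M := fl W i.
have eV : ((fl V i <= B)%MS * count_mid i.+1 (@codim1 d E) (@codim1 d E) V A B =
  #|between A B|)%N.
  rewrite (submx_trans VWi) ?s // mul1n.
  rewrite /count_mid; congr #|pred_of_set _|; apply/setP=> U; rewrite !inE fE.
  apply/and3P/and3P => [[/and3P[g _ _] h1 h2] //|[g h1 h2]]; split=> //.
  rewrite g (submx_trans (s V i iN)); last by case/andP: h1.
  by rewrite VW2 (submx_trans _ (s W i.+1 iN1)) //; case/andP: h2.
rewrite eV.
have -> : ((M <= A)%MS * count_mid i.+1 (@codim1 d E) (@codim1 d E) W A B =
  (M <= A)%MS * #|between A B|)%N.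
  case: (boolP (M <= A)%MS) => MA; last by rewrite !mul0n.
  rewrite !mul1n; congr #|pred_of_set _|; apply/setP=> U; rewrite !inE fE.
  apply/and3P/and3P => [[/and3P[g _ _] h1 h2] //|[g h1 h2]]; split=> //.
  rewrite g (submx_trans MA); last by case/andP: h1.
  by rewrite (submx_trans _ (s W i.+1 iN1)) //; case/andP: h2.
rewrite -mid_lower //.
- congr (_ * #|pred_of_set _|)%N; apply/setP=> U; rewrite !inE !fE.
  apply/and4P/andP => [[/and3P[g _ _] /and3P[_ h _] h1 h2]|[/and3P[g h1 h2] MU]].
    by rewrite g h1 h2.
  have AU : (A <= U)%MS by case/andP: h1.
  have UB : (U <= B)%MS by case/andP: h2.
  split=> //; rewrite g ?MU ?(submx_trans (s V i iN)) //=.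
    by rewrite VW2 (submx_trans UB) // s.
  by rewrite (submx_trans UB) // s.
- exact: s.
rewrite rWi ltnS mxrankS // sub_capmx VWi andbT; exact: s.
Qed.

(** This is [card_common] for A = V_(n-1) and B = W_(n-1): the middle space has to contain A if both
    t come before e, and B otherwise. Moving e to the front also requires V_n to contain B. *)
Lemma tS_eS_rel V W : (0 < d)%N -> (1 < n)%N ->
  (paths (paths t_step t_step) (e_step n.-1) V W + q * paths (e_step n.-1) (paths t_step
    t_step) V W =
   q.+1 * paths (paths t_step (e_step n.-1)) t_step V W +
     q ^ (d - \rank (fl V n.-1)) * e_step n.-1 V W)%N.
Proof.
move=> hd n1; have [hn hn1 hnn] : [/\ (0 < n <= n)%N, (0 < n.-1 <= n)%N & n != n.-1].
  by split; move: n1; clear; lia.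
rewrite cmp_sandwich // cmp_same_step // cmp_step_same2 //.
(* The single e is viewed as a change at both places n and n - 1 that keeps the n-th term, the case
   M = M'. *)
have -> : e_step n.-1 V W =
   (agree_off2 n n.-1 V W && codim1 (fl V n.-1) (fl W n.-1) && (fl V n == fl W n)) :> nat.
  rewrite /e_step /step; case: (codim1 _ _); rewrite /= ?andbT ?andbF //; congr nat_of_bool.
  apply/agree_offP/andP => [h|[/agree_off2P h /eqP h'] k /andP[k0 kn] kn'].
    split; last by rewrite h ?eqxx // eq_sym.
    apply/agree_off2P => k k1 k2 k3; case: k k1 k2 k3 => [|k] k1 k2 k3; first by rewrite !fl0.
    exact: h.
  by have [->|kn2] := eqVneq k n; rewrite ?h' // h.
case: (boolP (agree_off2 n n.-1 V W)) => a; last by rewrite !mul0n !muln0.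
case: (boolP (codim1 _ _)) => l; last by rewrite !mul0n !muln0.
have /andP[VW _] := l.
have fE Z U : fits n Z U = [&& <<U>>%MS == U, (fl Z n.-1 <= U)%MS & lagrangian U].
  by rewrite /fits eqxx.
have s Z : (fl Z n.-1 <= fl Z n)%MS by apply: fl_sub; clear; lia.
rewrite !mul1n !fE !flK !eqxx !fl_lagr !andbT (submx_trans VW) //= mul1n.
have cE Z M M' : count_mid n (@adjacent d E) (@adjacent d E) Z M M' =
  #|common_nbrs (fl Z n.-1) M M'|.
  rewrite /count_mid; congr #|pred_of_set _|; apply/setP=> U; rewrite !inE fE.
  by do !case: (_ == _) (lagrangian _) (_ <= _)%MS => [] [] [].
rewrite !cE (card_common hd (fl_lagr V) (fl_lagr W) (flK V n) (flK W n) (s V) l (s W)).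
congr (_ * #|pred_of_set _| + _)%N; last by rewrite mulnC.
apply/setP=> U; rewrite !inE !fE; case: eqP => //= _; case: (lagrangian U); rewrite ?andbF //=.
rewrite !andbT; case: (boolP (fl W n.-1 <= U)%MS) => WU; last by rewrite andbF.
by rewrite (submx_trans VW).
Qed.

Lemma ef_diag i V : (0 < i < n)%N -> paths (e_step i) (f_step i) V V =
  #|covers (fl V i) (fl V i.+1)|.
Proof.
move=> hi; rewrite cmp_step_same; last by move: hi; clear; lia.
rewrite agree_off_refl mul1n; congr #|pred_of_set _|; apply/setP=> U; rewrite !inE.
rewrite /fits ifN; last by move: hi; clear; lia.
apply/and3P/and3P => [[/and3P[-> _ ->] -> _] //|[g h1 h2]]; split=> //.
rewrite g h2 (submx_trans (_ : _ <= fl V i)%MS) //; last by case/andP: h1.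
by apply: fl_sub; move: hi; clear; lia.
Qed.

Lemma fe_diag i V : (0 < i < n)%N -> paths (f_step i) (e_step i) V V =
  #|cocovers (fl V i.-1) (fl V i)|.
Proof.
move=> hi; rewrite cmp_step_same; last by move: hi; clear; lia.
rewrite agree_off_refl mul1n; congr #|pred_of_set _|; apply/setP=> U; rewrite !inE.
rewrite /fits ifN; last by move: hi; clear; lia.
apply/and3P/and3P => [[/and3P[-> -> _] -> _] //|[g h1 h2]]; split=> //.
rewrite g h1 (submx_trans _ (_ : fl V i <= _)%MS) //; first by case/andP: h2.
by apply: fl_sub; move: hi; clear; lia.
Qed.

(** Distinct terms A and B have at most one common cover, A + B, and at most one common hyperplane,
    A :&: B. Each exists exactly when dim A = dim B and dim (A + B) = dim A + 1. *)
Lemma ef_offdiag i V W : (0 < i < n)%N -> V != W ->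
  paths (e_step i) (f_step i) V W = paths (f_step i) (e_step i) V W.
Proof.
move=> hi nVW; have hi1 : (0 < i <= n)%N by move: hi; clear; lia.
rewrite !cmp_step_same //; case: (boolP (agree_off i V W)) => a; last by rewrite !mul0n.
have nVWi : fl V i != fl W i.
  by apply: contra nVW => /eqP e; apply/eqP/(agree_off_inj hi1 _ a e)/agree_off_refl.
rewrite !mul1n /count_mid.
set S1 := [set U | _]; set S2 := [set U | _].
set A := fl V i in S1 S2 nVWi *; set B := fl W i in S1 S2 nVWi *.
have gA : <<A>>%MS = A := flK V i; have gB : <<B>>%MS = B := flK W i.
have fE U : fits i V U = [&& <<U>>%MS == U, (fl V i.-1 <= U)%MS & (U <= fl V i.+1)%MS].
  by rewrite /fits ifN //; move: hi; clear; lia.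
have lo Z : (fl Z i.-1 <= fl Z i)%MS by apply: fl_sub; move: hi; clear; lia.
have up Z : (fl Z i <= fl Z i.+1)%MS by apply: fl_sub; move: hi; clear; lia.
have [e1 e2] : fl V i.-1 = fl W i.-1 /\ fl V i.+1 = fl W i.+1.
  by split; apply: (agree_off_fl a); move: hi; clear; lia.
pose c := (\rank A == \rank B) && (\rank (A + B)%MS == (\rank A).+1).
have rAB : \rank A = \rank B -> (\rank A < \rank (A + B)%MS)%N.
  move=> r; rewrite ltnNge; apply: contra nVWi => h.
  have BA : (B <= A)%MS.
    by apply: submx_trans (addsmxSr A B) _; apply: submx_rank_geq h; apply: addsmxSl.
  by apply/eqP/eq_genmx_normal => //; apply/eqmx_sym/eqmxP; rewrite BA submx_rank_geq ?r.
have -> : S1 = if c then [set <<(A + B)%MS>>%MS] else set0.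
  apply/setP=> U; rewrite inE fE; case: ifP => hc; rewrite inE.
    have /andP[/eqP r1 /eqP r2] := hc.
    apply/and3P/eqP => [[/and3P[/eqP g _ _] /andP[AU /eqP rA] /andP[BU _]]|->].
      apply: eq_genmx_normal; rewrite ?genmx_id //; apply: eqmx_trans (eqmx_sym (genmxE _)).
      by apply/eqmx_sym/eqmxP; rewrite addsmx_sub AU BU submx_rank_geq ?addsmx_sub ?AU // rA r2.
    rewrite genmx_id eqxx /codim1 !genmxE addsmxSl addsmxSr addsmx_sub r2 -r1 eqxx; split=> //.
    by rewrite (submx_trans (lo V)) ?addsmxSl //= up e2 up.
  apply/negP => /and3P[_ /andP[AU /eqP rA] /andP[BU /eqP rB]].
  case/negP: hc; have r : \rank A = \rank B by move: rA; rewrite rB => -[].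
  rewrite /c r eqxx /=; move: (rAB r).
  have /mxrankS : (A + B <= U)%MS by rewrite addsmx_sub AU BU.
  by rewrite rB; clear -r; lia.
have -> : S2 = if c then [set <<(A :&: B)%MS>>%MS] else set0.
  apply/setP=> U; rewrite inE fE; case: ifP => hc; rewrite inE.
    have /andP[/eqP r1 /eqP r2] := hc.
    have rC : \rank A = (\rank (A :&: B)%MS).+1.
      by have := mxrank_sum_cap A B; rewrite r2 -r1; clear; lia.
    apply/and3P/eqP => [[/and3P[/eqP g _ _] /andP[UA /eqP rA] /andP[UB _]]|->].
      apply: eq_genmx_normal; rewrite ?genmx_id //; apply: eqmx_trans (eqmx_sym (genmxE _)).
      apply/eqmxP; rewrite sub_capmx UA UB submx_rank_geq ?sub_capmx ?UA //.
      by rewrite -ltnS -rC rA.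
    rewrite genmx_id eqxx /codim1 !genmxE capmxSl capmxSr sub_capmx -r1 rC eqxx; split=> //.
    by rewrite lo e1 lo /= (submx_trans (capmxSl _ _) (up V)).
  apply/negP => /and3P[_ /andP[UA /eqP rA] /andP[UB /eqP rB]].
  case/negP: hc; have r : \rank A = \rank B by rewrite rA rB.
  rewrite /c r eqxx /=; move: (rAB r).
  have /mxrankS : (U <= A :&: B)%MS by rewrite sub_capmx UA UB.
  have := mxrank_sum_cap A B; move: r rA; clear; lia.
by case: ifP => _; rewrite ?cards1 ?cards0.
Qed.

End Counts.

(** * Evaluation of Laurent polynomials *)

Section Evaluation.
Variables (K : fieldType) (s : K) (hs : s != 0).

Lemma laurentP (x : laurent) :
  exists pk : {poly int} * nat, x = FracField.tofrac pk.1 / fracv ^+ pk.2 :> {fraction {poly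
    int}}.
Proof.
by case: x => x /= /asboolP[p [k ->]]; exists (p, k).
Qed.

Let evp (p : {poly int}) : K := (map_poly intr p).[s].

(* The value at v = s; by [evE] it does not depend on the chosen presentation
   p / v^k. *)
Definition evalv of s != 0 := fun x : laurent =>
  let pk := sval (cid (laurentP x)) in evp pk.1 / s ^+ pk.2.

Lemma evE (x : laurent) p k :
  x = FracField.tofrac p / fracv ^+ k :> {fraction {poly int}} -> evalv hs x = evp p / s ^+ k.
Proof.
rewrite /evalv; case: cid => -[p' k'] /= -> e.
have vk m : fracv ^+ m != 0 by rewrite expf_neq0 ?fracv_neq0.
have sk m : s ^+ m != 0 by rewrite expf_neq0.
have : p' * 'X^k = p * 'X^k'.
  apply/eqP; rewrite -tofrac_eq !tofracM !tofracXn -/fracv.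
  by move/eqP: e; rewrite eqr_div ?vk.
move=> /(congr1 evp); rewrite /evp !rmorphM !rmorphXn /= map_polyX !hornerM !hornerXn => h.
by apply/eqP; rewrite eqr_div ?sk // h.
Qed.

Lemma ev_zmod_morphism : zmod_morphism (evalv hs).
Proof.
move=> x y; have [[p k] ex] := laurentP x; have [[p' k'] ey] := laurentP y.
have vk m : fracv ^+ m != 0 by rewrite expf_neq0 ?fracv_neq0.
have sk m : s ^+ m != 0 by rewrite expf_neq0.
rewrite (evE ex) (evE ey) (@evE _ (p * 'X^k' - p' * 'X^k) (k + k')) /=.
  rewrite /evp rmorphB !rmorphM !rmorphXn /= map_polyX hornerD hornerN !hornerM !hornerXn
    -[in RHS]mulNr.
  by rewrite addf_div ?vk ?sk // exprD mulNr.
rewrite -[LHS]/(laurent_val x - laurent_val y) ex ey /= tofracB !tofracM !tofracXn -/fracv.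
by rewrite -[in LHS]mulNr addf_div ?vk ?sk // exprD mulNr.
Qed.

Lemma ev_monoid_morphism : monoid_morphism (evalv hs).
Proof.
split=> [|x y].
  rewrite (@evE _ 1 0) /=; last by rewrite tofrac1 expr0 divr1.
  by rewrite /evp rmorph1 hornerC expr0 divr1.
have [[p k] ex] := laurentP x; have [[p' k'] ey] := laurentP y.
rewrite (evE ex) (evE ey) (@evE _ (p * p') (k + k')) /=.
  by rewrite /evp rmorphM hornerM exprD mulf_div.
by rewrite -[LHS]/(laurent_val x * laurent_val y) ex ey /= tofracM exprD mulf_div.
Qed.

HB.instance Definition _ := GRing.isZmodMorphism.Build laurent K (evalv hs) ev_zmod_morphism.
HB.instance Definition _ := GRing.isMonoidMorphism.Build laurent K (evalv hs)
  ev_monoid_morphism.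

Lemma ev_vpow z : evalv hs (vpow z) = s ^ z.
Proof.
case: z => k.
  rewrite (@evE _ ('X^k) 0) /=; first by rewrite /evp rmorphXn /= map_polyX hornerXn expr0
    divr1.
  by rewrite expr0 divr1 tofracXn.
rewrite (@evE _ 1 k.+1) /=; first by rewrite /evp rmorph1 hornerC div1r NegzE -exprnN.
by rewrite tofrac1 div1r NegzE -exprnN.
Qed.

Lemma ev_vdbl2 : evalv hs vdbl2 = s + s^-1.
Proof. by rewrite rmorphD /= !ev_vpow expr1z exprN1. Qed.

Lemma ev_eval_v2 (p : {poly int}) (k : nat) : s ^+ 2 = k%:R ->
  evalv hs (eval_v2 p) = (p.[k%:R])%:~R.
Proof.
move=> sqrtC_prime_sq; rewrite /eval_v2 -horner_map /= ev_vpow -map_poly_comp.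
have -> : s ^ 2 = (k%:R : int)%:~R by rewrite -exprnP sqrtC_prime_sq rmorph_nat.
rewrite (_ : map_poly _ p = map_poly intr p) ?horner_map //.
by apply: eq_map_poly => x /=; rewrite rmorph_int.
Qed.

End Evaluation.

Lemma sqrtC_prime_neq0 p : prime p -> sqrtC (p%:R : algC) != 0.
Proof. by move=> pp; rewrite sqrtC_eq0 pnatr_eq0 -lt0n prime_gt0. Qed.

Definition eval_sqrt p (pp : prime p) : laurent -> algC := evalv (sqrtC_prime_neq0 pp).

(** A prime above 2 plus the sum of those already found is new and odd. *)
Lemma odd_primes k : exists s : seq nat,
  [/\ size s = k, uniq s & all (fun p => prime p && odd p) s].
Proof.
elim: k => [|k [s [sk us ps]]]; first by exists [::].
have [p lp pp] := prime_above (2 + \sum_(i <- s) i).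
have np : p \notin s.
  apply/negP=> sp; move: lp; rewrite (big_rem p sp) /=; clear; lia.
exists (p :: s); rewrite /= sk us np ps pp andbT; split=> //=.
by case: (even_prime pp) => // p2; move: lp; rewrite p2; clear; lia.
Qed.

Lemma ev_inj (x : laurent) :
  (forall p (pp : prime p), odd p -> eval_sqrt pp x = 0) -> x = 0.
Proof.
move=> h; have [[P k] ex] := laurentP x.
suff P0 : P = 0 by apply: val_inj; rewrite /= ex P0 /= tofrac0 mul0r.
apply/eqP/negPn/negP => nP.
pose Q : {poly algC} := map_poly intr P.
have nQ : Q != 0 by rewrite map_poly_eq0_id0 // intr_eq0 lead_coef_eq0.
(* A nonzero Q has fewer roots than [size Q], whereas the square roots of [size Q] distinct primes
   are distinct. *)
have [s [ss us ps]] := odd_primes (size Q).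
have := max_poly_roots nQ (rs := [seq sqrtC (p%:R : algC) | p <- s]).
rewrite size_map ss ltnn => H; apply: notF; apply: H.
  apply/allP=> _ /mapP[p ps' ->]; have /andP[pp op] := allP ps _ ps'.
  have := h p pp op; rewrite /eval_sqrt (evE _ ex) /= => /eqP.
  by rewrite mulf_eq0 invr_eq0 expf_eq0 (negPf (sqrtC_prime_neq0 pp)) andbF orbF.
rewrite map_inj_uniq // => a b /(congr1 (fun x => x ^+ 2)); rewrite !sqrtCK.
by move/eqP; rewrite eqr_nat => /eqP.
Qed.

(** * The relations over a finite field *)

Section Graded.
Variables (n d : nat) (E : orthogonal_space d).
Local Notation X := (flag n E).
Local Notation q := #|E|.
Variables (K : fieldType) (s : K) (hs : s != 0) (hs2 : s ^+ 2 = q%:R).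
Implicit Types (V W Z : X) (i j a : nat) (P Q R : X -> X -> nat) (F : X -> X -> K) (k : int).

Definition convol F1 F2 V W : K := \sum_Z F1 V Z * F2 Z W.

Definition gap V a : int := (\rank (fl V a))%:Z - (\rank (fl V a.-1))%:Z.

(* A product of generators is a path count times s to the power of an affine
   function of the jumps [gap V a], evaluated at the source V of the path; this
   makes sense because every step changes the jumps by a constant. *)
Definition weight (k : int) (l : seq (int * nat)) V : int :=
  foldr (fun ca x => ca.1 * gap V ca.2 + x) k l.

Definition weight_shift (eps : nat -> int) (l : seq (int * nat)) : int :=
  foldr (fun ca x => ca.1 * eps ca.2 + x) 0 l.

Definition graded k l P V W : K := s ^ (weight k l V) * (P V W)%:R.

Definition shifts P (eps : nat -> int) :=
  forall V W a, (0 < a <= n)%N -> P V W != 0%N -> gap W a = gap V a + eps a.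

Definition inrange (l : seq (int * nat)) := all (fun ca => 0 < ca.2 <= n)%N l.

Lemma inrange1 c a : (0 < a <= n)%N -> inrange [:: (c, a)].
Proof. by rewrite /inrange /= andbT. Qed.

Lemma inrange2 c a c' a' : (0 < a <= n)%N -> (0 < a' <= n)%N -> inrange [:: (c, a); (c', a')].
Proof. by rewrite /inrange /= andbT => -> . Qed.

Lemma wtE k l V : weight k l V = k + weight 0 l V.
Proof. by elim: l => [|[c a] l IH] /=; rewrite ?addr0 // IH addrCA. Qed.

Lemma wt_cat k l l' V : weight k (l ++ l') V = weight k l V + weight 0 l' V.
Proof. by elim: l => [|[c a] l IH] /=; [rewrite -wtE | rewrite IH addrA]. Qed.

(** The second weight is taken at the intermediate flag; moving it back to the source of the path
    costs [weight_shift eps l']. *)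
Lemma convol_graded P Q eps k l k' l' : shifts P eps -> inrange l' ->
  convol (graded k l P) (graded k' l' Q) = graded (k + k' +
    weight_shift eps l') (l ++ l') (paths P Q).
Proof.
move=> sP rl; apply: funext => V; apply: funext => W.
rewrite /convol /graded /paths natr_sum mulr_sumr; apply: eq_bigr => Z _.
have [->|p0] := eqVneq (P V Z) 0%N; first by rewrite mul0n !(mulr0, mul0r).
rewrite natrM mulrACA -expfzDr //; congr (s ^ _ * _).
have -> : weight k' l' Z = weight k' l' V + weight_shift eps l'.
  elim: l' rl => [|[c a] l' IH] /=; first by rewrite addr0.
  by move=> /andP[ra /IH ->]; rewrite (sP _ _ _ ra p0); ring.
by rewrite wt_cat !(wtE k) !(wtE k') (wtE (_ + _)); ring.
Qed.

Arguments convol_graded {P Q eps k l k' l'}.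

Lemma shifts_cmp P Q eps eps' : shifts P eps -> shifts Q eps' ->
  shifts (paths P Q) (fun a => eps a + eps' a).
Proof.
move=> sP sQ V W a ra; rewrite /paths sum_nat_eq0 => /forallPn[Z] /=.
rewrite muln_eq0 negb_or => /andP[p0 q0].
by rewrite (sQ _ _ _ ra q0) (sP _ _ _ ra p0) addrA.
Qed.

Definition id_step V W : nat := (V == W).

Lemma cmp_idl P : paths id_step P = P.
Proof.
apply: funext => V; apply: funext => W; rewrite /paths (sum_only1 (Z0 := V)) /id_step ?eqxx
  ?mul1n //.
by move=> Z /negPf; rewrite eq_sym => ->.
Qed.

Lemma cmp_idr P : paths P id_step = P.
Proof.
apply: funext => V; apply: funext => W; rewrite /paths (sum_only1 (Z0 := W)) /id_step ?eqxx
  ?muln1 //.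
by move=> Z /negPf ->; rewrite muln0.
Qed.

(** As the i-th term gains a dimension, the jump at i rises and the jump at i + 1 drops. *)
Definition eps_e i a : int := (a == i)%:Z - (a == i.+1)%:Z.

Lemma shifts_id : shifts id_step (fun=> 0).
Proof. by move=> V W a _; rewrite /id_step; case: (V =P W) => [->|//] _; rewrite addr0. Qed.

Lemma shifts_t : shifts (@t_step n d E) (fun=> 0).
Proof.
move=> V W a ra; rewrite addr0 /t_step /step; case: (boolP (agree_off n V W));
  rewrite ?andbF // => h _.
have r (k : nat) : (k <= n)%N -> \rank (fl W k) = \rank (fl V k).
  by move=> kn; have [->|kn'] := eqVneq k n; rewrite ?(lagr_rank (fl_lagr _)) //
    (agree_off_fl h).
by rewrite /gap !r //; move: ra; clear; lia.
Qed.

Lemma shifts_e i : (0 < i < n)%N -> shifts (@e_step n d E i) (eps_e i).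
Proof.
move=> hi V W a ra; rewrite /e_step /step; case: (boolP (agree_off i V W));
  rewrite ?andbF // => h.
case: (boolP (codim1 _ _)) => // /andP[_ /eqP r] _; rewrite /gap /eps_e.
have e (k : nat) : (k <= n)%N -> k != i -> \rank (fl W k) = \rank (fl V k).
  by move=> k1 k2; rewrite (agree_off_fl h).
have [->|ai] := eqVneq a i.
  rewrite r e; try by move: hi; clear; lia.
have [->|ai'] := eqVneq a i.+1 => /=.
  by rewrite r e; [lia | move: hi; clear; lia | lia].
rewrite !e //; by move: ra ai ai' hi; clear; lia.
Qed.

Lemma shifts_f i : (0 < i < n)%N -> shifts (@f_step n d E i) (fun a => - eps_e i a).
Proof.
move=> hi V W a ra p; rewrite (shifts_e hi (V := W) (W := V) ra) ?addrK //.
by move: p; rewrite /f_step /e_step /step agree_off_sym.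
Qed.

(* The exponents in the definitions of the generators involve the target V' of
   the step; here they are expressed by the jumps of its source V. *)
Definition e_op i := graded 1 [:: (-1, i.+1)] (@e_step n d E i).
Definition f_op i := graded 1 [:: (-1, i)] (@f_step n d E i).
Definition t_op := graded 0 [:: (-1, n)] (@t_step n d E).
Definition d_op a := graded 0 [:: (-1, a)] id_step.
Definition dinv_op a := graded 0 [:: (1, a)] id_step.
Definition one_op := graded 0 [::] id_step.

Lemma ev_e i : (0 < i < n)%N -> (fun V W => evalv hs (e_fun n E i (V, W))) = e_op i.
Proof.
move=> hi; apply: funext => V; apply: funext => W.
rewrite ffunE /e_op /graded /e_step /step; case: ifP => h; last by rewrite rmorph0 mulr0.
rewrite ev_vpow mulr1 /=; congr (s ^ _).
have /andP[/andP[_ /eqP r] a] := h; rewrite /gap /qdim.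
rewrite (agree_off_fl a (k := i.+1)); try by move: hi; clear; lia.
have /mxrankS : (fl W i <= fl W i.+1)%MS by apply: fl_sub; move: hi; clear; lia.
by rewrite /= r; lia.
Qed.

Lemma ev_f i : (0 < i < n)%N -> (fun V W => evalv hs (f_fun n E i (V, W))) = f_op i.
Proof.
move=> hi; apply: funext => V; apply: funext => W.
rewrite ffunE /f_op /graded /f_step /step; case: ifP => h; last by rewrite rmorph0 mulr0.
rewrite ev_vpow mulr1 /=; congr (s ^ _).
have /andP[/andP[_ /eqP r] a] := h; rewrite /gap /qdim.
rewrite (agree_off_fl a (k := i.-1)); try by move: hi; clear; lia.
have /mxrankS : (fl W i.-1 <= fl W i)%MS by apply: fl_sub; move: hi; clear; lia.
by rewrite /= r; lia.
Qed.

Lemma ev_t : (0 < n)%N -> (fun V W => evalv hs (t_fun n E (V, W))) = t_op.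
Proof.
move=> hn; apply: funext => V; apply: funext => W.
rewrite ffunE /t_op /graded /t_step /step /adjacent; case: ifP => h;
  last by rewrite rmorph0 mulr0.
rewrite ev_vpow mulr1 /=; congr (s ^ _).
have /andP[_ a] := h; rewrite /gap /qdim.
rewrite (agree_off_fl a (k := n.-1)); try by move: hn; clear; lia.
have /mxrankS : (fl W n.-1 <= fl W n)%MS by apply: fl_sub; move: hn; clear; lia.
by rewrite !(lagr_rank (fl_lagr _)) /=; lia.
Qed.

Lemma ev_d a : (0 < a <= n)%N -> (fun V W => evalv hs (d_fun n E a (V, W))) = d_op a.
Proof.
move=> ha; apply: funext => V; apply: funext => W.
rewrite ffunE /d_op /graded /id_step; case: eqP => [->|_]; last by rewrite rmorph0 mulr0.
rewrite ev_vpow mulr1 /=; congr (s ^ _); rewrite /gap /qdim.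
have /mxrankS : (fl W a.-1 <= fl W a)%MS by apply: fl_sub; move: ha; clear; lia.
by lia.
Qed.

Lemma ev_dV a : (0 < a <= n)%N -> (fun V W => evalv hs (dinv_fun n E a (V, W))) = dinv_op a.
Proof.
move=> ha; apply: funext => V; apply: funext => W.
rewrite ffunE /dinv_op /graded /id_step; case: eqP => [->|_]; last by rewrite rmorph0 mulr0.
rewrite ev_vpow mulr1 /=; congr (s ^ _); rewrite /gap /qdim.
have /mxrankS : (fl W a.-1 <= fl W a)%MS by apply: fl_sub; move: ha; clear; lia.
by lia.
Qed.

Lemma ev_one : (fun V W => evalv hs (@Defs.one_fun n d E (V, W))) = one_op.
Proof.
apply: funext => V; apply: funext => W.
rewrite ffunE /one_op /graded /id_step /=; case: (V =P W) => [_|_];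
  last by rewrite rmorph0 mulr0.
by rewrite rmorph1 mulr1.
Qed.

Lemma trn_cmp P Q : converse (paths P Q) = paths (converse Q) (converse P).
Proof. by apply: funext => V; apply: funext => W; rewrite /converse cmp_trn. Qed.

Lemma trn_f i : converse (@f_step n d E i) = @e_step n d E i.
Proof. by apply: funext => V; apply: funext => W; rewrite /f_step step_trn. Qed.

Lemma trn_t : converse (@t_step n d E) = @t_step n d E.
Proof.
apply: funext => V; apply: funext => W; rewrite /t_step step_trn /step.
by rewrite nearC.
Qed.

Lemma cmpA P Q R : paths P (paths Q R) = paths (paths P Q) R.
Proof.
apply: funext => V; apply: funext => W; rewrite /paths.
under eq_bigr do rewrite big_distrr; rewrite exchange_big; apply: eq_bigr => Z _.
by rewrite big_distrl; apply: eq_bigr => Z' _; rewrite /= mulnA.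
Qed.

Lemma converseE P V W : P V W = converse P W V. Proof. by []. Qed.

(** Up to the factor s^(w3 - 1) the claim is s^2 c1 + c2 = (s^2 + 1) c3, the counting identity with
    q = s^2. *)
Lemma serre_arith (w1 w2 w3 : int) (c1 c2 c3 : nat) : w1 = w3 + 1 -> w2 = w3 - 1 ->
  (q.+1 * c3 = q * c1 + c2)%N ->
  s ^ w1 * c1%:R + s ^ w2 * c2%:R = (s + s^-1) * (s ^ w3 * c3%:R).
Proof.
move=> -> -> /(congr1 (fun x => x%:R : K)); rewrite -(addn1 q) !(natrM, natrD) -hs2 => e.
rewrite !expfzDr // expr1z exprN1; apply: (mulfI hs).
transitivity (s ^ w3 * (s ^+ 2 * c1%:R + c2%:R)); first by field.
by rewrite -e; field.
Qed.

Lemma serre_arith' (w1 w2 w3 : int) (c1 c2 c3 : nat) : w1 = w3 - 1 -> w2 = w3 + 1 ->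
  (q.+1 * c3 = c1 + q * c2)%N ->
  s ^ w1 * c1%:R + s ^ w2 * c2%:R = (s + s^-1) * (s ^ w3 * c3%:R).
Proof. by move=> h1 h2 e; rewrite addrC; apply: serre_arith; rewrite // addnC. Qed.

(** The coefficient q^m becomes s^(2m). The exponent w4 is constrained only where c4 is nonzero,
    since for f it is computed from the dimensions of two flags joined by a step. *)
Lemma quad_arith (w1 w2 w3 w4 : int) (m c1 c2 c3 c4 : nat) :
  w1 = w3 - 1 -> w2 = w3 + 1 -> (c4 != 0%N -> w4 = w3 - 1 + (2 * m)%N%:Z) ->
  (c1 + q * c2 = q.+1 * c3 + q ^ m * c4)%N ->
  s ^ w1 * c1%:R + s ^ w2 * c2%:R - (s + s^-1) * (s ^ w3 * c3%:R) = s ^ w4 * c4%:R.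
Proof.
move=> -> -> h4 /(congr1 (fun x => x%:R : K)).
rewrite -(addn1 q) !(natrM, natrD) natrX -hs2 => e.
have -> : s ^ w4 * c4%:R = s ^ (w3 - 1 + (2 * m)%N%:Z) * c4%:R.
  by have [->|/h4 -> //] := eqVneq c4 0%N; rewrite !mulr0.
rewrite !expfzDr // expr1z exprN1 -exprnP exprM; apply: (mulfI hs).
transitivity (s ^ w3 * (c1%:R + s ^+ 2 * c2%:R) - s ^ w3 * ((s ^+ 2 + 1) * c3%:R));
  first by field.
by rewrite e; field.
Qed.

Lemma quad_arith' (w1 w2 w3 w4 : int) (m c1 c2 c3 c4 : nat) :
  w1 = w3 + 1 -> w2 = w3 - 1 -> (c4 != 0%N -> w4 = w3 - 1 + (2 * m)%N%:Z) ->
  (c2 + q * c1 = q.+1 * c3 + q ^ m * c4)%N ->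
  s ^ w1 * c1%:R + s ^ w2 * c2%:R - (s + s^-1) * (s ^ w3 * c3%:R) = s ^ w4 * c4%:R.
Proof. by move=> h1 h2 h4 e; rewrite (addrC (s ^ w1 * _)); apply: quad_arith e. Qed.

Lemma graded_ext k l k' l' P Q V W : weight k l V = weight k' l' V -> P V W = Q V W ->
  graded k l P V W = graded k' l' Q V W.
Proof. by rewrite /graded => -> ->. Qed.

Lemma rel_dd a : (0 < a <= n)%N -> convol (d_op a) (dinv_op a) = one_op.
Proof.
move=> ha; rewrite /d_op /dinv_op (convol_graded shifts_id) ?inrange1 // cmp_idl.
by apply: funext => V; apply: funext => W; apply: graded_ext => //=; lia.
Qed.

Lemma rel_dd' a : (0 < a <= n)%N -> convol (dinv_op a) (d_op a) = one_op.
Proof.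
move=> ha; rewrite /d_op /dinv_op (convol_graded shifts_id) ?inrange1 // cmp_idl.
by apply: funext => V; apply: funext => W; apply: graded_ext => //=; lia.
Qed.

Lemma rel_dC a b : (0 < a <= n)%N -> (0 < b <= n)%N ->
  convol (d_op a) (d_op b) = convol (d_op b) (d_op a).
Proof.
move=> ha hb; rewrite /d_op !(convol_graded shifts_id) ?inrange1 // cmp_idl.
by apply: funext => V; apply: funext => W; apply: graded_ext => //=; lia.
Qed.

(** The first factor contributes minus the jump at the source, the last one the jump at the target;
    the difference is [eps a]. *)
Lemma rel_conj_d a P k l eps : (0 < a <= n)%N -> shifts P eps -> inrange l ->
  convol (convol (d_op a) (graded k l P)) (dinv_op a) = fun V W =>
    s ^ (eps a) * graded k l P V W.
Proof.
move=> ha sP rl; rewrite /d_op /dinv_op (convol_graded shifts_id) // cmp_idl (convol_graded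
  sP) ?inrange1 // cmp_idr.
apply: funext => V; apply: funext => W; rewrite /graded mulrA -expfzDr //; congr (s ^ _ * _).
rewrite wtE /= wt_cat /= (wtE k l).
suff -> : weight_shift (fun=> 0) l = 0 by lia.
by elim: l {rl} => //= ca l ->; rewrite mulr0 addr0.
Qed.

Arguments rel_conj_d {a P k l eps}.

Lemma rel_de a j : (0 < a <= n)%N -> (0 < j < n)%N ->
  convol (convol (d_op a) (e_op j)) (dinv_op a) = fun V W =>
    s ^ ((a == j)%:Z - (a == j.+1)%:Z) * e_op j V W.
Proof.
by move=> ha hj; rewrite /e_op (rel_conj_d ha (shifts_e hj)) // inrange1 //; move: hj; clear;
  lia.
Qed.

Lemma rel_df a j : (0 < a <= n)%N -> (0 < j < n)%N ->
  convol (convol (d_op a) (f_op j)) (dinv_op a) = fun V W =>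
    s ^ (- (a == j)%:Z + (a == j.+1)%:Z) * f_op j V W.
Proof.
move=> ha hj; rewrite /f_op (rel_conj_d ha (shifts_f hj)).
  by apply: funext => V; apply: funext => W; congr (s ^ _ * _); rewrite /eps_e; lia.
by rewrite inrange1 //; move: hj; clear; lia.
Qed.

Lemma rel_dt a : (0 < a <= n)%N -> convol (d_op a) t_op = convol t_op (d_op a).
Proof.
move=> ha; rewrite /d_op /t_op (convol_graded shifts_id) ?(convol_graded shifts_t) ?inrange1 //.
  rewrite cmp_idl cmp_idr; apply: funext => V; apply: funext => W.
  by apply: graded_ext => //=; lia.
by move: ha; clear; lia.
Qed.

Section OneIndex.
Variable i : nat.
Hypothesis hi : (0 < i < n)%N.
Let ri1 : (0 < i <= n)%N. Proof. by move: hi; clear; lia. Qed.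
Let ri2 : (0 < i.+1 <= n)%N. Proof. by move: hi; clear; lia. Qed.

(** On the diagonal the two counts are (x^2 - 1) / (s^2 - 1) and (y^2 - 1) / (s^2 - 1), where x and
    y are s to the jumps at i + 1 and at i. With the common weight s / (x y), both sides equal x / y
    - y / x. Off the diagonal both sides vanish. *)
Lemma rel_ef_diag V W : (s - s^-1) * (convol (e_op i) (f_op i) V W - convol (f_op i) (e_op i)
  V W) =
  convol (d_op i) (dinv_op i.+1) V W - convol (dinv_op i) (d_op i.+1) V W.
Proof.
rewrite /e_op /f_op /d_op /dinv_op (convol_graded (shifts_e hi)) ?(convol_graded (shifts_f
  hi)) ?inrange1 //.
rewrite !(convol_graded shifts_id) ?inrange1 // cmp_idl /graded /=.
rewrite (_ : -1 * gap V i.+1 + (-1 * gap V i + _) = 1 - gap V i.+1 - gap V i); last first.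
  by rewrite /eps_e; lia.
rewrite (_ : -1 * gap V i + (-1 * gap V i.+1 + _) = 1 - gap V i.+1 - gap V i); last first.
  by rewrite /eps_e; lia.
rewrite (_ : -1 * gap V i + (1 * gap V i.+1 + _) = gap V i.+1 - gap V i); last by lia.
rewrite (_ : 1 * gap V i + (-1 * gap V i.+1 + _) = gap V i - gap V i.+1); last by lia.
have [->|nVW] := eqVneq V W; last first.
  by rewrite ef_offdiag // /id_step (negPf nVW) !mulr0 !subrr mulr0.
rewrite /id_step eqxx !mulr1 ef_diag // fe_diag //.
have VV : (fl W i.-1 <= fl W i)%MS by apply: fl_sub; move: hi; clear; lia.
have VV' : (fl W i <= fl W i.+1)%MS by apply: fl_sub; move: hi; clear; lia.
have q1 := card_gt1 E.
have key m c : (c * q.-1 + 1 = q ^ m)%N -> (s ^+ 2 - 1) * c%:R = (s ^+ 2) ^+ m - 1.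
  move=> e; rewrite hs2 -natrX -e natrD natrM addrK.
  have eq1 : q%:R = q.-1%:R + 1 :> K by rewrite natr1 prednK // ltnW.
  by rewrite eq1 addrK mulrC.
have := key _ _ (card_covers VV'); have := key _ _ (card_cocovers VV).
move: #|covers _ _| #|cocovers _ _| => c1 c2.
have [r1 r2] := (mxrankS VV', mxrankS VV).
have -> : gap W i.+1 = (\rank (fl W i.+1) - \rank (fl W i))%N%:Z by rewrite /gap /=; lia.
have -> : gap W i = (\rank (fl W i) - \rank (fl W i.-1))%N%:Z by rewrite /gap /=; lia.
move: (_ - _)%N (_ - _)%N => m2 m1 e2 e1.
rewrite !expfzDr // -!invr_expz expr1z -!exprnP.
have [x0 y0] : s ^+ m1 != 0 /\ s ^+ m2 != 0 by rewrite !expf_neq0.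
move: e1 e2; rewrite !(exprAC s 2); move: (s ^+ m1) (s ^+ m2) x0 y0 => x y x0 y0 e1 e2.
transitivity (((s ^+ 2 - 1) * c1%:R - (s ^+ 2 - 1) * c2%:R) / (x * y)); first by field;
  rewrite hs x0 y0.
by rewrite e1 e2; field; rewrite x0 y0.
Qed.

Lemma rel_et : (i.+1 < n)%N -> convol (e_op i) t_op = convol t_op (e_op i).
Proof.
move=> ij; have hn : (0 < n <= n)%N by move: ij; clear; lia.
rewrite /e_op /t_op (convol_graded (shifts_e hi)) ?(convol_graded shifts_t) ?inrange1 //.
apply: funext => V; apply: funext => W; apply: graded_ext; first by rewrite /= /eps_e; lia.
by apply: step_far_comm => //; rewrite ij.
Qed.

Lemma rel_ft : (i.+1 < n)%N -> convol (f_op i) t_op = convol t_op (f_op i).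
Proof.
move=> ij; have hn : (0 < n <= n)%N by move: ij; clear; lia.
rewrite /f_op /t_op (convol_graded (shifts_f hi)) ?(convol_graded shifts_t) ?inrange1 //.
apply: funext => V; apply: funext => W; apply: graded_ext; first by rewrite /= /eps_e; lia.
by apply: step_far_comm => //; rewrite ij.
Qed.

End OneIndex.

Section TwoIndices.
Variables (i j : nat).
Hypotheses (hi : (0 < i < n)%N) (hj : (0 < j < n)%N).
Let ri1 : (0 < i <= n)%N. Proof. by move: hi; clear; lia. Qed.
Let ri2 : (0 < i.+1 <= n)%N. Proof. by move: hi; clear; lia. Qed.
Let rj1 : (0 < j <= n)%N. Proof. by move: hj; clear; lia. Qed.
Let rj2 : (0 < j.+1 <= n)%N. Proof. by move: hj; clear; lia. Qed.

Lemma rel_ef : i != j -> convol (e_op i) (f_op j) = convol (f_op j) (e_op i).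
Proof.
move=> ij; rewrite /e_op /f_op (convol_graded (shifts_e hi)) ?(convol_graded (shifts_f hj))
  ?inrange1 //.
apply: funext => V; apply: funext => W; apply: graded_ext; first by rewrite /= /eps_e; lia.
have [e|nij] := eqVneq j i.+1; first by rewrite e; apply: eS_fSS_comm.
have [e|nji] := eqVneq i j.+1; first by rewrite e; apply: eSS_fS_comm.
by apply: step_far_comm => //; move: ij nij nji; clear; lia.
Qed.

Lemma rel_far_e : (i.+1 < j)%N || (j.+1 < i)%N -> convol (e_op i) (e_op j) =
  convol (e_op j) (e_op i).
Proof.
move=> ij; rewrite /e_op (convol_graded (shifts_e hi)) ?(convol_graded (shifts_e hj))
  ?inrange1 //.
apply: funext => V; apply: funext => W; apply: graded_ext; first by rewrite /= /eps_e; lia.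
exact: step_far_comm.
Qed.

Lemma rel_far_f : (i.+1 < j)%N || (j.+1 < i)%N -> convol (f_op i) (f_op j) =
  convol (f_op j) (f_op i).
Proof.
move=> ij; rewrite /f_op (convol_graded (shifts_f hi)) ?(convol_graded (shifts_f hj))
  ?inrange1 //.
apply: funext => V; apply: funext => W; apply: graded_ext; first by rewrite /= /eps_e; lia.
exact: step_far_comm.
Qed.

End TwoIndices.

Ltac expand_words si sj :=
  rewrite !(convol_graded si) ?(convol_graded sj)
    ?(convol_graded (shifts_cmp si si)) ?(convol_graded (shifts_cmp si sj))
    ?inrange1 ?inrange2 //.

(** The quantum Serre expression with F twice and G once; the cubic relations say that it is 0, or G
    itself in (f) and (g). *)
Definition twice_cross F G V W : K :=
  convol (convol F F) G V W + convol G (convol F F) V W - (s +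
    s^-1) * convol (convol F G) F V W.

Section Cubic.
Variable i : nat.
Hypotheses (i0 : (0 < i)%N) (hi1 : (i.+1 < n)%N).
Let hi : (0 < i < n)%N. Proof. by move: i0 hi1; clear; lia. Qed.
Let hi' : (0 < i.+1 < n)%N. Proof. by move: hi1; clear; lia. Qed.
Let r0 : (0 < i <= n)%N. Proof. by move: i0 hi1; clear; lia. Qed.
Let r1 : (0 < i.+1 <= n)%N. Proof. by move: hi1; clear; lia. Qed.
Let r2 : (0 < i.+2 <= n)%N. Proof. by move: hi1; clear; lia. Qed.

Let cod (V W : X) : codim1 (fl V i.+1) (fl W i.+1) ->
   (\rank (fl W i.+1) <= (\rank (fl V i.+1 :&: fl W i.+1)%MS).+1)%N.
Proof. by move=> /andP[h /eqP->]; rewrite (capmx_idPl h). Qed.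

Lemma rel_serre_e_up V W : twice_cross (e_op i) (e_op i.+1) V W = 0.
Proof.
have [si sj] := (shifts_e hi, shifts_e hi').
apply/eqP; rewrite /twice_cross subr_eq0 /e_op; apply/eqP.
expand_words si sj.
apply: serre_arith; try by rewrite /= /eps_e; lia.
by apply: serre_up => // /cod.
Qed.

Lemma rel_serre_e_down V W : twice_cross (e_op i.+1) (e_op i) V W = 0.
Proof.
have [si sj] := (shifts_e hi', shifts_e hi).
apply/eqP; rewrite /twice_cross subr_eq0 /e_op; apply/eqP.
expand_words si sj.
apply: serre_arith'; try by rewrite /= /eps_e; lia.
exact: serre_down.
Qed.

Lemma rel_serre_f_up V W : twice_cross (f_op i) (f_op i.+1) V W = 0.
Proof.
have [si sj] := (shifts_f hi, shifts_f hi').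
apply/eqP; rewrite /twice_cross subr_eq0 /f_op; apply/eqP.
expand_words si sj.
apply: serre_arith'; try by rewrite /= /eps_e; lia.
(* Transposition reverses words and so exchanges F F G with G F F, which explains the commuted sum
   and the exponents of [serre_arith']. *)
do 3!rewrite [paths _ _ V W]converseE; rewrite !trn_cmp !trn_f addnC (cmpA _ (e_step i.+1)).
by apply: serre_up => // /cod.
Qed.

Lemma rel_serre_f_down V W : twice_cross (f_op i.+1) (f_op i) V W = 0.
Proof.
have [si sj] := (shifts_f hi', shifts_f hi).
apply/eqP; rewrite /twice_cross subr_eq0 /f_op; apply/eqP.
expand_words si sj.
apply: serre_arith; try by rewrite /= /eps_e; lia.
do 3!rewrite [paths _ _ V W]converseE; rewrite !trn_cmp !trn_f addnC (cmpA _ (e_step i)).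
exact: serre_down.
Qed.

End Cubic.

Section WithT.
Hypotheses (hd : (0 < d)%N) (n1 : (1 < n)%N).
Let hi : (0 < n.-1 < n)%N. Proof. by move: n1; clear; lia. Qed.
Let r0 : (0 < n.-1 <= n)%N. Proof. by move: n1; clear; lia. Qed.
Let r1 : (0 < n <= n)%N. Proof. by move: n1; clear; lia. Qed.
Let nE : n.-1.+1 = n. Proof. by move: n1; clear; lia. Qed.

Let r1' : (0 < n.-1.+1 <= n)%N. Proof. by rewrite nE r1. Qed.

Let nearP (V W : X) : adjacent (fl V n.-1.+1) (fl W n.-1.+1) ->
   (\rank (fl W n.-1.+1) <= (\rank (fl V n.-1.+1 :&: fl W n.-1.+1)%MS).+1)%N.
Proof. by rewrite nE (lagr_rank (fl_lagr W)) /adjacent; move: hd; clear; lia. Qed.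

Let count_et V W :
  (q.+1 * paths (paths (@e_step n d E n.-1) (@t_step n d E)) (@e_step n d E n.-1) V W =
   q * paths (paths (@e_step n d E n.-1) (@e_step n d E n.-1)) (@t_step n d E) V W
   + paths (@t_step n d E) (paths (@e_step n d E n.-1) (@e_step n d E n.-1)) V W)%N.
Proof.
have -> : @t_step n d E = step n.-1.+1 (@adjacent d E) by rewrite nE.
by apply: serre_up => // /nearP.
Qed.

Lemma rel_eet V W : twice_cross (e_op n.-1) t_op V W = 0.
Proof.
have [si sj] := (shifts_e hi, shifts_t).
apply/eqP; rewrite /twice_cross subr_eq0 /e_op /t_op; apply/eqP.
expand_words si sj.
apply: serre_arith; try by rewrite /= /eps_e ?nE; lia.
exact: count_et.
Qed.

Lemma rel_fft V W : twice_cross (f_op n.-1) t_op V W = 0.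
Proof.
have [si sj] := (shifts_f hi, shifts_t).
apply/eqP; rewrite /twice_cross subr_eq0 /f_op /t_op; apply/eqP.
expand_words si sj.
apply: serre_arith'; try by rewrite /= /eps_e ?nE; lia.
do 3!rewrite [paths _ _ V W]converseE; rewrite !trn_cmp !trn_f !trn_t addnC (cmpA _ (@t_step
  n d E)).
exact: count_et.
Qed.

Lemma rel_tte V W : twice_cross t_op (e_op n.-1) V W = e_op n.-1 V W.
Proof.
have [si sj] := (shifts_t, shifts_e hi).
rewrite /twice_cross /e_op /t_op.
expand_words si sj.
(* m is the jump of V at n, so q^m cancels the factors v^(-m) of the two t. *)
apply: (quad_arith (m := (d - \rank (fl V n.-1))%N)); try by rewrite /= /eps_e ?nE; lia.
  move=> _; rewrite /= nE /eps_e.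
  have := mxrankS (fl_sub V (_ : n.-1 <= n <= n.*2.+1)%N); rewrite /gap (lagr_rank (fl_lagr V)).
  by move=> /(_ _)h; have {}h := h ltac:(clear; lia); lia.
exact: tS_eS_rel.
Qed.

Lemma rel_ttf V W : twice_cross t_op (f_op n.-1) V W = f_op n.-1 V W.
Proof.
have [si sj] := (shifts_t, shifts_f hi).
rewrite /twice_cross /f_op /t_op.
expand_words si sj.
(* After transposition W is the source, so the jump at n is taken there. *)
apply: (quad_arith' (m := (d - \rank (fl W n.-1))%N)); try by rewrite /= /eps_e ?nE; lia.
  rewrite /f_step /step eqb0 negbK => /andP[/andP[_ /eqP r] _]; rewrite /= /eps_e.
  have := mxrankS (fl_sub V (_ : n.-1 <= n <= n.*2.+1)%N); rewrite /gap (lagr_rank (fl_lagr V)).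
  by move=> /(_ _)h; have {}h := h ltac:(clear; lia); lia.
do 3!rewrite [paths _ _ V W]converseE; rewrite (converseE (@f_step n d E n.-1)) !trn_cmp
  !trn_f !trn_t.
rewrite (cmpA _ (e_step n.-1) (@t_step n d E)).
exact: tS_eS_rel.
Qed.

End WithT.

End Graded.

(** * Relative positions *)

Section Relpos.
Variables (n d : nat) (E : orthogonal_space d).
Local Notation N := n.*2.+1.
Local Notation D := d.*2.+1.
Local Notation X := (flag n E).
Implicit Types (V W Z : X) (i j k l : nat).

Definition caprk V W i j := \rank (fl V i :&: fl W j)%MS.

Lemma caprkC V W i j : caprk V W i j = caprk W V j i.
Proof. by rewrite /caprk capmxC. Qed.

Lemma fl_last V : (fl V N :=: 1%:M)%MS.
Proof.
apply: eqmx_trans (fl_perp V (leqnn _)) _; apply/eqmxP; rewrite submx1 subnn fl0 /=.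
by rewrite perp_sym sub0mx.
Qed.

Lemma caprk_full V W i : caprk V W i N = \rank (fl V i).
Proof.
rewrite /caprk; apply: eqmx_rank.
by rewrite sub_capmx submx_refl (fl_last W) submx1 capmxSl.
Qed.

Lemma caprk_full' V W i : caprk V W N i = \rank (fl W i).
Proof. by rewrite caprkC caprk_full. Qed.

Lemma caprk0 V W i : caprk V W i 0 = 0%N.
Proof. by rewrite /caprk fl0 capmx0 mxrank0. Qed.

Lemma caprk0' V W i : caprk V W 0 i = 0%N.
Proof. by rewrite caprkC caprk0. Qed.

(** By the dimension formula an entry of the matrix is a mixed second difference of the dimensions
    of intersections, written here without subtraction. *)
Lemma relpos_caprk V W (i j : 'I_N) :
  (relpos V W i j + caprk V W i.+1 j + caprk V W i j.+1 =
   caprk V W i.+1 j.+1 + caprk V W i j)%N.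
Proof.
have e k : (\rank (fl V i + fl V i.+1 :&: fl W k)%MS + caprk V W i k =
            \rank (fl V i) + caprk V W i.+1 k)%N.
  have := mxrank_sum_cap (fl V i) (fl V i.+1 :&: fl W k)%MS.
  rewrite (_ : \rank (fl V i :&: (fl V i.+1 :&: fl W k))%MS = caprk V W i k) //.
  apply: eqmx_rank; rewrite capmxS ?capmxSr //=.
  by rewrite !sub_capmx !capmxSl capmxSr (submx_trans (capmxSl _ _)) // flS.
(* The entries are at most D, so [inord] does not alter them. *)
rewrite mxE inordK; last first.
  rewrite ltnS /qdim; apply: leq_trans (leq_subr _ _) _; exact: rank_le_dim.
rewrite /qdim.
have /mxrankS : (fl V i + fl V i.+1 :&: fl W j <= fl V i + fl V i.+1 :&: fl W j.+1)%MS.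
  by rewrite addsmxS // capmxS // flS.
by have := e j; have := e j.+1; lia.
Qed.

(** The mixed differences telescope, so the relative position determines the dimensions of all
    intersections. *)
Lemma sum_relpos V W i j (hi : (i <= N)%N) (hj : (j <= N)%N) :
  (\sum_(k < N | (k < i)%N) \sum_(l < N | (l < j)%N) relpos V W k l = caprk V W i j)%N.
Proof.
have row (k : 'I_N) : forall j, (j <= N)%N ->
    (\sum_(l < N | (l < j)%N) relpos V W k l + caprk V W k j = caprk V W k.+1 j)%N.
  elim=> [|m IH] hm; first by rewrite big_pred0 // !caprk0.
  rewrite (bigD1 (Ordinal hm)) //= (eq_bigl (fun l : 'I_N => (l < m)%N)).
    by have := IH (ltnW hm); have /= := relpos_caprk V W k (Ordinal hm); lia.
  move=> l; rewrite ltnS [in RHS]ltn_neqAle andbC; congr (_ && _).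
elim: i hi => [|m IH] hm; first by rewrite big_pred0 // caprk0'.
rewrite (bigD1 (Ordinal hm)) //= [X in (_ + X)%N](eq_bigl (fun l : 'I_N => (l < m)%N)).
  by rewrite (IH (ltnW hm)) (row (Ordinal hm) j hj).
by move=> l; rewrite ltnS [in RHS]ltn_neqAle andbC; congr (_ && _).
Qed.

Lemma caprk_perp V W i j : (i <= N)%N -> (j <= N)%N ->
  (caprk V W (N - i) (N - j) + \rank (fl V i) + \rank (fl W j) = D + caprk V W i j)%N.
Proof.
move=> hi hj.
have e (Z : X) k : (k <= N)%N -> (fl Z (N - k) :=: perp (fl Z k))%MS.
  by move=> hk; have := fl_perp Z (leq_subr k N); rewrite subKn.
rewrite {1}/caprk (cap_eqmx (e V i hi) (e W j hj)).
rewrite -(perp_adds (fl V i) (fl W j)) rank_perp.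
have := mxrank_sum_cap (fl V i) (fl W j); have := rank_le_dim (fl V i + fl W j)%MS.
by rewrite /caprk; lia.
Qed.

(** In [caprk_perp] the terms depending on a single index cancel when mixed differences are
    taken. *)
Lemma relpos_sym V W (i j : 'I_N) : relpos V W i j = relpos V W (rev_ord i) (rev_ord j).
Proof.
apply: val_inj => /=.
have [hi hj] := (ltn_ord i, ltn_ord j).
have := relpos_caprk V W i j; have := relpos_caprk V W (rev_ord i) (rev_ord j).
have c1 := caprk_perp V W (ltnW hi) (ltnW hj); have c2 := caprk_perp V W hi hj.
have c3 := caprk_perp V W (ltnW hi) hj; have c4 := caprk_perp V W hi (ltnW hj).
have e (k : 'I_N) : (N - k.+1).+1 = (N - k)%N by have := ltn_ord k; lia.
by rewrite /= !e; lia.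
Qed.

Lemma rank_mid V : \rank (fl V n) = d.
Proof. exact: lagr_rank (fl_lagr V). Qed.

Lemma rank_mid1 V : \rank (fl V n.+1) = d.+1.
Proof.
rewrite (fl_perp V (_ : n.+1 <= N)%N) ?rank_perp; last by clear; lia.
by rewrite (_ : N - n.+1 = n)%N ?rank_mid; clear; lia.
Qed.

Let mid_ord : 'I_N := inord n.
Let midE : mid_ord = n :> nat. Proof. by rewrite inordK //; clear; lia. Qed.

Lemma sum_row_mid V W : (\sum_(l < N) relpos V W mid_ord l = 1)%N.
Proof.
have h1 : (n.+1 <= N)%N by clear; lia.
have h0 : (n <= N)%N by clear; lia.
have := sum_relpos V W h1 (leqnn N); have := sum_relpos V W h0 (leqnn N).
rewrite !caprk_full rank_mid rank_mid1 => e0.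
rewrite (bigD1 mid_ord) ?midE //= [X in (_ + X)%N](eq_bigl (fun k : 'I_N => (k < n)%N)).
  rewrite e0 (eq_bigl xpredT) => [|l]; last exact: ltn_ord.
  by clear; lia.
by move=> k; rewrite ltnS [in RHS]ltn_neqAle andbC -val_eqE /= midE.
Qed.

(** The middle row has sum 1 and is symmetric about its centre; a nonzero entry off the centre would
    occur twice. *)
Lemma relpos_mid V W (l : 'I_N) : relpos V W mid_ord l = (l == mid_ord) :> nat.
Proof.
have rm : rev_ord mid_ord = mid_ord by apply: val_inj; rewrite /= midE; clear; lia.
have z (k : 'I_N) : k != mid_ord -> relpos V W mid_ord k = 0%N :> nat.
  move=> km; have := sum_row_mid V W; have := relpos_sym V W mid_ord k; rewrite rm => e.
  have rk : rev_ord k != k.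
    apply: contra km => /eqP /(congr1 val) /= h; apply/eqP/val_inj; rewrite /= midE.
    by move: h (ltn_ord k); clear; lia.
  by rewrite (bigD1 k) //= (bigD1 (rev_ord k)) //= -e; clear; lia.
have [->|lm] := eqVneq l mid_ord; last exact: z.
by have := sum_row_mid V W; rewrite (bigD1 mid_ord) //= big1 ?addn0 // => k /z.
Qed.

End Relpos.

Lemma relpos_tr n d (E : orthogonal_space d) (V W : flag n E) (i j : 'I_(n.*2.+1)) :
  relpos V W i j = relpos W V j i.
Proof.
apply: val_inj => /=; have := relpos_caprk V W i j; have := relpos_caprk W V j i.
by rewrite !(caprkC W V); lia.
Qed.

Lemma relpos_Xi n d (E : orthogonal_space d) (V W : flag n E) : relpos V W \in Xi n d.
Proof.
rewrite inE; apply/and5P; split.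
- have := sum_relpos V W (leqnn _) (leqnn _); rewrite caprk_full (fl_last V) mxrank1 => h;
  apply/eqP; apply: etrans h.
  apply: eq_big => [i|i _]; first by rewrite ltn_ord.
  by apply: eq_bigl => j; rewrite ltn_ord.
- by apply/forallP=> i; apply/forallP=> j; apply/eqP/relpos_sym.
- by rewrite relpos_mid eqxx.
- by apply/forallP=> j; apply/implyP=> /negPf h; rewrite relpos_mid h.
- by apply/forallP=> j; apply/implyP=> /negPf h; rewrite relpos_tr relpos_mid h.
Qed.

(** * The generators depend on the relative position only, even across two spaces *)

Section Invariants.
Variables (n d : nat) (E E' : orthogonal_space d).
Local Notation N := n.*2.+1.
Variables (V W : flag n E) (V' W' : flag n E').
Hypothesis eqVW : relpos V W = relpos V' W'.

Lemma relpos_eq_caprk i j : (i <= N)%N -> (j <= N)%N -> caprk V W i j = caprk V' W' i j.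
Proof.
by move=> hi hj; rewrite -!sum_relpos // eqVW.
Qed.

Lemma relpos_eq_rankl i : (i <= N)%N -> \rank (fl V i) = \rank (fl V' i).
Proof. by move=> hi; rewrite -(caprk_full V W) -(caprk_full V' W') relpos_eq_caprk. Qed.

Lemma relpos_eq_rankr i : (i <= N)%N -> \rank (fl W i) = \rank (fl W' i).
Proof. by move=> hi; rewrite -(caprk_full' V W) -(caprk_full' V' W') relpos_eq_caprk. Qed.

Lemma caprk_sub (F : orthogonal_space d) (Y Z : flag n F) i :
  (fl Y i <= fl Z i)%MS = (caprk Y Z i i == \rank (fl Y i)).
Proof.
apply/idP/eqP => [h|h]; first by rewrite /caprk (capmx_idPl h).
by apply: submx_trans (capmxSr (fl Y i) _); apply: submx_rank_geq (capmxSl _ _) _;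
  rewrite [X in (_ <= X)%N]h.
Qed.

Lemma relpos_eq_subl i : (i <= N)%N -> (fl V i <= fl W i)%MS = (fl V' i <= fl W' i)%MS.
Proof. by move=> hi; rewrite !caprk_sub relpos_eq_caprk // relpos_eq_rankl. Qed.

Lemma relpos_eq_subr i : (i <= N)%N -> (fl W i <= fl V i)%MS = (fl W' i <= fl V' i)%MS.
Proof. by move=> hi; rewrite !caprk_sub !(caprkC W) !(caprkC W') relpos_eq_caprk //
  relpos_eq_rankr. Qed.

Lemma relpos_eq_eq i : (i <= N)%N -> (fl V i == fl W i) = (fl V' i == fl W' i).
Proof.
move=> hi; have e (F : orthogonal_space d) (Y Z : flag n F) :
    (fl Y i == fl Z i) = (fl Y i <= fl Z i)%MS && (fl Z i <= fl Y i)%MS.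
  apply/eqP/andP => [->|/andP/eqmxP]; first by rewrite submx_refl.
  by apply: eq_genmx_normal; apply: flK.
by rewrite !e relpos_eq_subl // relpos_eq_subr.
Qed.

Lemma relpos_eq_agree i : agree_off i V W = agree_off i V' W'.
Proof.
apply: eq_forallb => j; rewrite relpos_eq_eq //.
by have := ltn_ord j; clear; lia.
Qed.

Lemma relpos_eq_flag : (V == W) = (V' == W').
Proof.
have e (F : orthogonal_space d) (Y Z : flag n F) : (Y == Z) =
  [forall i : 'I_N.+1, fl Y i == fl Z i].
  by apply/eqP/idP => /flagP.
by rewrite !e; apply: eq_forallb => i; rewrite relpos_eq_eq // -ltnS.
Qed.

Lemma relpos_eq_e i : (i < N)%N -> e_fun n E i (V, W) = e_fun n E' i (V', W').
Proof.
move=> hi; have hi' := ltnW hi.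
by rewrite !ffunE /codim1 /qdim relpos_eq_subl // relpos_eq_rankl // relpos_eq_agree
  !relpos_eq_rankr.
Qed.

Lemma relpos_eq_f i : (i <= N)%N -> f_fun n E i (V, W) = f_fun n E' i (V', W').
Proof.
move=> hi; have hi' : (i.-1 <= N)%N by apply: leq_trans (leq_pred _) hi.
by rewrite !ffunE /codim1 /qdim relpos_eq_subr // relpos_eq_rankl // relpos_eq_agree
  !relpos_eq_rankr.
Qed.

Lemma relpos_eq_t : t_fun n E (V, W) = t_fun n E' (V', W').
Proof.
have [h h'] : (n <= N)%N /\ (n.-1 <= N)%N by clear; lia.
rewrite !ffunE /qdim -/(caprk V W n n) -/(caprk V' W' n n).
by rewrite relpos_eq_caprk // relpos_eq_agree !relpos_eq_rankr.
Qed.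

Lemma relpos_eq_d a : (a <= N)%N -> d_fun n E a (V, W) = d_fun n E' a (V', W').
Proof.
move=> hi; have hi' : (a.-1 <= N)%N by apply: leq_trans (leq_pred _) hi.
by rewrite !ffunE /qdim relpos_eq_flag !relpos_eq_rankr.
Qed.

Lemma relpos_eq_dV a : (a <= N)%N -> dinv_fun n E a (V, W) = dinv_fun n E' a (V', W').
Proof.
move=> hi; have hi' : (a.-1 <= N)%N by apply: leq_trans (leq_pred _) hi.
by rewrite !ffunE /qdim relpos_eq_flag !relpos_eq_rankr.
Qed.

Lemma relpos_eq_one : Defs.one_fun n E (V, W) = Defs.one_fun n E' (V', W').
Proof. by rewrite !ffunE /= relpos_eq_flag. Qed.

End Invariants.

(** * Realisation of relative positions *)

Lemma rev_allpairs (S T : Type) (s : seq S) (t : seq T) :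
  rev [seq (i, j) | i <- s, j <- t] = [seq (i, j) | i <- rev s, j <- rev t].
Proof.
rewrite rev_flatten -!map_rev -map_comp; congr flatten; apply: eq_map => i /=.
by rewrite map_rev.
Qed.

Section Cells.
Variables (n d : nat) (A : 'M['I_(d.*2.+2)]_(n.*2.+1)).
Hypothesis hA : A \in Xi n d.
Local Notation N := n.*2.+1.
Local Notation D := d.*2.+1.
Local Notation cell := ('I_N * 'I_N)%type.

Definition cell_list : seq cell := [seq (i, j) | i <- enum 'I_N, j <- enum 'I_N].

(* Lexicographic order makes the reversal of the list correspond to the point
   reflection of the matrix. *)
Definition cells : seq cell := flatten [seq nseq (A p.1 p.2) p | p <- cell_list].

Definition rev_cell (p : cell) : cell := (rev_ord p.1, rev_ord p.2).

Lemma cell_list_uniq : uniq cell_list.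
Proof. by apply: allpairs_uniq; rewrite ?enum_uniq // => -[a b] [c e]. Qed.

Lemma mem_cell_list p : p \in cell_list.
Proof. by case: p => i j; apply/allpairsP; exists (i, j); rewrite !mem_enum. Qed.

Lemma rev_enum_ord m : rev (enum 'I_m) = [seq rev_ord i | i <- enum 'I_m].
Proof.
apply: (inj_map val_inj); rewrite map_rev val_enum_ord -map_comp.
apply: (@eq_from_nth _ 0%N); first by rewrite size_rev size_iota size_map size_enum_ord.
move=> i; rewrite size_rev size_iota => hi.
rewrite nth_rev ?size_iota // nth_iota; last by move: hi; clear; lia.
rewrite (nth_map (Ordinal hi)) ?size_enum_ord //= nth_enum_ord //.
Qed.

Lemma rev_cell_list : rev cell_list = [seq rev_cell p | p <- cell_list].
Proof.
rewrite /cell_list rev_allpairs !rev_enum_ord; move: (enum 'I_N) => e.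
rewrite -map_comp map_flatten -map_comp; congr flatten; apply: eq_map => i /=.
by rewrite -!map_comp.
Qed.

Lemma rev_cells : rev cells = [seq rev_cell p | p <- cells].
Proof.
rewrite /cells rev_flatten -map_comp -map_rev rev_cell_list -map_comp map_flatten -map_comp.
congr flatten; apply: eq_map => p /=; rewrite rev_nseq map_nseq.
have : A \in Xi n d := hA; rewrite inE => /and5P[_ /forallP/(_ p.1)/forallP/(_ p.2)/eqP<- _ _
  _] //.
Qed.

Lemma count_cells p : count_mem p cells = A p.1 p.2.
Proof.
rewrite /cells count_flatten sumnE -map_comp big_map (bigD1_seq p) ?mem_cell_list
  ?cell_list_uniq //=.
rewrite count_nseq /= eqxx mul1n big1 ?addn0 // => r /negPf nr.
by rewrite count_nseq /= nr mul0n.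
Qed.

Lemma size_cells : size cells = D.
Proof.
have : A \in Xi n d := hA; rewrite inE => /and5P[/eqP h _ _ _ _]; apply: etrans h.
rewrite /cells size_flatten sumnE /shape -map_comp big_map.
rewrite (eq_bigr (fun p : cell => (A p.1 p.2 : nat))) => [|p _]; last by rewrite /= size_nseq.
rewrite big_allpairs_dep /= big_enum; apply: eq_bigr => i _.
by rewrite big_enum.
Qed.

Let o : 'I_N := inord n.

(** Assigns to each vector of a hyperbolic basis a position in the matrix A, every position being
    used as often as its entry says. The default is never reached, as the list has length D. *)
Definition cell_of (k : 'I_D) : cell := nth (o, o) cells k.

Lemma cell_of_rev k : cell_of (rev_ord k) = rev_cell (cell_of k).
Proof.
have hk : (k < size cells)%N by rewrite size_cells.
rewrite /cell_of -(nth_map _ (o, o)) // -rev_cells nth_rev // size_cells.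
by [].
Qed.

Lemma card_cell_of p : #|[pred k | cell_of k == p]| = A p.1 p.2.
Proof.
rewrite -count_cells -sum1_count (big_nth (o, o)) size_cells big_mkord sum1_card.
by apply: eq_card => k; rewrite !inE.
Qed.

Let Ao : A o o = 1%N :> nat.
Proof. by have : A \in Xi n d := hA; rewrite inE => /and5P[_ _ /eqP]. Qed.

Lemma card_row_mid : #|[pred k | (cell_of k).1 == o]| = 1%N.
Proof.
rewrite -[RHS]Ao -(card_cell_of (o, o)); apply: eq_card => k; rewrite !inE.
apply/eqP/eqP => [e|-> //].
have : (0 < A (cell_of k).1 (cell_of k).2)%N.
  by rewrite -card_cell_of; apply/card_gt0P; exists k; rewrite inE.
have : A \in Xi n d := hA; rewrite inE => /and5P[_ _ _ /forallP/(_ (cell_of k).2) h _].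
rewrite e; move: h e; case: (eqVneq (cell_of k).2 o) => [e2 _ e _|_ /= /eqP-> //].
by rewrite (surjective_pairing (cell_of k)) e e2.
Qed.

Lemma card_col_mid : #|[pred k | (cell_of k).2 == o]| = 1%N.
Proof.
rewrite -[RHS]Ao -(card_cell_of (o, o)); apply: eq_card => k; rewrite !inE.
apply/eqP/eqP => [e|-> //].
have : (0 < A (cell_of k).1 (cell_of k).2)%N.
  by rewrite -card_cell_of; apply/card_gt0P; exists k; rewrite inE.
have : A \in Xi n d := hA; rewrite inE => /and5P[_ _ _ _ /forallP/(_ (cell_of k).1) h].
rewrite e; move: h e; case: (eqVneq (cell_of k).1 o) => [e2 _ e _|_ /= /eqP-> //].
by rewrite (surjective_pairing (cell_of k)) e e2.
Qed.

End Cells.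

Lemma card_negb m (S : pred 'I_m) : (#|S| + #|(fun k => ~~ S k) : pred 'I_m| = m)%N.
Proof.
by rewrite -[RHS]card_ord -(cardC S); congr (_ + _)%N; apply: eq_card => k; rewrite !inE.
Qed.

(** * Flags spanned by parts of a hyperbolic basis *)

Section Coordinate.
Variables (d : nat) (E : orthogonal_space d).
Local Notation D := d.*2.+1.
Variable P : 'M[E]_D.

(** The Gram matrix of the rows of P lives on the antidiagonal. Its values there are left free,
    because the norm of the middle vector need not be a square. *)
Definition hyperbolic := P \in unitmx /\
  forall k l, l != rev_ord k -> (P *m os_form E *m P^T) k l = 0.

Implicit Types S T : pred 'I_D.

Definition coord_mx S : 'M[E]_D := diag_mx (\row_k (S k)%:R).

Lemma coordM S T : coord_mx S *m coord_mx T = coord_mx (predI S T).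
Proof.
rewrite /coord_mx mulmx_diag; congr diag_mx; apply/rowP=> k; rewrite !mxE /= -natrM.
by rewrite mulnb.
Qed.

Lemma eq_coord S T : S =1 T -> coord_mx S = coord_mx T.
Proof. by move=> e; congr diag_mx; apply/rowP=> k; rewrite !mxE e. Qed.

Lemma coord_cap S T : (coord_mx S :&: coord_mx T :=: coord_mx (predI S T))%MS.
Proof.
have fixS (X : 'M[E]_D) S' : (X <= coord_mx S')%MS -> X *m coord_mx S' = X.
  move=> /submxP[Y ->]; rewrite -mulmxA coordM; congr (_ *m _); apply: eq_coord => k /=.
  by rewrite andbb.
apply/eqmxP; apply/andP; split.
  have e : (coord_mx S :&: coord_mx T)%MS = (coord_mx S :&: coord_mx T)%MS *m (coord_mx S *m
    coord_mx T).
    by rewrite mulmxA (fixS _ S) ?capmxSl // fixS ?capmxSr.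
  by rewrite e coordM submxMl.
rewrite sub_capmx -coordM submxMl andbT.
by rewrite coordM (eq_coord (T := predI T S)) -?coordM ?submxMl // => k /=; rewrite andbC.
Qed.

(** The projections for S and for its complement add up to the identity, so the upper bounds for
    their ranks are both attained. *)
Lemma coord_rank S : \rank (coord_mx S) = #|S|.
Proof.
have le T : (\rank (coord_mx T) <= #|T|)%N.
  rewrite /coord_mx diag_mx_sum_delta -sum1_card [X in (_ <= X)%N]big_mkcond /=.
  apply: (big_ind2 (fun (M : 'M[E]_D) (r : nat) => \rank M <= r)%N).
  - by rewrite mxrank0.
  - by move=> M1 r1 M2 r2 h1 h2; apply: leq_trans (mxrank_add _ _) (leq_add h1 h2).
  move=> k _; rewrite !mxE -[T k]/(k \in T); case: (k \in T); rewrite ?scale1r ?mxrank_delta //.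
  by rewrite scale0r mxrank0.
apply/eqP; rewrite eqn_leq le /=.
have e1 : coord_mx S + coord_mx (fun k => ~~ S k) = 1%:M.
  rewrite -raddfD /= -diag_const_mx; congr diag_mx; apply/rowP=> k; rewrite !mxE /=.
  by case: (S k); rewrite ?addr0 ?add0r.
have := mxrank_add (coord_mx S) (coord_mx (fun k => ~~ S k)); rewrite e1 mxrank1.
by have := le (fun k => ~~ S k); have := card_negb S; lia.
Qed.

Definition coord_span S : 'M[E]_D := <<coord_mx S *m P>>%MS.

Lemma eq_span S T : S =1 T -> coord_span S = coord_span T.
Proof. by move=> e; rewrite /coord_span (eq_coord e). Qed.

Hypothesis hP : hyperbolic.

Let freeP : row_free P. Proof. by rewrite row_free_unit; case: hP. Qed.

Lemma span_rank S : \rank (coord_span S) = #|S|.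
Proof. by rewrite genmxE mxrankMfree // coord_rank. Qed.

Lemma span_cap_rank S T : \rank (coord_span S :&: coord_span T)%MS = #|predI S T|.
Proof.
rewrite (cap_eqmx (genmxE _) (genmxE _)) (capmx_unit _ _ (proj1 hP)).
by rewrite mxrankMfree // coord_cap coord_rank.
Qed.

Lemma spanS S T : {subset S <= T} -> (coord_span S <= coord_span T)%MS.
Proof.
move=> ST; rewrite !genmxE; apply: submxMr.
rewrite (eq_coord (T := predI S T)) -?coordM ?submxMl // => k /=.
by case h: (S k) => //=; symmetry; apply: ST.
Qed.

Lemma span_perp S : (perp (coord_span S) :=: coord_span (fun k => ~~ S (rev_ord k)))%MS.
Proof.
set T := fun k => _; have h : (coord_span T <= perp (coord_span S))%MS.
  rewrite sub_perp; have /submxP[C ->] : (coord_span T <= coord_mx T *m P)%MS by rewrite genmxE.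
  have /submxP[C' ->] : (coord_span S <= coord_mx S *m P)%MS by rewrite genmxE.
  rewrite !trmx_mul; set Gm := P *m os_form E *m P^T.
  have -> : C *m (coord_mx T *m P) *m os_form E *m (P^T *m (coord_mx S)^T *m C'^T) =
            C *m (coord_mx T *m Gm *m (coord_mx S)^T) *m C'^T by rewrite /Gm !mulmxA.
  suff -> : coord_mx T *m Gm *m (coord_mx S)^T = 0 by rewrite mulmx0 mul0mx.
  have hG : forall k l, l != rev_ord k -> Gm k l = 0 := proj2 hP.
  clearbody Gm; apply/matrixP=> k l; rewrite tr_diag_mx mul_mx_diag mul_diag_mx !mxE.
  have [->|/hG ->] := eqVneq l (rev_ord k); last by rewrite mulr0 mul0r.
  by rewrite /T; case: (S _); rewrite ?mulr0 ?mul0r.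
apply/eqmx_sym/eqmxP; rewrite h submx_rank_geq // rank_perp !span_rank.
have -> : #|T| = #|(fun k => ~~ S k) : pred 'I_D|.
  rewrite -(card_image (inv_inj (@rev_ordK D)) (fun k => ~~ S k)); apply: eq_card => k.
  by rewrite -{2}(rev_ordK k) mem_image //; apply: inv_inj (@rev_ordK D).
by have := card_negb S; clear; lia.
Qed.

Variables (n : nat) (rho : 'I_D -> 'I_(n.*2.+1)).
Hypothesis rho_rev : forall k, rho (rev_ord k) = rev_ord (rho k).
Hypothesis rho_mid : #|[pred k | rho k == inord n]| = 1%N.
Local Notation N := n.*2.+1.

(** Since rho commutes with the reflection, [span_perp] gives the required duality. One basis vector
    sits in the middle and the reflection pairs the others, so d of them lie below. *)
Lemma flag_of_index : exists V : flag n E,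
  forall i, (i <= N)%N -> (fl V i :=: coord_span (fun k => (rho k < i)%N))%MS.
Proof.
pose S (i : nat) : pred 'I_D := fun k => (rho k < i)%N.
have revS i k : (i <= N)%N -> ~~ S (N - i)%N (rev_ord k) = S i k.
  by rewrite /S rho_rev /=; have := ltn_ord (rho k); lia.
have cS : #|S n| = d.
  have e : #|S n| = #|[pred k | (n < rho k)%N]|.
    rewrite -(card_image (inv_inj (@rev_ordK D)) (S n)); apply: eq_card => k.
    rewrite -{1}(rev_ordK k) mem_image; last exact: inv_inj (@rev_ordK D).
    by rewrite !inE /in_mem /= /S rho_rev /=; have := ltn_ord (rho k); lia.
  have := card_negb (S n).
  have -> : #|(fun k => ~~ S n k) : pred 'I_D| = (#|[pred k | rho k == inord n]| +
    #|[pred k | (n < rho k)%N]|)%N.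
    rewrite -cardUI [X in (_ + X)%N]eq_card0 ?addn0.
      apply: eq_card => k; rewrite !inE -val_eqE /= inordK; last by clear; lia.
      by rewrite /in_mem /= /S; lia.
    move=> k; rewrite !inE -val_eqE /= inordK; last by clear; lia.
    by apply/negP => /andP[/eqP->]; rewrite ltnn.
  by rewrite -e rho_mid; clear; lia.
have [V hV] : exists V : flag n E, forall i, (i <= n)%N -> fl V i = coord_span (S i).
  apply: flag_build => [i||i hi|].
  - by rewrite /coord_span genmx_id.
  - rewrite (eq_span (T := pred0)) // /coord_span; apply/eqP; rewrite -mxrank_eq0 genmxE.
    by rewrite mxrankMfree // coord_rank eq_card0.
  - by apply: spanS => k; rewrite /in_mem /= /S => /leqW.
  rewrite /lagrangian /isotropic span_perp span_rank cS eqxx andbT; apply: spanS => k.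
  by rewrite /in_mem /= /S rho_rev /=; have := ltn_ord (rho k); lia.
exists V => i hi; have [hin|hin] := leqP i n; first by rewrite hV.
apply: eqmx_trans (fl_perp V hi) _; rewrite hV; last by move: hin; clear; lia.
apply: eqmx_trans (span_perp _) _; rewrite (eq_span (T := S i)) // => k.
exact: revS.
Qed.

End Coordinate.

(** Rows of the cells define V and columns define W. Then V_a :&: W_b is spanned by the basis
    vectors with cells in the first a rows and b columns, and the mixed difference counts the
    vectors in the cell (i, j). *)
Lemma Xi_realised n d (E : orthogonal_space d) (P : 'M[E]_(d.*2.+1)) A :
  hyperbolic P -> A \in Xi n d -> exists V W : flag n E, relpos V W = A.
Proof.
move=> hP hA; pose c := cell_of A.
have rc k : c (rev_ord k) = rev_cell (c k) by apply: cell_of_rev.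
have [V hV] := flag_of_index hP (rho := fun k => (c k).1) (fun k =>
  congr1 fst (rc k)) (card_row_mid hA).
have [W hW] := flag_of_index hP (rho := fun k => (c k).2) (fun k =>
  congr1 snd (rc k)) (card_col_mid hA).
exists V, W; apply/matrixP=> i j; apply: val_inj => /=.
have cE a b : (a <= n.*2.+1)%N -> (b <= n.*2.+1)%N ->
    caprk V W a b = (\sum_k (((c k).1 < a) && ((c k).2 < b)))%N.
  move=> ha hb; rewrite /caprk (cap_eqmx (hV a ha) (hW b hb)) span_cap_rank //.
  by rewrite -sum1_card [LHS]big_mkcond /=; apply: eq_bigr => k _; rewrite /in_mem /=;
    case: ifP.
have := relpos_caprk V W i j; have [hi hj] := (ltn_ord i, ltn_ord j).
rewrite !cE //; try exact: ltnW.
have -> : A i j = (\sum_k (c k == (i, j)))%N :> nat.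
  by rewrite -(card_cell_of hA (i, j)) -sum1_card [LHS]big_mkcond; apply: eq_bigr => k _;
    rewrite inE; case: ifP.
move: (relpos V W i j) => r h; apply/eqP.
set s1 := (\sum_k _)%N in h; set s2 := (X in (_ + X = _)%N) in h.
rewrite -(eqn_add2r (s1 + s2)) addnA h /s1 /s2 -!big_split /=; apply/eqP/eq_bigr => k _.
rewrite -[c k == _]/(((c k).1 == i) && ((c k).2 == j)) -!val_eqE /=.
by case: (ltngtP (c k).1 i) => h1; case: (ltngtP (c k).2 j) => h2; rewrite ?ltnS; lia.
Qed.

(** * Existence of hyperbolic bases *)

Section HyperbolicBasis.
Variables (d : nat) (E : orthogonal_space d).
Local Notation D := d.*2.+1.
Local Notation Q := (os_form E).

Lemma lagr_dual (M : 'M[E]_D) : lagrangian M -> exists B B' : 'M[E]_(d, D),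
  [/\ B *m Q *m B^T = 0, B *m Q *m B'^T = 1%:M & B' *m Q *m B'^T = 0].
Proof.
move=> lM; have : exists2 B : 'M[E]_(\rank M, D), (B :=: M)%MS & row_free B.
  by exists (row_base M); [apply: eq_row_base | apply: row_base_free].
rewrite (lagr_rank lM) => -[B eB fB].
have BB : B *m Q *m B^T = 0.
  have /submxP[C eC] : (B <= M)%MS by rewrite eB.
  have : (B <= perp M)%MS by rewrite eB; apply: lagr_iso.
  by rewrite sub_perp {3}eC trmx_mul mulmxA => /eqP->; rewrite mul0mx.
(* Nondegeneracy yields a family dual to the basis B of M, not yet isotropic. *)
have /row_freeP[R' hR] : row_free (B *m Q).
  by rewrite -row_leq_rank mxrankMfree ?row_free_unit ?os_nondeg // row_leq_rank.
pose R := R'^T; have BR : B *m Q *m R^T = 1%:M by rewrite trmxK.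
have RB : R *m Q *m B^T = 1%:M.
  by apply: trmx_inj; rewrite !trmx_mul trmxK os_sym mulmxA BR trmx1.
have [S SE S_sym] : exists2 S, R *m Q *m R^T = S & S^T = S.
  by exists (R *m Q *m R^T); rewrite // !trmx_mul trmxK os_sym mulmxA.
(* Subtracting half of the Gram matrix S makes the dual family isotropic. *)
pose h : E := 2%:R^-1.
have trB' : (R - h *: (S *m B))^T = R^T - h *: (B^T *m S).
  by apply/matrixP=> a b; rewrite -{2}S_sym -trmx_mul !mxE.
exists B, (R - h *: (S *m B)); split=> //.
  by rewrite trB' mulmxBr -scalemxAr mulmxA BB mul0mx scaler0 subr0.
rewrite trB' !mulmxBl !mulmxBr -!scalemxAl -!scalemxAr SE.
have -> : R *m Q *m (B^T *m S) = S by rewrite mulmxA RB mul1mx.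
have -> : S *m B *m Q *m R^T = S by rewrite -!mulmxA [B *m _]mulmxA BR mulmx1.
have -> : S *m B *m Q *m (B^T *m S) = 0.
  by rewrite -!mulmxA [B *m _]mulmxA [B *m Q *m _]mulmxA BB mul0mx mulmx0.
rewrite !scaler0 subr0 -addrA -opprD -scalerDr -mulr2n -scaler_nat scalerA mulVf ?scale1r
  ?subrr //.
exact: two_neq0.
Qed.

Lemma lagr_hyperbolic (M : 'M[E]_D) : lagrangian M -> exists P : 'M[E]_D, hyperbolic P.
Proof.
move=> /lagr_dual[B [B' [BB BB' B'B']]].
have B'B : B' *m Q *m B^T = 1%:M.
  by apply: trmx_inj; rewrite !trmx_mul trmxK os_sym mulmxA BB' trmx1.
have [x [x0 xB xB']] : exists x : 'rV[E]_D, [/\ x != 0, x *m Q *m B^T = 0 & x *m Q *m B'^T = 0].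
  have : kermx (Q *m (col_mx B B')^T) != 0.
    rewrite kermx_eq0 /row_free neq_ltn; apply/orP; left.
    by apply: leq_ltn_trans (rank_leq_col _) _; clear; lia.
  case/rowV0Pn=> x /sub_kermxP; rewrite tr_col_mx mulmxA mul_mx_row => h x0; exists x;
    split=> //.
    by have := congr1 lsubmx h; rewrite row_mxKl linear0.
  by have := congr1 rsubmx h; rewrite row_mxKr linear0.
(* The rows of B, then x, then the rows of B' backwards, so that dual vectors occupy opposite
   positions; the final 0 is never reached for k < D. *)
pose r (k : nat) : 'rV[E]_D :=
  if insub k is Some a then row (a : 'I_d) B else
  if k == d then x else if insub (d.*2 - k)%N is Some a then row (a : 'I_d) B' else 0.
have r_lo (a : 'I_d) : r a = row a B by rewrite /r valK.
have r_mid : r d = x by rewrite /r insubF ?ltnn // eqxx.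
have r_hi (a : 'I_d) : r (d.*2 - a)%N = row a B'.
  have ha := ltn_ord a; rewrite /r insubF; last by move: ha; clear; lia.
  rewrite ifN; last by move: ha; clear; lia.
  by rewrite subKn ?valK //; move: ha; clear; lia.
have r_case (k : 'I_D) : [\/ exists a : 'I_d, k = a :> nat, k =
  d :> nat | exists a : 'I_d, k = (d.*2 - a)%N :> nat].
  have hk := ltn_ord k; case: (ltngtP k d) => h; last by constructor 2.
    by constructor 1; exists (Ordinal h).
  have h' : (d.*2 - k < d)%N by move: h hk; clear; lia.
  by constructor 3; exists (Ordinal h') => /=; move: h hk; clear; lia.
have bE (Y Z : 'M[E]_(d, D)) a b : bilin (row a Y) (row b Z) = (Y *m Q *m Z^T) a b.
  by rewrite /bilin -row_mul [LHS]mxE [RHS]mxE; apply: eq_bigr => j _; rewrite !mxE.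
have xE (Z : 'M[E]_(d, D)) b : x *m Q *m Z^T = 0 -> bilin x (row b Z) = 0.
  move=> h; have <- : (x *m Q *m Z^T) 0 b = 0 by rewrite h mxE.
  by rewrite /bilin [LHS]mxE [RHS]mxE; apply: eq_bigr => j _; rewrite !mxE.
pose P : 'M[E]_D := \matrix_(k < D) r k.
have GE k l : (P *m Q *m P^T) k l = bilin (r k) (r l).
  rewrite /bilin -[r k](rowK (fun k : 'I_D => r k)) -[r l](rowK (fun k : 'I_D => r k)) -/P.
  by rewrite -row_mul [LHS]mxE [RHS]mxE; apply: eq_bigr => j _; rewrite !mxE.
have G0 k l : l != rev_ord k -> (P *m Q *m P^T) k l = 0.
  rewrite GE -val_eqE /=.
  case: (r_case k) => [[a ->]|->|[a ->]]; case: (r_case l) => [[b ->]|->|[b ->]];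
    rewrite ?r_lo ?r_mid ?r_hi ?bE ?BB ?B'B' ?BB' ?B'B ?mxE ?xE // 1?bfC ?xE //.
  - case: (eqVneq a b) => [->|//]; have := ltn_ord b; move=> hb /eqP[]; lia.
  - by move=> /eqP[]; clear; lia.
  - case: (eqVneq a b) => [->|//]; have := ltn_ord b; move=> hb /eqP[]; lia.
have G1 (k : 'I_D) : k != d :> nat -> (P *m Q *m P^T) (rev_ord k) k = 1.
  rewrite GE; have hk := ltn_ord k; case: (r_case k) => [[a ak]|->|[a ak]]; last 1 first.
  - have -> : rev_ord k = a :> nat by rewrite /= ak; have := ltn_ord a; lia.
    by rewrite ak r_lo r_hi bE BB' mxE eqxx.
  - have -> : rev_ord k = (d.*2 - a)%N :> nat by rewrite /= ak; have := ltn_ord a; lia.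
    by rewrite ak r_lo r_hi bE B'B mxE eqxx.
  - by rewrite eqxx.
(* In a linear relation, pairing with the k-th vector isolates the coefficient at the opposite
   position for k other than d; what remains is a multiple of the nonzero x. *)
exists P; split=> //; rewrite -row_free_unit; apply: inj_row_free => u uP.
have u0 (k : 'I_D) : k != d :> nat -> u 0 (rev_ord k) = 0.
  move=> kd; have := congr1 (fun A : 'rV[E]_D => (A *m Q *m P^T) 0 k) uP.
  rewrite !mul0mx -!mulmxA !mulmxA -(mulmxA u) -(mulmxA u) !mxE (bigD1 (rev_ord k)) //= G1 //
    mulr1.
  by rewrite big1 ?addr0 // => l lk; rewrite G0 ?mulr0 // -(inj_eq rev_ord_inj) rev_ordK eq_sym.
have uE : u 0 (inord d) *: x = 0.
  rewrite -uP mulmx_sum_row (bigD1 (inord d)) //= rowK inordK ?r_mid; last by clear; lia.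
  rewrite big1 ?addr0 // => l ld; rewrite -(rev_ordK l) u0 ?scale0r //.
  apply: contra ld => /eqP /= e; apply/eqP/val_inj; rewrite /= inordK; last by clear; lia.
  by move: e (ltn_ord l); clear; lia.
apply/rowP=> k; rewrite mxE -(rev_ordK k).
have [e|ne] := eqVneq (rev_ord k : nat) d; last exact: u0.
move/eqP: uE; rewrite scaler_eq0 (negPf x0) orbF => /eqP <-; congr (u 0 _).
by apply: val_inj; rewrite rev_ordK /= inordK; move: e (ltn_ord k) => /=; clear; lia.
Qed.

Lemma flag_hyperbolic n (V : flag n E) : exists P : 'M[E]_D, hyperbolic P.
Proof. exact: lagr_hyperbolic (fl_lagr V). Qed.

End HyperbolicBasis.

(** * The split space over a prime field *)

Section PrimeSpace.
Variables (d p : nat) (pp : prime p) (op : odd p).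
Local Notation D := d.*2.+1.

Definition antidiag : 'M['F_p]_D := \matrix_(k, l) (l == rev_ord k)%:R.

Lemma antidiag_sym : antidiag^T = antidiag.
Proof.
apply/matrixP=> k l; rewrite !mxE -(inj_eq rev_ord_inj) rev_ordK eq_sym.
by [].
Qed.

Lemma antidiag_unit : antidiag \in unitmx.
Proof.
suff /mulmx1_unit[] : antidiag *m antidiag = 1%:M by [].
apply/matrixP=> k l; rewrite !mxE (bigD1 (rev_ord k)) //= !mxE eqxx mul1r rev_ordK big1 ?addr0.
  by rewrite eq_sym.
by move=> m /negPf h; rewrite !mxE h mul0r.
Qed.

Lemma card_Fp_odd : odd #|('F_p : finFieldType)|.
Proof. by rewrite card_Fp. Qed.

Definition prime_space : orthogonal_space d :=
  OrthogonalSpace card_Fp_odd antidiag_sym antidiag_unit.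

Lemma prime_space_hyperbolic : @hyperbolic d prime_space 1%:M.
Proof.
split; first exact: unitmx1.
by move=> k l /negPf h; rewrite mul1mx trmx1 mulmx1 mxE h.
Qed.

Lemma card_prime_space : #|prime_space| = p.
Proof. exact: card_Fp. Qed.

End PrimeSpace.

(** * Transfer to the generic algebra *)

Section Transfer.
Variables (n d : nat) (E : orthogonal_space d).
Local Notation mat := 'M['I_(d.*2.+2)]_(n.*2.+1).
Variable c : mat -> mat -> mat -> {poly int}.
Local Notation X := (flag n E).
Implicit Types (f g : schur n E) (A : mat).

Lemma schurD f g p : (f + g) p = f p + g p.
Proof. by rewrite -[LHS]/((schur_val f + schur_val g) p) ffunE. Qed.

Lemma schur0 p : (0 : schur n E) p = 0.
Proof. by rewrite -[LHS]/((0 : {ffun X * X -> laurent^o}) p) ffunE. Qed.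

Lemma schurN f p : (- f) p = - f p.
Proof. by rewrite -[LHS]/((- schur_val f) p) ffunE. Qed.

Lemma schurZ (a : laurent) f p : (a *: f) p = a * f p.
Proof. by rewrite -[LHS]/((a *: schur_val f) p) ffunE. Qed.

(* By Witt's theorem this holds for every invariant function; it is immediate
   for the elements that occur in the relations. *)
Definition by_relpos f := forall p p' : X * X, relpos p.1 p.2 = relpos p'.1 p'.2 -> f p = f p'.

Lemma by_relposD f g : by_relpos f -> by_relpos g -> by_relpos (f + g).
Proof. by move=> hf hg p p' e; rewrite !schurD (hf _ _ e) (hg _ _ e). Qed.

Lemma by_relposN f : by_relpos f -> by_relpos (- f).
Proof. by move=> hf p p' e; rewrite !schurN (hf _ _ e). Qed.

Lemma by_relposZ a f : by_relpos f -> by_relpos (a *: f).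
Proof. by move=> hf p p' e; rewrite !schurZ (hf _ _ e). Qed.

Lemma by_relpos0 : by_relpos 0.
Proof. by move=> p p' _; rewrite !schur0. Qed.

Lemma by_relpos_conv f g : by_relpos (conv c f g).
Proof. by move=> p p' e; rewrite !ffunE e. Qed.

Lemma by_relpos_e i : (0 < i < n)%N -> by_relpos (e_elt n E i).
Proof.
move=> hi [V W] [V' W'] /= h; apply: (relpos_eq_e h).
by move: hi; clear; lia.
Qed.

Lemma by_relpos_f i : (0 < i < n)%N -> by_relpos (f_elt n E i).
Proof.
move=> hi [V W] [V' W'] /= h; apply: (relpos_eq_f h).
by move: hi; clear; lia.
Qed.

Lemma by_relpos_one : by_relpos (one_elt n E).
Proof. by move=> [V W] [V' W'] /= h; apply: (relpos_eq_one h). Qed.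

Lemma coef_at_relpos f V W : by_relpos f -> coef_at f (relpos V W) = f (V, W).
Proof.
move=> hf; rewrite /coef_at; case: pickP => [p /eqP e|/(_ (V, W))]; last by rewrite eqxx.
exact: hf.
Qed.

Section Specialise.
Variables (p : nat) (pp : prime p) (op : odd p).
Local Notation Ep := (prime_space d pp op).
Local Notation s := (sqrtC (p%:R : algC)).
Local Notation hs := (sqrtC_prime_neq0 pp).

(** Orbits over E and over F_p are identified through their matrices, so a function on pairs of
    flags over E becomes one over F_p, with v = sqrt p. *)
Definition specialise f (V W : flag n Ep) : algC := evalv hs (coef_at f (relpos V W)).

Lemma specD f g : specialise (f + g) = fun V W => specialise f V W + specialise g V W.
Proof.
apply: funext => V; apply: funext => W; rewrite /specialise -rmorphD; congr (evalv _ _).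
by rewrite /coef_at; case: pickP => [q _|_]; rewrite ?schurD ?addr0.
Qed.

Lemma spec0 V W : specialise 0 V W = 0.
Proof.
by rewrite /specialise /coef_at; case: pickP => [q _|_]; rewrite ?schur0 rmorph0.
Qed.

Lemma specN f : specialise (- f) = fun V W => - specialise f V W.
Proof.
apply: funext => V; apply: funext => W; rewrite /specialise -rmorphN; congr (evalv _ _).
by rewrite /coef_at; case: pickP => [q _|_]; rewrite ?schurN ?oppr0.
Qed.

Lemma specZ a f : specialise (a *: f) = fun V W => evalv hs a * specialise f V W.
Proof.
apply: funext => V; apply: funext => W; rewrite /specialise -rmorphM; congr (evalv _ _).
by rewrite /coef_at; case: pickP => [q _|_]; rewrite ?schurZ ?mulr0.
Qed.

Lemma sqrtC_prime_sq : s ^+ 2 = #|Ep|%:R.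
Proof. by rewrite sqrtCK card_prime_space. Qed.

Section Split.
Variable V0 : X.

(* Without a flag over E there would be orbits on which [coef_at] takes its
   default value 0. *)
Lemma realised A : A \in Xi n d -> exists V W : X, relpos V W = A.
Proof. by have [P hP] := flag_hyperbolic V0; apply: Xi_realised hP. Qed.

Lemma coef_at_by f (F : flag n Ep -> flag n Ep -> laurent) :
  (forall (V W : X) (V' W' : flag n Ep), relpos V W = relpos V' W' -> f (V, W) = F V' W') ->
  specialise f = fun V W => evalv hs (F V W).
Proof.
move=> h; apply: funext => V'; apply: funext => W'; congr (evalv _ _).
rewrite /coef_at; case: pickP => [[V W] /= /eqP e|no]; first exact: h.
have [V [W e]] := realised (relpos_Xi V' W').
by have := no (V, W); rewrite /= e eqxx.
Qed.

Lemma spec_e i : (0 < i < n)%N -> specialise (e_elt n E i) = e_op s i.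
Proof.
move=> hi; rewrite -(ev_e _ hs hi); apply: coef_at_by => V W V' W' e.
by apply: relpos_eq_e => //; move: hi; clear; lia.
Qed.

Lemma spec_f i : (0 < i < n)%N -> specialise (f_elt n E i) = f_op s i.
Proof.
move=> hi; rewrite -(ev_f _ hs hi); apply: coef_at_by => V W V' W' e.
by apply: relpos_eq_f => //; move: hi; clear; lia.
Qed.

Lemma spec_t : (0 < n)%N -> specialise (t_elt n E) = t_op s.
Proof.
by move=> hn; rewrite -(ev_t _ hs hn); apply: coef_at_by => V W V' W' e; apply: relpos_eq_t.
Qed.

Lemma spec_d a : (0 < a <= n)%N -> specialise (d_elt n E a) = d_op s a.
Proof.
move=> ha; rewrite -(ev_d _ hs ha); apply: coef_at_by => V W V' W' e.
by apply: relpos_eq_d => //; move: ha; clear; lia.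
Qed.

Lemma spec_dV a : (0 < a <= n)%N -> specialise (dinv_elt n E a) = dinv_op s a.
Proof.
move=> ha; rewrite -(ev_dV _ hs ha); apply: coef_at_by => V W V' W' e.
by apply: relpos_eq_dV => //; move: ha; clear; lia.
Qed.

Lemma spec_one : specialise (one_elt n E) = one_op s.
Proof.
rewrite -(ev_one _ _ hs); apply: coef_at_by => V W V' W' e.
exact: relpos_eq_one.
Qed.

(** Sorting the intermediate flags Z by the positions of (V, Z) and (Z, W) turns the product of
    matrices into the sum over pairs of orbits, with the structure constants taken at q = p. *)
Lemma spec_conv f g : is_structure_constants c -> specialise (conv c f g) =
  convol (specialise f) (specialise g).
Proof.
move=> hc; apply: funext => V; apply: funext => W; rewrite /specialise /convol.
have [V1 [W1 e]] := realised (relpos_Xi V W).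
rewrite -{1}e coef_at_relpos; last exact: by_relpos_conv.
rewrite ffunE /= e rmorph_sum /=.
pose cf (h : schur n E) A := evalv hs (coef_at h A).
transitivity (\sum_(A in Xi n d) \sum_(B in Xi n d) \sum_(Z : flag n Ep)
    cf f A * cf g B * ((relpos V Z == A) && (relpos Z W == B))%:R).
  apply: eq_bigr => A hA; rewrite rmorph_sum; apply: eq_bigr => B hB.
  rewrite !rmorphM /= (ev_eval_v2 _ _ (k := #|Ep|) sqrtC_prime_sq) (hc Ep A B _ hA hB
    (relpos_Xi V W) V W erefl).
  rewrite -mulr_sumr; congr (_ * _); rewrite rmorph_nat -natr_sum -sum1_card big_mkcond /=.
  by congr (_%:R); apply: eq_bigr => Z _; rewrite inE; case: ifP.
transitivity (\sum_(Z : flag n Ep) \sum_(A in Xi n d) \sum_(B in Xi n d)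
    cf f A * cf g B * ((relpos V Z == A) && (relpos Z W == B))%:R).
  by rewrite [RHS]exchange_big; apply: eq_bigr => A _; rewrite [RHS]exchange_big.
apply: eq_bigr => Z _.
rewrite (bigD1 (relpos V Z)) ?relpos_Xi //= [X in _ + X]big1 ?addr0; last first.
  move=> A /andP[_ /negPf nA]; apply: big1 => B _; rewrite eq_sym nA mulr0 //.
rewrite (bigD1 (relpos Z W)) ?relpos_Xi //= [X in _ + X]big1 ?addr0.
  by rewrite !eqxx mulr1.
by move=> B /andP[_ /negPf nB]; rewrite [relpos Z W == _]eq_sym nB andbF mulr0.
Qed.

End Split.
End Specialise.

(** The comparison over F_p may assume a flag over E, which supplies a hyperbolic basis: equality of
    functions is tested on pairs of flags, and such a pair provides one. *)
Lemma transfer f g : by_relpos f -> by_relpos g ->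
  (X -> forall p (pp : prime p) (op : odd p) (V W : flag n (prime_space d pp op)),
    specialise f V W = specialise g V W) -> f = g.
Proof.
move=> hf hg h; apply: val_inj; apply/ffunP=> -[V W] /=.
apply/eqP; rewrite -subr_eq0; apply/eqP/ev_inj => p pp op.
have [V' [W' e]] := Xi_realised (prime_space_hyperbolic d pp op) (relpos_Xi V W).
have := h V p pp op V' W'; rewrite /specialise e !coef_at_relpos // => e'.
by rewrite /eval_sqrt rmorphB /= e' subrr.
Qed.

Lemma transfer_cross f g h : is_structure_constants c -> by_relpos h ->
  (X -> forall p (pp : prime p) (op : odd p) (V W : flag n (prime_space d pp op)),
    twice_cross (sqrtC p%:R) (specialise f) (specialise g) V W = specialise h V W) ->
  f *[c] f *[c] g - vdbl2 *: (f *[c] g *[c] f) + g *[c] (f *[c] f) = h.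
Proof.
move=> hc hh H; apply: transfer => //.
  by do ![apply: by_relposD | apply: by_relposN | apply: by_relposZ | apply: by_relpos_conv].
move=> V0 p pp op V W; rewrite -(H V0) !(specD, specN, specZ) !(spec_conv pp op V0 _ _ hc).
by rewrite ev_vdbl2 /twice_cross addrAC.
Qed.

Lemma transfer_conv f g f' g' : is_structure_constants c ->
  (X -> forall p (pp : prime p) (op : odd p),
    convol (specialise (pp := pp) (op := op) f) (specialise g) =
      convol (specialise f') (specialise g')) ->
  f *[c] g = f' *[c] g'.
Proof.
move=> hc H; apply: transfer; try exact: by_relpos_conv.
by move=> V0 p pp op V W; rewrite !(spec_conv pp op V0 _ _ hc) (H V0).
Qed.

End Transfer.

Theorem proposition5p4 (n d : nat) (hn : (0 < n)%N) (hd : (0 < d)%N)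
    (E : orthogonal_space d)
    (c : 'M['I_(d.*2.+2)]_(n.*2.+1) -> 'M['I_(d.*2.+2)]_(n.*2.+1) ->
         'M['I_(d.*2.+2)]_(n.*2.+1) -> {poly int})
    (hc : is_structure_constants c) :
  let e := e_elt n E in
  let f := f_elt n E in
  let dg := d_elt n E in
  let dgV := dinv_elt n E in
  let t := t_elt n E in
  let one := one_elt n E in
  (* (a) *)
  ((forall a, (0 < a <= n)%N ->
      dg a *[c] dgV a = one /\ dgV a *[c] dg a = one) /\
   (forall a b, (0 < a <= n)%N -> (0 < b <= n)%N ->
      dg a *[c] dg b = dg b *[c] dg a) /\
   (forall a j, (0 < a <= n)%N -> (0 < j < n)%N ->
      dg a *[c] e j *[c] dgV a
        = vpow ((a == j)%:Z - (a == j.+1)%:Z) *: e j) /\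
   (forall a j, (0 < a <= n)%N -> (0 < j < n)%N ->
      dg a *[c] f j *[c] dgV a
        = vpow (- (a == j)%:Z + (a == j.+1)%:Z) *: f j) /\
   (forall i j, (0 < i < n)%N -> (0 < j < n)%N ->
      exists z : schur n E,
        (vpow 1 - vpow (-1)) *: z
          = dg i *[c] dgV i.+1 - dgV i *[c] dg i.+1 /\
        e i *[c] f j - f j *[c] e i = (i == j)%:R *: z) /\
   (forall i j, (0 < i < n)%N -> (0 < j < n)%N ->
      `|i%:Z - j%:Z| = 1 ->
      (e i *[c] e i) *[c] e j + e j *[c] (e i *[c] e i)
        = vdbl2 *: (e i *[c] e j *[c] e i) /\
      (f i *[c] f i) *[c] f j + f j *[c] (f i *[c] f i)
        = vdbl2 *: (f i *[c] f j *[c] f i)) /\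
   (forall i j, (0 < i < n)%N -> (0 < j < n)%N ->
      `|i%:Z - j%:Z| > 1 ->
      e i *[c] e j = e j *[c] e i /\ f i *[c] f j = f j *[c] f i)) /\
  (* (b) *)
  (forall i, (0 < i <= n)%N -> dg i *[c] t = t *[c] dg i) /\
  (* (c) *)
  (forall i, (0 < i < n.-1)%N ->
     e i *[c] t = t *[c] e i /\ f i *[c] t = t *[c] f i) /\
  (* (d) *)
  ((1 < n)%N ->
     (e n.-1 *[c] e n.-1) *[c] t - vdbl2 *: (e n.-1 *[c] t *[c] e n.-1)
       + t *[c] (e n.-1 *[c] e n.-1) = 0) /\
  (* (e) *)
  ((1 < n)%N ->
     (f n.-1 *[c] f n.-1) *[c] t - vdbl2 *: (f n.-1 *[c] t *[c] f n.-1)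
       + t *[c] (f n.-1 *[c] f n.-1) = 0) /\
  (* (f) *)
  ((1 < n)%N ->
     (t *[c] t) *[c] e n.-1 - vdbl2 *: (t *[c] e n.-1 *[c] t)
       + e n.-1 *[c] (t *[c] t) = e n.-1) /\
  (* (g) *)
  ((1 < n)%N ->
     (t *[c] t) *[c] f n.-1 - vdbl2 *: (t *[c] f n.-1 *[c] t)
       + f n.-1 *[c] (t *[c] t) = f n.-1).
Proof.
move=> e f dg dgV t one.
have hs p (pp : prime p) : sqrtC (p%:R : algC) != 0 := sqrtC_prime_neq0 pp.
split.
  split.
    move=> a ha; split; apply: transfer; try exact: by_relpos_conv; try exact: by_relpos_one.
      move=> V0 p pp op V W; rewrite (spec_conv pp op V0 _ _ hc) (spec_d pp op V0) //
        (spec_dV pp op V0) //.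
      by rewrite (spec_one pp op V0) rel_dd // hs.
    move=> V0 p pp op V W; rewrite (spec_conv pp op V0 _ _ hc) (spec_d pp op V0) // (spec_dV
      pp op V0) //.
    by rewrite (spec_one pp op V0) rel_dd' // hs.
  split.
    move=> a b ha hb; apply: transfer_conv => // V0 p pp op.
    by rewrite !(spec_d pp op V0) // rel_dC // hs.
  split.
    move=> a j ha hj; apply: transfer; first exact: by_relpos_conv.
      by apply: by_relposZ; apply: by_relpos_e.
    move=> V0 p pp op V W; rewrite specZ !(spec_conv pp op V0 _ _ hc) (spec_d pp op V0) //.
    by rewrite (spec_dV pp op V0) // (spec_e pp op V0) // rel_de ?hs // ev_vpow.
  split.
    move=> a j ha hj; apply: transfer; first exact: by_relpos_conv.
      by apply: by_relposZ; apply: by_relpos_f.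
    move=> V0 p pp op V W; rewrite specZ !(spec_conv pp op V0 _ _ hc) (spec_d pp op V0) //.
    by rewrite (spec_dV pp op V0) // (spec_f pp op V0) // rel_df ?hs // ev_vpow.
  split.
    (* The quotient by v - v^-1 is the commutator for i = j itself; it remains to check its product
       with v - v^-1. *)
    move=> i j hi hj; exists (e i *[c] f i - f i *[c] e i); split.
      apply: transfer; try by do ![apply: by_relposD | apply: by_relposN | apply: by_relposZ
        | apply: by_relpos_conv].
      move=> V0 p pp op V W; rewrite specZ !(specD, specN) !(spec_conv pp op V0 _ _ hc).
      have [h1 h2] : (0 < i <= n)%N /\ (0 < i.+1 <= n)%N by move: hi; clear; lia.
      rewrite (spec_e pp op V0) // (spec_f pp op V0) // !(spec_d pp op V0) // !(spec_dV pp op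
        V0) //.
      rewrite rmorphB /= !ev_vpow expr1z exprN1; apply: rel_ef_diag => //; first exact: hs.
      exact: sqrtC_prime_sq.
    case: (eqVneq i j) => [<-|ij]; first by rewrite scale1r.
    rewrite scale0r; apply/eqP; rewrite subr_eq0; apply/eqP.
    apply: transfer_conv => // V0 p pp op.
    by rewrite (spec_e pp op V0) // (spec_f pp op V0) // rel_ef // hs.
  split.
    move=> i j hi hj hij.
    have cross0 (g h : schur n E) :
        (flag n E -> forall p (pp : prime p) (op : odd p) (V W : flag n (prime_space d pp op)),
          twice_cross (sqrtC p%:R) (specialise g) (specialise h) V W = 0) ->
        g *[c] g *[c] h + h *[c] (g *[c] g) = vdbl2 *: (g *[c] h *[c] g).
      move=> H; apply/eqP; rewrite -subr_eq0 addrAC; apply/eqP.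
      apply: transfer_cross => //; first exact: by_relpos0.
      by move=> V0 p pp op V W; rewrite spec0 (H V0).
    have [ji|ij] : j = i.+1 \/ i = j.+1 by move: hij; clear; lia.
      have i0 : (0 < i)%N by case/andP: hi.
      have hi1 : (i.+1 < n)%N by rewrite -ji; case/andP: hj.
      rewrite ji in hj *; split; apply: cross0 => V0 p pp op V W.
        rewrite !(spec_e pp op V0) // rel_serre_e_up ?hs //; apply: sqrtC_prime_sq.
      rewrite !(spec_f pp op V0) // rel_serre_f_up ?hs //; apply: sqrtC_prime_sq.
    have j0 : (0 < j)%N by case/andP: hj.
    have hj1 : (j.+1 < n)%N by rewrite -ij; case/andP: hi.
    rewrite ij in hi *; split; apply: cross0 => V0 p pp op V W.
      rewrite !(spec_e pp op V0) // rel_serre_e_down ?hs //; apply: sqrtC_prime_sq.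
    rewrite !(spec_f pp op V0) // rel_serre_f_down ?hs //; apply: sqrtC_prime_sq.
  move=> i j hi hj hij.
  have far : (i.+1 < j)%N || (j.+1 < i)%N by move: hij; clear; lia.
  split; apply: transfer_conv => // V0 p pp op.
    by rewrite !(spec_e pp op V0) // rel_far_e // hs.
  by rewrite !(spec_f pp op V0) // rel_far_f // hs.
split.
  move=> i hi; apply: transfer_conv => // V0 p pp op.
  by rewrite (spec_d pp op V0) // (spec_t pp op V0) // rel_dt // hs.
split.
  move=> i hi; have [hi0 hi1] : (0 < i < n)%N /\ (i.+1 < n)%N by move: hi; clear; lia.
  split; apply: transfer_conv => // V0 p pp op; rewrite (spec_t pp op V0) //.
    by rewrite (spec_e pp op V0) // rel_et // hs.
  by rewrite (spec_f pp op V0) // rel_ft // hs.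
have hn1 : (1 < n)%N -> (0 < n.-1 < n)%N by clear; lia.
split; [|split; [|split]] => n1; have hn' := hn1 n1; apply: transfer_cross => //;
  try exact: by_relpos0; try exact: by_relpos_e; try exact: by_relpos_f;
  move=> V0 p pp op V W; rewrite ?spec0 (spec_t pp op V0) //.
- rewrite (spec_e pp op V0) // rel_eet ?hs //; apply: sqrtC_prime_sq.
- rewrite (spec_f pp op V0) // rel_fft ?hs //; apply: sqrtC_prime_sq.
- rewrite (spec_e pp op V0) // rel_tte ?hs //; apply: sqrtC_prime_sq.
- rewrite (spec_f pp op V0) // rel_ttf ?hs //; apply: sqrtC_prime_sq.
Qed.
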